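(* Let $K$ be an algebraically closed field of characteristic $p\ge 0$ with $p\ne 2$, and let $C\subset\mathbb{P}^2$ be a smooth plane curve over $K$ of degree $d\ge 4$. If $\mathrm{Aut}(C)$ is simple and $|\mathrm{Aut}(C)|$ is even, then $\mathrm{Aut}(C)=G_n(C)$ for some even integer $n\ge 2$. For example, if $p=0$, and $C$ is the Klein quartic or the Wiman sextic, then $\mathrm{Aut}(C)=G_2(C)$.
   Context: For $P\in\mathbb{P}^2$, $\pi_P:C\dashrightarrow\mathbb{P}^1$ is the projection from $P$, and $G[P]=\{\tau\in\mathrm{Bir}(C)\mid \pi_P\circ\tau=\pi_P\}$ (for smooth $C$, a finite subgroup of $\mathrm{Aut}(C)$ consisting of restrictions of linear transformations of $\mathbb{P}^2$). $P$ is called quasi-Galois if $|G[P]|\ge 2$. For smooth $C$ and $n\ge 2$, $G_n(C)=\langle G[P]\mid P\in\mathbb{P}^2 \text{ quasi-Galois with } |G[P]|=n\rangle\subset\mathrm{Aut}(C)$ is the subgroup generated by all these groups $G[P]$. The Klein quartic is the curve $X^3Y+Y^3Z+Z^3X=0$; the Wiman sextic is the curve $10X^3Y^3+9(X^5+Y^5)Z-45X^2Y^2Z^2-135XYZ^4+27Z^6=0$. *)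

(* Defs.v *)
From mathcomp Require Import all_boot all_fingroup all_algebra all_solvable.
From mathcomp Require Import boolp classical_sets functions cardinality.
From mathcomp Require Import mpoly.

Set Implicit Arguments.
Unset Strict Implicit.
Unset Printing Implicit Defensive.

Import GRing.Theory.
Local Open Scope classical_set_scope.
Local Open Scope ring_scope.

(* A point of P^2 is given by a nonzero vector x : 'rV[K]_3 of homogeneous
   coordinates; every notion below is invariant under scaling of x.  The curve
   C is given by the form F that defines it. *)

Section PlaneCurve.
Variable K : closedFieldType.
Implicit Types (F : {mpoly K[3]}) (x P : 'rV[K]_3).

Definition curve_points F : set 'rV[K]_3 :=
  [set x | x != 0 /\ F.@[x 0] = 0].

(* In characteristic p | d the Euler relation does not recover F from its
   partial derivatives, so singularity is tested at points of the curve.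
   The condition forces F != 0 and, for d > 0, F to be irreducible. *)
Definition smooth_plane_curve (d : nat) F : Prop :=
  F \is d.-homog /\
  forall x, curve_points F x -> exists i : 'I_3, (F^`M(i)).@[x 0] != 0.

Definition vanishes_on F (G : {mpoly K[3]}) : Prop :=
  forall x, curve_points F x -> G.@[x 0] = 0.

(* An m-tuple Phi of forms of the same degree, not all zero on C, represents
   the rational map x |-> (Phi_0(x) : ... : Phi_{m-1}(x)) from C to P^{m-1}. *)
Definition represents_ratmap F m (Phi : m.-tuple {mpoly K[3]}) : Prop :=
  (exists e : nat, forall i, tnth Phi i \is e.-homog) /\
  (exists i, ~ vanishes_on F (tnth Phi i)).

Definition same_ratmap F m (Phi Psi : m.-tuple {mpoly K[3]}) : Prop :=
  [/\ represents_ratmap F Phi, represents_ratmap F Psi &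
   forall i j,
     vanishes_on F (tnth Phi i * tnth Psi j - tnth Phi j * tnth Psi i)].

(* A rational map is the set of all the tuples that represent it. *)
Definition ratmap (m : nat) := set (m.-tuple {mpoly K[3]}).

Definition ratmap_of F m (Phi : m.-tuple {mpoly K[3]}) : ratmap m :=
  [set Psi | same_ratmap F Phi Psi].

Definition ratmap_id F : ratmap 3 := ratmap_of F [tuple 'X_i | i < 3].

Definition compose_forms m (Phi : m.-tuple {mpoly K[3]})
    (Psi : 3.-tuple {mpoly K[3]}) : m.-tuple {mpoly K[3]} :=
  [tuple (tnth Phi i) \mPo Psi | i < m].

(* sigma \o tau; only representatives whose substitution does not vanish
   identically on C contribute, by the definition of same_ratmap. *)
Definition ratmap_comp F m (sigma : ratmap m) (tau : ratmap 3) : ratmap m :=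
  [set Theta | exists Phi Psi,
     [/\ sigma Phi, tau Psi & same_ratmap F (compose_forms Phi Psi) Theta]].

Definition rational_selfmap F : set (ratmap 3) :=
  [set sigma | exists Phi, [/\ represents_ratmap F Phi,
     vanishes_on F (F \mPo Phi) & sigma = ratmap_of F Phi]].

Definition regular_at m (sigma : ratmap m) x : Prop :=
  exists Phi, sigma Phi /\ exists i, (tnth Phi i).@[x 0] != 0.

Definition regular_selfmap F : set (ratmap 3) :=
  [set sigma | rational_selfmap F sigma /\
     forall x, curve_points F x -> regular_at sigma x].

Definition mutually_inverse F (sigma tau : ratmap 3) : Prop :=
  ratmap_comp F sigma tau = ratmap_id F /\
  ratmap_comp F tau sigma = ratmap_id F.

Definition curve_Bir F : set (ratmap 3) :=
  [set sigma | rational_selfmap F sigma /\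
     exists2 tau, rational_selfmap F tau & mutually_inverse F sigma tau].

Definition curve_Aut F : set (ratmap 3) :=
  [set sigma | regular_selfmap F sigma /\
     exists2 tau, regular_selfmap F tau & mutually_inverse F sigma tau].

(* Projection from P onto the line X_i = 0, where i is an index with P_i != 0,
   in the two coordinates of that line: the point x goes to P_i x - x_i P. *)
Definition projection_forms P : 2.-tuple {mpoly K[3]} :=
  let i := odflt ord0 [pick i | P 0 i != 0] in
  [tuple P 0 i *: 'X_(lift i k) - P 0 (lift i k) *: 'X_i | k < 2].

Definition projection F P : ratmap 2 := ratmap_of F (projection_forms P).

(* G[P] *)
Definition galois_at F P : set (ratmap 3) :=
  [set tau | curve_Bir F tau /\
     ratmap_comp F (projection F P) tau = projection F P].

Definition curve_Bir_subgroup F (H : set (ratmap 3)) : Prop :=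
  [/\ H `<=` curve_Bir F, H (ratmap_id F),
      (forall sigma tau, H sigma -> H tau -> H (ratmap_comp F sigma tau)) &
      (forall sigma, H sigma ->
         exists2 tau, H tau & mutually_inverse F sigma tau)].

(* G_n(C), for n >= 2; then |G[P]| = n implies that P is quasi-Galois. *)
Definition quasi_galois_group F (n : nat) : set (ratmap 3) :=
  smallest (curve_Bir_subgroup F)
    (\bigcup_(P in [set P | P != 0 /\ (galois_at F P #= `I_n)%card])
       galois_at F P).

(* phi is an isomorphism from the finite group G onto the group A of rational
   self-maps of C under composition. *)
Definition group_iso F (gT : finGroupType) (G : {group gT})
    (A : set (ratmap 3)) (phi : gT -> ratmap 3) : Prop :=
  [/\ {in G &, injective phi},
      phi @` [set g | g \in G] = A &
      {in G &, forall g h, phi (g * h)%g = ratmap_comp F (phi g) (phi h)}].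

End PlaneCurve.

Section Examples.
Variable K : closedFieldType.
Local Notation X := 'X_(0 : 'I_3).
Local Notation Y := 'X_(1 : 'I_3).
Local Notation Z := 'X_(2 : 'I_3).

Definition Klein_quartic : {mpoly K[3]} :=
  X ^+ 3 * Y + Y ^+ 3 * Z + Z ^+ 3 * X.

Definition Wiman_sextic : {mpoly K[3]} :=
  10%:R * X ^+ 3 * Y ^+ 3 + 9%:R * (X ^+ 5 + Y ^+ 5) * Z
  - 45%:R * X ^+ 2 * Y ^+ 2 * Z ^+ 2 - 135%:R * X * Y * Z ^+ 4
  + 27%:R * Z ^+ 6.

End Examples.
Arguments Klein_quartic K : clear implicits.
Arguments Wiman_sextic K : clear implicits.

(* Main.v *)
(* Let L be a line that meets C transversally in q_1, ..., q_d, let sigma be a birational self-map of C and let p_i be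
   the preimage of q_i.  For another line N through q_k, the pullback of N / L is regular outside the p_i with i <> k
   and has at most simple poles there.  By the residue theorem these d - 1 points impose dependent conditions on the
   forms of degree d - 3, and so they lie on a line.  Hence all the p_i lie on one line l, the quotients
   l X_j(sigma) / L(sigma) are regular, i.e. linear forms on C, and sigma is linear.  So Bir(C) = Aut(C) is a group of
   matrices, in which G[P] consists of the homologies r + lambda P with center P.

   An involution in PGL_3 is a homology; its center P has |G[P]| = n even.  As G_n(C) is normal and nontrivial, it is
   Aut(C) when Aut(C) is simple.

   For the two examples put Gamma = G_2(C), which is normal in Aut(C), and let g in Gamma be diagonal of prime order p
   (7 for the Klein quartic, 5 for the Wiman sextic).  The flexes fixed by g lie in a single Gamma-orbit O, and their
   number is positive and less than p.  An automorphism maps O onto a Gamma-orbit with as many elements, prime to p,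
   which thus contains a flex fixed by g and is O again.  It remains to see that the stabilizer in Aut(C) of one flex
   of O consists of diagonal matrices that are commutators of elements of Gamma. *)
Require Import Defs.
From HB Require Import structures.
From mathcomp Require Import all_boot all_fingroup all_algebra all_solvable.
From mathcomp Require Import separable zify ring.
From mathcomp Require Import boolp classical_sets functions cardinality.
From mathcomp Require Import mpoly.
Set Implicit Arguments.
Unset Strict Implicit.
Unset Printing Implicit Defensive.
Import GRing.Theory.
Local Open Scope ring_scope.

(** Fix a point O off C and coordinates in which O = (0 : 1 : 0). Then C is the zero set of a
    polynomial f(x, y), monic in y, whose degree in y equals its total degree, and division by f
    respects total degree. All the geometry is done in this chart. If f does not divide g,
    elimination gives c = u f + v g with c nonzero in K[x]; this yields the Nullstellensatz on C,
    the finiteness of zeros and the generic fibres. The residue theorem becomes a trace identity: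
    the coefficient of y^(d-1) in the remainder of h modulo f is the trace of h / f_y, and its
    values at the abscissas of the poles are tied by Lagrange interpolation. Forms of degree d - 3
    are those that cut out the regular differentials. The bound d >= 4 makes two of the lines
    through d - 1 points share two points. In the examples the order of Aut(C) is never computed:
    the flexes are the zeros of the Hessian on C, a finite set stable under Aut(C), on which orbits
    can be counted modulo p. That |G[P]| is exactly 2 is read off from the second-order terms of F
    at P along the polar line of P. *)

Local Notation "F .[: p ]" := (F.@[p 0]) (at level 2, p at level 200, format "F .[:  p ]").

(** * Bivariate polynomials *)

Section Bivariate.
Variable R : comNzRingType.
Implicit Types (g h : {poly {poly R}}) (x y : R).

(** The outer variable is y and the inner one x, so this bounds the total degree strictly by [n].
    Truncated subtraction forces the coefficients of y^i with i >= n to vanish. *)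
Definition tdeg_lt (n : nat) g : Prop := forall i, (size (g`_i)%R <= n - i)%N.

(** The homogeneous part of degree [n], read at x = 1. Its roots are the points at infinity other
    than (0 : 1 : 0). *)
Definition top (n : nat) g : {poly R} := \poly_(i < n.+1) g`_i`_(n - i).

(** Restriction to a vertical line, that is, to a line through the centre of projection (0 : 1 :
    0). *)
Definition fiber x g : {poly R} := map_poly (horner_eval x) g.
HB.instance Definition _ x := GRing.RMorphism.copy (fiber x) (map_poly (horner_eval x)).

Lemma coef_fiber x g i : (fiber x g)`_i = (g`_i).[x].
Proof. by rewrite /fiber coef_map. Qed.

Lemma fiberB x g h : fiber x (g - h) = fiber x g - fiber x h.
Proof. by rewrite /fiber raddfB. Qed.

Lemma fiberD x g h : fiber x (g + h) = fiber x g + fiber x h.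
Proof. by rewrite /fiber raddfD. Qed.

Lemma fiberM x g h : fiber x (g * h) = fiber x g * fiber x h.
Proof. by rewrite /fiber rmorphM. Qed.

Lemma fiberX x : fiber x 'X = 'X.
Proof. by rewrite /fiber map_polyX. Qed.

Lemma fiberC x (c : {poly R}) : fiber x c%:P = (c.[x])%:P.
Proof. by rewrite /fiber map_polyC. Qed.

Lemma fiber_monic x g : g \is monic -> fiber x g \is monic.
Proof. exact: monic_map. Qed.

Lemma size_fiber_monic x g : g \is monic -> size (fiber x g) = size g.
Proof. by move=> mg; rewrite /fiber size_map_poly_id0 // (eqP mg) /horner_eval hornerC oner_neq0. Qed.

Lemma tdeg_ltW n m g : (n <= m)%N -> tdeg_lt n g -> tdeg_lt m g.
Proof. by move=> nm tg i; apply: leq_trans (tg i) _; lia. Qed.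

Lemma tdeg_lt_exists g : exists n, tdeg_lt n g.
Proof.
elim/poly_ind: g => [|g c [n tg]]; first by exists 0%N => i; rewrite coef0 size_poly0.
exists (n.+1 + size c)%N => i.
rewrite coefD coefMX coefC; case: i => [|i] /=; first by rewrite add0r; lia.
by rewrite addr0; apply: leq_trans (tg i) _; lia.
Qed.

Lemma tdeg_lt0 g : tdeg_lt 0 g -> g = 0.
Proof. by move=> tg; apply/polyP => i; rewrite coef0; apply/eqP; rewrite -size_poly_leq0; exact: tg i. Qed.

Lemma tdeg_lt0r n : tdeg_lt n 0.
Proof. by move=> i; rewrite coef0 size_poly0. Qed.

Lemma tdeg_ltD n g h : tdeg_lt n g -> tdeg_lt n h -> tdeg_lt n (g + h).
Proof. by move=> tg th i; rewrite coefD (leq_trans (size_polyD _ _)) // geq_max tg th. Qed.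

Lemma tdeg_ltN n g : tdeg_lt n g -> tdeg_lt n (- g).
Proof. by move=> tg i; rewrite coefN size_polyN. Qed.

Lemma tdeg_ltB n g h : tdeg_lt n g -> tdeg_lt n h -> tdeg_lt n (g - h).
Proof. by move=> tg th; apply: tdeg_ltD => //; apply: tdeg_ltN. Qed.

Lemma tdeg_ltM n m g h : tdeg_lt n g -> tdeg_lt m.+1 h -> tdeg_lt (n + m) (g * h).
Proof.
move=> tg th i; rewrite coefM.
apply: (big_ind (fun p : {poly R} => size p <= n + m - i)%N) => [|p q sp sq|j _].
- by rewrite size_poly0.
- by rewrite (leq_trans (size_polyD _ _)) // geq_max sp sq.
have [->|gj0] := eqVneq g`_j 0; first by rewrite mul0r size_poly0.
have [->|hj0] := eqVneq h`_(i - j) 0; first by rewrite mulr0 size_poly0.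
apply: leq_trans (size_polyMleq _ _) _.
move: (tg j) (th (i - j)%N) (ltn_ord j) gj0 hj0; rewrite -!size_poly_gt0; move: (size g`_j) (size h`_(i - j)) => a b.
lia.
Qed.

Lemma tdeg_ltC n (c : {poly R}) : (size c <= n)%N -> tdeg_lt n c%:P.
Proof. by move=> sc i; rewrite coefC; case: i => [|i] /=; rewrite ?subn0 // size_poly0. Qed.

Lemma coef_ge (p : {poly R}) n i : (size p <= n)%N -> (n <= i)%N -> p`_i = 0.
Proof. by move=> sp ni; rewrite nth_default // (leq_trans sp). Qed.

Lemma coefM_top (p q : {poly R}) a b : (size p <= a.+1)%N -> (size q <= b.+1)%N ->
  (p * q)`_(a + b) = p`_a * q`_b.
Proof.
move=> sp sq; rewrite coefM.
have ha : (a < (a + b).+1)%N by lia.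
rewrite (bigD1 (Ordinal ha)) //= addKn big1 ?addr0 // => j /eqP ja.
have [lt|ge] := ltnP a j; first by rewrite (coef_ge sp lt) mul0r.
have jna : (j : nat) <> a by move=> e; apply: ja; apply: val_inj.
by rewrite (coef_ge sq) ?mulr0 //; lia.
Qed.

Lemma coef_top n g i : tdeg_lt n.+1 g -> (i <= n)%N || (g`_i == 0).
Proof.
move=> tg; case: (leqP i n) => //= lt; rewrite -size_poly_leq0.
by apply: leq_trans (tg i) _; lia.
Qed.

Lemma topM n m g h : tdeg_lt n.+1 g -> tdeg_lt m.+1 h ->
  top (n + m) (g * h) = top n g * top m h.
Proof.
move=> tg th; apply/polyP => k; rewrite coef_poly.
have E : (top n g * top m h)`_k = \sum_(j < k.+1) (if (j <= n)%N then g`_j`_(n - j) else 0) *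
    (if (k - j <= m)%N then h`_(k - j)`_(m - (k - j)) else 0).
  by rewrite coefM; apply: eq_bigr => j _; rewrite !coef_poly !ltnS.
rewrite E ltnS; case: leqP => knm; last first.
  rewrite big1 // => j _; case: leqP => jn; last by rewrite mul0r.
  by case: leqP => kj; rewrite ?mulr0 //; exfalso; lia.
rewrite coefM coef_sum; apply: eq_bigr => j _.
have := ltn_ord j => jk.
case: leqP => jn; last first.
  by move: (coef_top j tg); rewrite leqNgt jn /= => /eqP ->; rewrite !mul0r coef0.
case: leqP => kj; last first.
  by move: (coef_top (k - j) th); rewrite leqNgt kj /= => /eqP ->; rewrite !mulr0 coef0.
have -> : (n + m - k = (n - j) + (m - (k - j)))%N by lia.
by apply: coefM_top; [move: (tg j)|move: (th (k - j)%N)]; lia.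
Qed.

Lemma topB n g h : top n (g - h) = top n g - top n h.
Proof. by apply/polyP => i; rewrite !(coefB, coef_poly); case: ifP; rewrite ?subr0. Qed.

Lemma top_eq0 n g : tdeg_lt n.+1 g -> top n g = 0 -> tdeg_lt n g.
Proof.
move=> tg /polyP e i.
have := tg i; rewrite leq_eqVlt => /orP[/eqP s|]; last by lia.
case: (leqP i n) => [le|]; last by lia.
have : (g`_i)`_(n - i) = 0.
  by move: (e i); rewrite coef_poly ltnS le coef0.
have : lead_coef g`_i = 0 -> size g`_i = 0%N by move/eqP; rewrite lead_coef_eq0 => /eqP ->; rewrite size_poly0.
rewrite /lead_coef s subSn //= => H /H; lia.
Qed.

Lemma monicM_small (S : nzRingType) (f w : {poly S}) : f \is monic -> (size (f * w)%R < size f)%N -> w = 0.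
Proof.
move=> mf; apply: contraTeq => w0.
rewrite size_monicM // -leqNgt; move: w0; rewrite -size_poly_gt0; lia.
Qed.

Lemma monic_div_uniq (S : nzRingType) (f w w' r r' : {poly S}) : f \is monic ->
  f * w + r = f * w' + r' -> (size r < size f)%N -> (size r' < size f)%N -> w = w' /\ r = r'.
Proof.
move=> mf e sr sr'; have E : w - w' = 0.
  apply: (monicM_small mf); have -> : f * (w - w') = r' - r.
    by apply/eqP; rewrite mulrBr subr_eq addrAC -[r' + _]addrC -e addrK.
  by apply: leq_ltn_trans (size_polyD _ _) _; rewrite size_polyN gtn_max sr' sr.
by move/subr0_eq: E => E; split=> //; move: e; rewrite E => /addrI.
Qed.

(** The leading term y^d of [f] already has total degree d, so cancelling the top y-term of [g]
    never raises the total degree. For n < d the last bound says that the quotient is zero. *)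
Lemma tdeg_div d (f : {poly {poly R}}) n g : f \is monic -> size f = d.+1 -> tdeg_lt d.+1 f ->
  tdeg_lt n g -> exists w r, [/\ g = f * w + r, (size r <= d)%N, tdeg_lt n r & tdeg_lt (n - d) w].
Proof.
move=> mf sf tf; have [s] := ubnP (size g); elim: s g => // s IH g sg tg.
case: (leqP (size g) d) => [le|gt].
  by exists 0, g; split=> //; [rewrite mulr0 add0r | exact: tdeg_lt0r].
set l := lead_coef g; set k := (size g).-1.
have sl : (size l <= n - k)%N by apply: tg.
have l0 : l != 0 by rewrite lead_coef_eq0 -size_poly_gt0; lia.
have kn : (k < n)%N by move: l0; rewrite -size_poly_gt0; lia.
set w1 : {poly {poly R}} := l *: 'X^(k - d).
have tw : tdeg_lt (n - d) w1.
  move=> i; rewrite coefZ coefXn; case: eqP => [->|_]; rewrite ?mulr1 ?mulr0 ?size_poly0 //.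
  by rewrite /k in kn sl *; lia.
have tfw : tdeg_lt n (f * w1).
  have -> : (n = (n - d) + d)%N by rewrite /k in kn; lia.
  by rewrite mulrC; apply: tdeg_ltM.
have [|w [r [e sr tr tw2]]] := IH (g - f * w1) _ (tdeg_ltB tg tfw).
  have sw1 : size w1 = (k - d).+1.
    by rewrite /w1 -mul_polyC mulrC size_monicM ?monicXn ?polyC_eq0 // size_polyXn size_polyC l0 addn1.
  have sw : size (f * w1) = size g.
    rewrite size_monicM ?sw1 // -?size_poly_eq0 ?sw1 // sf.
    by rewrite /k; move: gt; move: (size g) => a; lia.
  have : (size (g - f * w1)%R <= k)%N.
    apply/leq_sizeP => j; rewrite leq_eqVlt => /orP[/eqP <-|kj].
      have -> : k = ((size f).-1 + (k - d))%N by rewrite sf /= /k; lia.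
      rewrite coefB.
      have -> : (f * w1)`_((size f).-1 + (k - d)) = l.
        by rewrite /w1 -scalerAr coefZ coefMXn ltnNge leq_addl /= addnK -/(lead_coef f) (eqP mf) mulr1.
      have -> : ((size f).-1 + (k - d) = (size g).-1)%N by rewrite sf /k; lia.
      by rewrite -/(lead_coef g) subrr.
    have gj : (size g <= j)%N by move: kj; rewrite /k; case: (size g).
    by rewrite coefB !nth_default ?subr0 // ?sw.
  by move=> H; apply: leq_ltn_trans H _; rewrite /k; move: sg gt; move: (size g) => a; lia.
exists (w1 + w), r; split=> //; last exact: tdeg_ltD.
by rewrite mulrDr -addrA -e addrCA subrr addr0.
Qed.

Lemma tdeg_quot d (f : {poly {poly R}}) n w : f \is monic -> size f = d.+1 -> tdeg_lt d.+1 f ->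
  tdeg_lt n (f * w) -> tdeg_lt (n - d) w.
Proof.
move=> mf sf tf /(tdeg_div mf sf tf) [w' [r [e sr _ tw]]].
by have [|||-> _ //] := @monic_div_uniq _ f w w' 0 r mf; rewrite ?addr0 ?size_poly0 ?sf.
Qed.

End Bivariate.

(** * Elimination and intersection of plane curves over an algebraically closed field *)

Section BivariateField.
Variable K : closedFieldType.
Implicit Types (f g F : {poly {poly K}}) (x y : K).

Lemma nonroot_exists (p : {poly K}) : p != 0 -> exists x, p.[x] != 0.
Proof. by move/closed_nonrootP. Qed.

Lemma root_exists (p : {poly K}) : (1 < size p)%N -> exists x, p.[x] = 0.
Proof. move=> sp; have /closed_rootP[x /rootP px] : size p != 1%N by rewrite gtn_eqF.
by exists x. Qed.

Lemma no_common_root_coprimep (p q : {poly K}) :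
  (p != 0) || (q != 0) -> (forall y, p.[y] = 0 -> q.[y] = 0 -> False) -> coprimep p q.
Proof.
move=> pq0 H; rewrite /coprimep; apply/negPn/negP => /closed_rootP[y].
by rewrite root_gcd => /andP[/rootP py /rootP qy]; exact: H py qy.
Qed.

Lemma factor_root (p : {poly K}) x : p.[x] = 0 -> exists q, p = ('X - x%:P) * q.
Proof. by move/rootP/factor_theorem => [q ->]; exists q; rewrite mulrC. Qed.

(** Divisibility is tested at one root at a time, multiplicity included: since [h] is a unit at y,
    [a] vanishes there too, and one linear factor is cancelled on both sides before the induction
    goes on. *)
Lemma dvd_by_local_units (F0 a : {poly K}) : F0 != 0 ->
  (forall y, F0.[y] = 0 -> exists h w, h.[y] != 0 /\ h * a = F0 * w) -> exists w, a = F0 * w.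
Proof.
have [s] := ubnP (size F0); elim: s F0 a => // s IH F0 a sF F00 H.
have [sF1|sF1] := eqVneq (size F0) 1%N.
  have [c c0 ->] := size_poly1P _ (introT eqP sF1).
  exists (c^-1%:P * a); by rewrite mulrA -polyCM divff // mul1r.
have [y /factor_root [F1 eF]] : exists y, F0.[y] = 0.
  by case: (closed_rootP _ sF1) => y /rootP ?; exists y.
have [h [w [hy e]]] : exists h w, h.[y] != 0 /\ h * a = F0 * w.
  by apply: H; rewrite eF !hornerE subrr mul0r.
have /factor_root [a1 ea] : a.[y] = 0.
  have /eqP : (h * a).[y] = 0 by rewrite e eF !hornerE subrr !mul0r.
  by rewrite hornerM mulf_eq0 (negPf hy) => /eqP.
have F10 : F1 != 0 by apply: contraNneq F00 => F10; rewrite eF F10 mulr0.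
have l0 : 'X - y%:P != 0 by rewrite polyXsubC_eq0.
have [||w1 ew1] := IH F1 a1 _ F10.
- by move: sF; rewrite eF size_monicM ?monicXsubC // size_XsubC.
- move=> z Fz; have [|h1 [w1 [hz e1]]] := H z; first by rewrite eF hornerM Fz mulr0.
  exists h1, w1; split=> //; apply: (mulfI l0).
  by rewrite mulrCA -ea e1 eF mulrA.
by exists w1; rewrite ea ew1 eF mulrA.
Qed.

Lemma fiber_lift x (t : {poly K}) : fiber x (map_poly polyC t) = t.
Proof. by apply/polyP => i; rewrite coef_fiber coef_map /= hornerC. Qed.

Lemma fiber_eq0 x g : fiber x g = 0 -> exists g1, g = ('X - x%:P)%:P * g1.
Proof.
move=> e; exists (map_poly (fun p => p %/ ('X - x%:P)) g); apply/polyP => i.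
rewrite coefCM coef_map_id0 ?div0p // mulrC divpK // dvdp_XsubCl.
by apply/rootP; rewrite -coef_fiber e coef0.
Qed.

Lemma fiberXsubC x z : fiber z ('X - x%:P)%:P = (z - x)%:P.
Proof. by rewrite fiberC !hornerE. Qed.

Lemma XsubC2_neq0 x : (('X - x%:P)%:P : {poly {poly K}}) != 0.
Proof. by rewrite polyC_eq0 polyXsubC_eq0. Qed.

Lemma fiberM_eval x y f g : (fiber x (f * g)).[y] = (fiber x f).[y] * (fiber x g).[y].
Proof. by rewrite fiberM hornerM. Qed.

Lemma fiberD_eval x y f g : (fiber x (f + g)).[y] = (fiber x f).[y] + (fiber x g).[y].
Proof. by rewrite fiberD hornerD. Qed.

Lemma fiberB_eval x y f g : (fiber x (f - g)).[y] = (fiber x f).[y] - (fiber x g).[y].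
Proof. by rewrite fiberB hornerD hornerN. Qed.

Lemma bezout_eval x y (c : {poly K}) (u v f g : {poly {poly K}}) : c%:P = u * f + v * g ->
  c.[x] = (fiber x u).[y] * (fiber x f).[y] + (fiber x v).[y] * (fiber x g).[y].
Proof. by rewrite -!fiberM_eval -fiberD_eval => <-; rewrite fiberC hornerC. Qed.

(* Gauss's lemma, by removing the roots of [c] one at a time. *)
Lemma gauss (c : {poly K}) f D E : f \is monic -> c != 0 -> c%:P * f = D * E ->
  exists D' E', [/\ f = D' * E', size D' = size D & size E' = size E].
Proof.
move=> mf; have [s] := ubnP (size c); elim: s c D E => // s IH c D E sc c0 e.
have [sc1|sc1] := eqVneq (size c) 1%N.
  have [k k0 ek] := size_poly1P _ (introT eqP sc1).
  have k20 : (k^-1%:P : {poly K}) != 0 by rewrite polyC_eq0 invr_eq0.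
  exists (k^-1%:P *: D), E; split; rewrite ?size_scale //.
  rewrite -scalerAl -e ek mul_polyC scalerA -polyCM mulVf // scale1r //.
have [x /factor_root [c1 ec]] : exists x, c.[x] = 0.
  by case: (closed_rootP _ sc1) => x /rootP ?; exists x.
have c10 : c1 != 0 by apply: contraNneq c0 => c10; rewrite ec c10 mulr0.
have sc2 : (size c1 < s)%N by move: sc; rewrite ec size_monicM ?monicXsubC // size_XsubC.
have e2 : ('X - x%:P)%:P * (c1%:P * f) = D * E by rewrite mulrA -polyCM -ec.
have : fiber x D * fiber x E = 0 by rewrite -fiberM -e2 fiberM fiberXsubC subrr mul0r.
have sX (g : {poly {poly K}}) : size (('X - x%:P)%:P * g) = size g.
  by rewrite mul_polyC size_scale // polyXsubC_eq0.
move/eqP; rewrite mulf_eq0 => /orP[/eqP /fiber_eq0 [D1 eD]|/eqP /fiber_eq0 [E1 eE]].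
  have [|D' [E' [ef s1 s2]]] := IH c1 D1 E sc2 c10.
    by apply: (mulfI (XsubC2_neq0 x)); rewrite e2 eD mulrA.
  by exists D', E'; rewrite eD sX.
have [|D' [E' [ef s1 s2]]] := IH c1 D E1 sc2 c10.
  by apply: (mulfI (XsubC2_neq0 x)); rewrite e2 eE mulrCA.
by exists D', E'; rewrite eE sX.
Qed.

(** Division by the monic [f] leaves a remainder r for which c r is a multiple of [f] of smaller
    degree in y; hence r = 0, and a nonzero element of K[x] can be cancelled. *)
Lemma monic_dvd_scale f g t (c : {poly K}) : f \is monic -> c != 0 ->
  c%:P * g = f * t -> exists w, g = f * w.
Proof.
move=> mf c0 e.
have e1 := Pdiv.RingMonic.rdivp_eq mf g; set w := Pdiv.Ring.rdivp g f in e1.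
set r := Pdiv.Ring.rmodp g f in e1.
have sr : (size r < size f)%N by apply: Pdiv.Ring.ltn_rmodpN0; apply: monic_neq0.
have E : f * (t - c%:P * w) = c%:P * r.
  by rewrite mulrBr -e e1 mulrDr [w * f]mulrC !mulrA [f * _]mulrC addrAC subrr add0r.
have : t - c%:P * w = 0.
  by apply: (monicM_small mf); rewrite E mul_polyC size_scale.
move=> z; move: E; rewrite z mulr0 => /esym/eqP; rewrite mulf_eq0 polyC_eq0 (negPf c0) /= => /eqP r0.
by exists w; rewrite e1 r0 addr0 mulrC.
Qed.

Definition irreducible_factors f := forall F1 F2 : {poly {poly K}}, f = F1 * F2 ->
  (size F1 <= 1)%N \/ (size F2 <= 1)%N.

(** If the gcd over K(x) is trivial, clearing denominators in the Bezout relation leaves c in K[x].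
    Otherwise Gauss's lemma turns the gcd into a factor of [f] of positive degree in y, so [f]
    itself divides [g]. The polynomial c acts as a resultant: only over its roots can the two curves
    meet. *)
Lemma irreducible_bezout f g : f \is monic -> irreducible_factors f ->
  ~ (exists w, g = f * w) -> exists (c : {poly K}) u v, c != 0 /\ c%:P = u * f + v * g.
Proof.
move=> mf irr ndiv; have f0 := monic_neq0 mf.
have [/Bezout_coprimepP [[u v] /= /eqpP [[c1 c2] /= /andP[c10 c20] e]]|ncop] := boolP (coprimep f g).
  exists c2, (c1 *: u), (c1 *: v); split=> //.
  by rewrite -!scalerAl -scalerDr e -mul_polyC mulr1.
case: ndiv; set D := gcdp f g.
have [[c1 E1] /= c10 e1] := elimT (Pdiv.WeakIdomain.dvdpP _ _) (dvdp_gcdl f g).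
have [[c2 E2] /= c20 e2] := elimT (Pdiv.WeakIdomain.dvdpP _ _) (dvdp_gcdr f g).
rewrite -mul_polyC in e1; rewrite -mul_polyC in e2.
have [E' [D' [ef sE sD]]] := gauss mf c10 e1.
have D0 : D != 0 by rewrite gcdp_eq0 (negPf f0).
have E10 : E1 != 0.
  apply: contraTneq c10 => E10; move: e1; rewrite E10 mul0r => /eqP.
  by rewrite mulf_eq0 (negPf f0) orbF polyC_eq0 negbK.
have sD1 : (1 < size D)%N by move: ncop; rewrite /coprimep -/D; move: D0; rewrite -size_poly_gt0; case: (size D) => [|[]].
case: (irr _ _ ef) => [|]; last by rewrite sD leqNgt sD1.
rewrite sE => sE1.
have /eqP sE11 : size E1 == 1%N by rewrite eqn_leq sE1 size_poly_gt0.
have [k k0 ek] := size_poly1P _ (introT eqP sE11).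
apply: (@monic_dvd_scale f g (E2 * c1%:P) (k * c2)) => //; first by rewrite mulf_neq0.
by rewrite polyCM -ek -mulrA e2 mulrCA -e1 mulrA mulrC.
Qed.

Lemma top_small (R : comNzRingType) n (g : {poly {poly R}}) : tdeg_lt n g -> top n g = 0.
Proof.
move=> tg; apply/polyP => i; rewrite coef_poly coef0; case: ifP => // _.
by apply: coef_ge (tg i) _.
Qed.

Lemma tdeg_exact (R : comNzRingType) (g : {poly {poly R}}) : g != 0 -> exists n, tdeg_lt n.+1 g /\ top n g != 0.
Proof.
have [n] := tdeg_lt_exists g; elim: n => [/tdeg_lt0 -> /eqP //|n IH tg g0].
have [e|] := eqVneq (top n g) 0; last by exists n.
by apply: IH => //; apply: top_eq0.
Qed.

(** Each factor contains a pure power of y, so its total degree is at least its degree in y. Top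
    forms multiply without cancellation, so the total degrees add up to at most d and no slack
    remains. *)
Lemma tdeg_factor d d1 d2 F1 F2 : F1 \is monic -> F2 \is monic -> size F1 = d1.+1 -> size F2 = d2.+1 ->
  (d1 + d2 = d)%N -> tdeg_lt d.+1 (F1 * F2) -> tdeg_lt d1.+1 F1 /\ tdeg_lt d2.+1 F2.
Proof.
move=> m1 m2 s1 s2 ed tf.
have [n1 [t1 T1]] := tdeg_exact (monic_neq0 m1).
have [n2 [t2 T2]] := tdeg_exact (monic_neq0 m2).
have le (n e : nat) (F : {poly {poly K}}) : F \is monic -> size F = e.+1 -> tdeg_lt n.+1 F -> (e <= n)%N.
  by move=> mF sF /(_ e); move: (eqP mF); rewrite /lead_coef sF /= => ->; rewrite size_poly1; lia.
have le1 := le _ _ _ m1 s1 t1; have le2 := le _ _ _ m2 s2 t2.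
suff H : (n1 + n2 <= d)%N.
  have -> : d1 = n1 by lia.
  by have -> : d2 = n2 by lia.
rewrite leqNgt; apply/negP => lt.
have : top (n1 + n2) (F1 * F2) = 0 by apply: top_small; apply: tdeg_ltW tf.
by move/eqP; rewrite topM // mulf_eq0 (negPf T1) (negPf T2).
Qed.

Lemma coprime_of_no_common_zero F1 F2 : F1 \is monic -> F2 \is monic ->
  (forall x y, (fiber x F1).[y] = 0 -> (fiber x F2).[y] = 0 -> False) -> coprimep F1 F2.
Proof.
move=> m1 m2 nz; apply/negPn/negP => ncop; set D := gcdp F1 F2.
have [[c1 E1] /= c10 e1] := elimT (Pdiv.WeakIdomain.dvdpP _ _) (dvdp_gcdl F1 F2).
have [[c2 E2] /= c20 e2] := elimT (Pdiv.WeakIdomain.dvdpP _ _) (dvdp_gcdr F1 F2).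
rewrite -mul_polyC -/D in e1; rewrite -mul_polyC -/D in e2.
have D0 : D != 0 by rewrite gcdp_eq0 (negPf (monic_neq0 m1)).
have sD1 : (1 < size D)%N by move: ncop; rewrite /coprimep -/D; move: D0; rewrite -size_poly_gt0; case: (size D) => [|[]].
have l0 : lead_coef D != 0 by rewrite lead_coef_eq0.
have [x] := nonroot_exists (mulf_neq0 l0 (mulf_neq0 c10 c20)).
rewrite !hornerM !mulf_eq0 !negb_or => /and3P[lx c1x c2x].
have sDx : size (fiber x D) = size D by rewrite /fiber size_map_poly_id0.
have [|y Dy] := @root_exists (fiber x D); first by rewrite sDx.
apply: (nz x y).
  move/(congr1 (fun g => (fiber x g).[y])): e1; rewrite !rmorphM /= !hornerM Dy mulr0 fiberC hornerC.
  by move/eqP; rewrite mulf_eq0 (negPf c1x) => /eqP.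
move/(congr1 (fun g => (fiber x g).[y])): e2; rewrite !rmorphM /= !hornerM Dy mulr0 fiberC hornerC.
by move/eqP; rewrite mulf_eq0 (negPf c2x) => /eqP.
Qed.

(** The roots of c are removed from c = u F1 + v F2 one at a time. Over a root x the fibres of F1
    and F2 are coprime and u F1 + v F2 vanishes, so (u, v) restricts to (F2 t, - F1 t). Subtracting
    this, with t lifted as constant in x, makes u and v divisible by X - x. *)
Lemma unit_ideal_of_no_common_zero F1 F2 : F1 \is monic -> F2 \is monic ->
  (forall x y, (fiber x F1).[y] = 0 -> (fiber x F2).[y] = 0 -> False) ->
  exists u v, 1 = u * F1 + v * F2.
Proof.
move=> m1 m2 nz.
have /Bezout_coprimepP [[u v] /= /eqpP [[c1 c2] /= /andP[c10 c20] e]] := coprime_of_no_common_zero m1 m2 nz.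
have {e} : c2%:P = (c1 *: u) * F1 + (c1 *: v) * F2 by rewrite -!scalerAl -scalerDr e -mul_polyC mulr1.
move: (c1 *: u) (c1 *: v) => {c1 c10 u v} u v; have [s] := ubnP (size c2); elim: s c2 c20 u v => // s IH c c0 u v sc e.
have [sc1|sc1] := eqVneq (size c) 1%N.
  have [k k0 ek] := size_poly1P _ (introT eqP sc1).
  exists (k^-1%:P *: u), (k^-1%:P *: v).
  by rewrite -!scalerAl -scalerDr -e ek -mul_polyC -polyCM -polyCM mulVf.
have [x /factor_root [c1 ec]] : exists x, c.[x] = 0.
  by case: (closed_rootP _ sc1) => x /rootP ?; exists x.
have c10 : c1 != 0 by apply: contraNneq c0 => c10; rewrite ec c10 mulr0.
have sc2 : (size c1 < s)%N by move: sc; rewrite ec size_monicM ?monicXsubC // size_XsubC.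
have ex : fiber x u * fiber x F1 + fiber x v * fiber x F2 = 0.
  by rewrite -!fiberM -fiberD -e ec fiberC hornerM hornerXsubC subrr mul0r.
have cop : coprimep (fiber x F2) (fiber x F1).
  apply: no_common_root_coprimep; first by rewrite monic_neq0 // fiber_monic.
  by move=> y h1 h2; exact: nz h2 h1.
have : fiber x F2 %| fiber x u * fiber x F1.
  by move/eqP: ex; rewrite addr_eq0 => /eqP ->; rewrite dvdpNr dvdp_mull.
rewrite (Gauss_dvdpl _ cop) => /dvdpP [t et].
set T := map_poly polyC t.
have /fiber_eq0 [u1 eu1] : fiber x (u - F2 * T) = 0.
  by rewrite fiberB fiberM fiber_lift et mulrC subrr.
have /fiber_eq0 [v1 ev1] : fiber x (v + F1 * T) = 0.
  rewrite fiberD fiberM fiber_lift.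
  apply: (mulIf (monic_neq0 (fiber_monic x m2))); rewrite mul0r -ex et mulrDl addrC; congr (_ + _).
  by rewrite mulrC mulrA mulrAC -mulrA mulrC; ring.
apply: (IH c1 c10 u1 v1) => //; apply: (mulfI (XsubC2_neq0 x)).
rewrite -polyCM -ec e mulrDr !mulrA -eu1 -ev1; ring.
Qed.

(** The part of Bezout's theorem that is needed: two curves of positive degree have a common point,
    possibly at infinity. Without one, the quotient ring by F1 F2 would split by an element E that
    is 0 modulo F1 and 1 modulo F2, and the degree of E leads to a contradiction. *)
Lemma plane_curves_meet d1 d2 F1 F2 : F1 \is monic -> F2 \is monic ->
  size F1 = d1.+1 -> size F2 = d2.+1 -> (0 < d1)%N -> (0 < d2)%N ->
  tdeg_lt d1.+1 F1 -> tdeg_lt d2.+1 F2 ->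
  (forall x y, (fiber x F1).[y] = 0 -> (fiber x F2).[y] = 0 -> False) ->
  (forall y, (top d1 F1).[y] = 0 -> (top d2 F2).[y] = 0 -> False) -> False.
Proof.
move=> m1 m2 s1 s2 d10 d20 t1 t2 nz nzt.
have [u [v e]] := unit_ideal_of_no_common_zero m1 m2 nz.
set f := F1 * F2.
have mf : f \is monic by rewrite monicMl.
have sf : size f = (d1 + d2).+1 by rewrite /f size_monicM ?monic_neq0 // s1 s2; lia.
have tf : tdeg_lt (d1 + d2).+1 f by rewrite /f -addSn; apply: tdeg_ltM.
have [n0 tn0] := tdeg_lt_exists (u * F1).
have [w [E [eE sE tE _]]] := tdeg_div mf sf tf tn0.
have E1 : E = F1 * (u - F2 * w) by rewrite mulrBr mulrA -/f [F1 * u]mulrC eE addrC addKr.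
have E2 : 1 - E = F2 * (v + F1 * w).
  have -> : E = u * F1 - f * w by rewrite eE addrC addKr.
  by rewrite e /f; ring.
have topmon (n : nat) (F : {poly {poly K}}) : F \is monic -> size F = n.+1 -> tdeg_lt n.+1 F -> top n F \is monic /\ size (top n F) = n.+1.
  move=> mF sF tF.
  have c1 : (F`_n)`_(n - n) = 1.
    by move: (eqP mF); rewrite /lead_coef sF /= => ->; rewrite subnn coef1.
  have sT : size (top n F) = n.+1 by rewrite /top size_poly_eq // c1 oner_neq0.
  by split=> //; apply/eqP; rewrite /lead_coef sT /= coef_poly ltnSn.
have [mt1 st1] := topmon _ _ m1 s1 t1; have [mt2 st2] := topmon _ _ m2 s2 t2.
have copt : coprimep (top d1 F1) (top d2 F2).
  by apply: no_common_root_coprimep => //; rewrite (monic_neq0 mt1).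
(* In positive degree the top form of E is divisible by those of F1 and F2. These are coprime, so
   their product of degree d1 + d2 divides it; but E has degree less than d1 + d2 in y. So the top
   form is zero and the bound on E drops by one. *)
have red n : tdeg_lt n.+2 E -> tdeg_lt n.+1 E.
  move=> tn; apply: top_eq0 => //.
  have tq (d : nat) (F w' G : {poly {poly K}}) : (0 < d)%N -> F \is monic -> size F = d.+1 -> tdeg_lt d.+1 F -> tdeg_lt n.+2 G -> G = F * w' ->
      top d F %| top n.+1 G.
    move=> d0 mF sF tF tG eG.
    have tw' : tdeg_lt (n.+2 - d) w' by apply: (tdeg_quot mF sF tF); rewrite -eG.
    have [le|gt] := leqP d n.+1.
      have -> : (n.+1 = d + (n.+1 - d))%N by lia.
      rewrite eG topM ?dvdp_mulr //.
      by have <- : (n.+2 - d = (n.+1 - d).+1)%N by lia.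
    have w0 : w' = 0 by apply: tdeg_lt0; move: tw'; have -> : (n.+2 - d = 0)%N by lia.
    by rewrite eG w0 mulr0 (_ : top n.+1 0 = 0) ?dvdp0 //; apply: top_small; apply: tdeg_lt0r.
  have D1 := tq _ _ _ _ d10 m1 s1 t1 tn E1.
  have t1E : tdeg_lt n.+2 (1 - E).
    by apply: tdeg_ltB => //; rewrite -polyC1; apply: tdeg_ltC; rewrite size_poly1.
  have D2 := tq _ _ _ _ d20 m2 s2 t2 t1E E2.
  have top1 : top n.+1 (1 : {poly {poly K}}) = 0.
    by apply: top_small; rewrite -polyC1; apply: tdeg_ltC; rewrite size_poly1.
  rewrite topB top1 sub0r dvdpNr in D2.
  have : top d1 F1 * top d2 F2 %| top n.+1 E by rewrite Gauss_dvdp ?D1.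
  apply: contraTeq => T0; apply/negP => /(dvdp_leq T0).
  rewrite size_monicM ?monic_neq0 // st1 st2.
  have : (size (top n.+1 E) <= d1 + d2)%N.
    apply/leq_sizeP => j dj; rewrite coef_poly (coef_ge sE dj) coef0; by case: ifP.
  by move=> H1 H2; have := leq_trans H2 H1; lia.
(* The descent ends with E constant. A constant multiple of F1 is zero, and then 1 would be a
   multiple of F2. *)
have tE1 : tdeg_lt 1 E.
  have [m tm] : exists m, tdeg_lt m.+1 E by exists n0; apply: tdeg_ltW tE.
  by elim: m tm => // m IH /red.
have sE1 : (size E <= 1)%N.
  apply/leq_sizeP => j j0; apply/eqP; rewrite -size_poly_leq0; apply: leq_trans (tE1 j) _; lia.
have q0 : u - F2 * w = 0.
  by apply: (monicM_small m1); rewrite -E1 s1; apply: leq_ltn_trans sE1 _.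
move: E2; rewrite E1 q0 mulr0 subr0 => E2.
have : v + F1 * w = 0 by apply: (monicM_small m2); rewrite -E2 size_poly1 s2.
by move=> z; move: E2; rewrite z mulr0 => /eqP; rewrite oner_eq0.
Qed.

End BivariateField.

(** * Forms and points of the plane *)

Section PolynomialForms.
Variable R : comNzRingType.

Lemma mpoly_alg_ind n (P : {mpoly R[n]} -> Prop) :
  (forall c, P c%:MP) -> (forall i, P 'X_i) ->
  (forall p q, P p -> P q -> P (p + q)) -> (forall p q, P p -> P q -> P (p * q)) ->
  forall p, P p.
Proof.
move=> PC PX PD PM p; have P1 : P 1 by rewrite -mpolyC1; exact: PC.
rewrite (mpolyE p); apply: (big_ind P) => // [|m _].
  by rewrite -mpolyC0; exact: PC.
rewrite -mul_mpolyC; apply: (PM) => //; rewrite mpolyXE_id.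
apply: (big_ind P) => [//||i _]; first exact: PM.
elim: (m i) => [|k IH]; first by rewrite expr0.
by rewrite exprS; apply: (PM).
Qed.

Lemma comp_mpolyM n k (T : n.-tuple {mpoly R[k]}) (p q : {mpoly R[n]}) :
  (p * q) \mPo T = (p \mPo T) * (q \mPo T).
Proof. exact: rmorphM. Qed.

Lemma comp_mpolyX1 n k (T : n.-tuple {mpoly R[k]}) i : 'X_i \mPo T = tnth T i.
Proof. by rewrite comp_mpolyXU (tnth_nth 0). Qed.

Lemma mderivXi n (i j : 'I_n) : ('X_i : {mpoly R[n]})^`M(j) = (i == j)%:R.
Proof.
rewrite mderivX mnm1E; case: eqP => [->|_]; last by rewrite scale0r.
by rewrite scale1r (_ : (U_(j) - U_(j))%MM = 0%MM) ?mpolyX0 //; apply/mnmP => k; rewrite mnmBE subnn mnm0E.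
Qed.

Lemma mderiv_comp n k (T : n.-tuple {mpoly R[k]}) i (p : {mpoly R[n]}) :
  (p \mPo T)^`M(i) = \sum_j (p^`M(j) \mPo T) * (tnth T j)^`M(i).
Proof.
move: p; apply: mpoly_alg_ind => [c|j|p q IHp IHq|p q IHp IHq].
- by rewrite comp_mpolyC mderivC big1 // => j _; rewrite mderivC comp_mpoly0 mul0r.
- rewrite comp_mpolyX1 (bigD1 j) //= big1 ?addr0 => [|l lj].
    by rewrite mderivXi eqxx comp_mpoly1 mul1r.
  by rewrite mderivXi eq_sym (negPf lj) comp_mpoly0 mul0r.
- rewrite comp_mpolyD mderivD IHp IHq -big_split; apply: eq_bigr => j _ /=.
  by rewrite mderivD comp_mpolyD mulrDl.
rewrite comp_mpolyM mderivM IHp IHq mulr_suml mulr_sumr -big_split; apply: eq_bigr => j _ /=.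
by rewrite mderivM comp_mpolyD !comp_mpolyM; ring.
Qed.

Lemma comp_mpolyA n k l (T : n.-tuple {mpoly R[k]}) (U : k.-tuple {mpoly R[l]}) (p : {mpoly R[n]}) :
  (p \mPo T) \mPo U = p \mPo [tuple (tnth T i) \mPo U | i < n].
Proof.
move: p; apply: mpoly_alg_ind => [c|j|p q IHp IHq|p q IHp IHq].
- by rewrite !comp_mpolyC.
- by rewrite !comp_mpolyX1 tnth_mktuple.
- by rewrite !comp_mpolyD IHp IHq.
by rewrite !comp_mpolyM IHp IHq.
Qed.

Lemma dhomog_comp n k (T : n.-tuple {mpoly R[k]}) m e (p : {mpoly R[n]}) :
  p \is m.-homog -> (forall i, tnth T i \is e.-homog) -> p \mPo T \is (m * e).-homog.
Proof.
move=> /dhomogP hp hT; rewrite comp_mpolyEX big_seq.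
apply: (big_ind (fun q => q \is (m * e).-homog)) => [|q r|mm mmp]; first exact: dhomog0.
  exact: dhomogD.
apply: dhomogZ; rewrite comp_mpolyX -(hp _ mmp) /= mdegE big_distrl /=.
apply: (big_ind2 (fun (q : {mpoly R[k]}) j => q \is j.-homog)) => [|x y q b|]; first exact: dhomog1.
  by move=> *; apply: dhomogM.
by move=> i _; rewrite mulnC; apply: dhomogMn.
Qed.

Lemma dhomog_scale n m (p : {mpoly R[n]}) (v w : 'I_n -> R) c :
  p \is m.-homog -> (forall i, w i = c * v i) -> p.@[w] = c ^+ m * p.@[v].
Proof.
move=> /dhomogP hp e; rewrite !mevalE mulr_sumr !big_seq; apply: eq_bigr => mm mmp.
rewrite mulrCA; congr (_ * _); rewrite -(hp _ mmp) /= mdegE -prodrXr -big_split /=.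
by apply: eq_bigr => i _; rewrite e exprMn.
Qed.

End PolynomialForms.

Section Frames.
Variable K : closedFieldType.
Implicit Types (F G : {mpoly K[3]}) (g : {poly {poly K}}) (x y : K) (p q v : 'rV[K]_3) (M : 'M[K]_3).

Lemma homog_evalZ m G p c : G \is m.-homog -> G.[: c *: p] = c ^+ m * G.[: p].
Proof. by move=> hG; apply: dhomog_scale hG _ => i; rewrite mxE. Qed.

Definition pt x y z : 'rV[K]_3 := \row_j nth 0 [:: x; y; z] j.

(** Points are row vectors and matrices act on the right, so column i of [M] holds the coefficients
    of the i-th form. *)
Definition linear_forms M : 3.-tuple {mpoly K[3]} := [tuple \sum_j M j i *: 'X_j | i < 3].

Lemma eval_linear_forms M p i : (tnth (linear_forms M) i).[: p] = (p *m M) 0 i.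
Proof.
rewrite tnth_mktuple raddf_sum mxE; apply: eq_bigr => j _.
by rewrite /= mevalZ mevalXU mulrC.
Qed.

Lemma linear_forms_homog M i : tnth (linear_forms M) i \is 1.-homog.
Proof.
rewrite tnth_mktuple; apply: rpred_sum => j _.
by apply: dhomogZ; rewrite dhomogX /= mdeg1.
Qed.

Definition lsub M G := G \mPo linear_forms M.
HB.instance Definition _ M := GRing.RMorphism.copy (lsub M) (comp_mpoly (linear_forms M)).

Lemma eval_lsub M G p : (lsub M G).[: p] = G.[: p *m M].
Proof. by rewrite /lsub comp_mpoly_meval; apply: meval_eq => i; rewrite eval_linear_forms. Qed.

Lemma lsub_homog M m G : G \is m.-homog -> lsub M G \is m.-homog.
Proof. by move=> hG; rewrite -[m]muln1; apply: dhomog_comp => // i; apply: linear_forms_homog. Qed.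

Lemma lsubM M N G : lsub M (lsub N G) = lsub (M *m N) G.
Proof.
rewrite /lsub comp_mpolyA; congr (_ \mPo _); apply: eq_from_tnth => i.
rewrite !tnth_mktuple raddf_sum /=.
transitivity (\sum_j N j i *: tnth (linear_forms M) j).
  by apply: eq_bigr => j _; rewrite comp_mpolyZ comp_mpolyX1.
transitivity (\sum_j \sum_k N j i *: (M k j *: 'X_k) : {mpoly K[3]}).
  by apply: eq_bigr => j _; rewrite tnth_mktuple scaler_sumr.
rewrite exchange_big; apply: eq_bigr => j _ /=.
rewrite mxE scaler_suml; apply: eq_bigr => k _.
by rewrite scalerA mulrC.
Qed.

Lemma lsub1 G : lsub 1%:M G = G.
Proof.
rewrite /lsub -[RHS]comp_mpoly_id; congr (_ \mPo _); apply: eq_from_tnth => i.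
rewrite !tnth_mktuple (bigD1 i) //= big1 ?addr0 => [|j ji]; first by rewrite mxE eqxx scale1r.
by rewrite mxE (negPf ji) scale0r.
Qed.

(** The derivative of F at p in the direction v. For p on a smooth curve its zeros v form the
    tangent line at p. *)
Definition dgrad F p v := \sum_i (F^`M(i)).[: p] * v 0 i.

Lemma dgrad_lsub M F p v : dgrad (lsub M F) p v = dgrad F (p *m M) (v *m M).
Proof.
rewrite /dgrad.
transitivity (\sum_i \sum_j F^`M(j).[: p *m M] * (M i j * v 0 i)).
  apply: eq_bigr => i _; rewrite /lsub mderiv_comp raddf_sum mulr_suml; apply: eq_bigr => j _ /=.
  rewrite mevalM -[_ \mPo _]/(lsub M _) eval_lsub -!mulrA; congr (_ * (_ * _)).
  rewrite tnth_mktuple (big_morph _ (@mderivD _ _ i) (@mderiv0 _ _ i)) raddf_sum (bigD1 i) //= big1 ?addr0 => [|k ki].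
    by rewrite mderivZ mderivXi eqxx mevalZ meval1 mulr1.
  by rewrite mderivZ mderivXi (negPf ki) scaler0 meval0.
rewrite exchange_big; apply: eq_bigr => j _ /=.
rewrite mxE mulr_sumr; apply: eq_bigr => i _; by rewrite [v 0 i * _]mulrC.
Qed.

(* Dehomogenisation at the last coordinate; the outer variable is the second coordinate. *)
Definition dehom_var (i : 'I_3) : {poly {poly K}} := nth 0 [:: 'X%:P; 'X; 1] i.
Definition dehom_const (c : K) : {poly {poly K}} := c%:P%:P.
HB.instance Definition _ := GRing.RMorphism.copy dehom_const (polyC \o polyC).
Definition dehom : {mpoly K[3]} -> {poly {poly K}} := mmap dehom_const dehom_var.
HB.instance Definition _ := GRing.RMorphism.copy dehom (mmap dehom_const dehom_var).

Lemma dehomC c : dehom c%:MP = c%:P%:P.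
Proof. by rewrite /dehom mmapC. Qed.

Lemma dehomX i : dehom 'X_i = dehom_var i.
Proof. by rewrite /dehom mmapX mmap1U. Qed.

Lemma dehomZ c G : dehom (c *: G) = c%:P%:P * dehom G.
Proof. by rewrite /dehom mmapZ. Qed.

Lemma mdeg3 (m : 'X_{1..3}) : mdeg m = (m 0%R + m 1%R + m ord_max)%N.
Proof.
rewrite mdegE !big_ord_recl big_ord0 addn0 addnA.
by congr (_ + _ + _)%N; congr (m _); apply: val_inj.
Qed.

Lemma dehom_mon (m : 'X_{1..3}) : dehom 'X_[m] = ('X^(m 0))%:P * 'X^(m 1).
Proof.
rewrite /dehom mmapX /mmap1 !big_ord_recl big_ord0 /= mulr1 /dehom_var /= rmorphXn /= expr1n mulr1.
by congr (_ ^+ _ * _ ^+ _); congr (m _); apply: val_inj.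
Qed.

Lemma fiber_dehom x y G : (fiber x (dehom G)).[y] = G.[: pt x y 1].
Proof.
move: G; apply: mpoly_alg_ind => [c|i|p q IHp IHq|p q IHp IHq].
- by rewrite dehomC fiberC !hornerC mevalC.
- rewrite dehomX mevalXU mxE; case: i => [[|[|[|k]]] hi] //=; rewrite /dehom_var /=.
  + by rewrite fiberC !hornerE.
  + by rewrite fiberX hornerX.
  by rewrite rmorph1 hornerC.
- by rewrite !rmorphD /= hornerD IHp IHq.
by rewrite !rmorphM /= hornerM IHp IHq.
Qed.

Lemma tdeg_dehom n G : G \is n.-homog -> tdeg_lt n.+1 (dehom G).
Proof.
move=> /dhomogP hG; rewrite [G]mpolyE raddf_sum big_seq.
apply: (big_ind (tdeg_lt n.+1)) => [|g h|m /hG dm]; first exact: tdeg_lt0r.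
  exact: tdeg_ltD.
rewrite /= dehomZ dehom_mon mulrA -polyCM => i; rewrite coefMXn.
case: ifP => [_|/negbT]; first by rewrite size_poly0.
rewrite -leqNgt coefC; case: eqP => [e le|_ _]; last by rewrite size_poly0.
rewrite mul_polyC; apply: leq_trans (size_scale_leq _ _) _; rewrite size_polyXn.
move/eqP: e; rewrite subn_eq0 => e.
by move: dm; rewrite /= mdeg3; move: (m 0) (m 1) (m ord_max) le e; lia.
Qed.

Definition mon3 (a b c : nat) : 'X_{1..3} := [multinom nth 0%N [:: a; b; c] i | i < 3].

Lemma mon3_0 a b c : mon3 a b c 0%R = a. Proof. by rewrite mnmE. Qed.
Lemma mon3_1 a b c : mon3 a b c 1%R = b. Proof. by rewrite mnmE. Qed.

Lemma mdeg_mon3 a b c : mdeg (mon3 a b c) = (a + b + c)%N.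
Proof. by rewrite mdeg3 !mnmE. Qed.

Definition rehom n g : {mpoly K[3]} :=
  \sum_(i < n.+1) \sum_(j < (n - i).+1) g`_i`_j *: 'X_[mon3 j i (n - i - j)].

Lemma rehom_homog n g : rehom n g \is n.-homog.
Proof.
apply: rpred_sum => i _; apply: rpred_sum => j _; apply: dhomogZ.
by rewrite dhomogX /= mdeg_mon3; case: i j => i /= ? [j /= ?]; lia.
Qed.

Lemma dehom_rehom n g : tdeg_lt n.+1 g -> dehom (rehom n g) = g.
Proof.
move=> tg; rewrite /rehom raddf_sum /=.
have E (i : 'I_n.+1) : dehom (\sum_(j < (n - i).+1) g`_i`_j *: 'X_[mon3 j i (n - i - j)]) = (g`_i)%:P * 'X^i.
  rewrite raddf_sum /=.
  transitivity (\sum_(j < (n - i).+1) (g`_i`_j *: 'X^j)%:P * 'X^i : {poly {poly K}}).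
    by apply: eq_bigr => j _; rewrite dehomZ dehom_mon mon3_0 mon3_1 mulrA -polyCM [(_%:P * _)%:P * _]mul_polyC mul_polyC -mul_polyC.
  rewrite -mulr_suml -raddf_sum /=; congr (_%:P * _).
  rewrite -[RHS]coefK [RHS]poly_def (@big_ord_widen _ _ _ (size g`_i) (n - i).+1 (fun j => g`_i`_j *: 'X^j)); last first.
    by rewrite -subSn ?tg // -ltnS.
  rewrite [RHS]big_mkcond; apply: eq_bigr => j _; case: ltnP => // le.
  by rewrite nth_default ?scale0r.
under eq_bigr => i _ do rewrite E mul_polyC.
rewrite -[RHS]coefK [RHS]poly_def (@big_ord_widen _ _ _ (size g) n.+1 (fun i => g`_i *: 'X^i)); last first.
  apply/leq_sizeP => j nj; apply/eqP; rewrite -size_poly_leq0; apply: leq_trans (tg j) _; lia.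
rewrite [RHS]big_mkcond; apply: eq_bigr => j _; case: ltnP => // le.
by rewrite nth_default ?scale0r.
Qed.

Lemma rehom_dehom n G : G \is n.-homog -> rehom n (dehom G) = G.
Proof.
move=> /dhomogP hG.
have Rsum (I : eqType) (s : seq I) (f : I -> {poly {poly K}}) : rehom n (\sum_(i <- s) f i) = \sum_(i <- s) rehom n (f i).
  elim: s => [|a s IH]; rewrite ?big_nil ?big_cons.
    rewrite /rehom big1 // => i _; rewrite big1 // => j _; by rewrite !coef0 scale0r.
  rewrite -IH /rehom -big_split; apply: eq_bigr => i _ /=; rewrite -big_split; apply: eq_bigr => j _ /=.
  by rewrite !coefD scalerDl.
rewrite {1}[G]mpolyE raddf_sum Rsum [RHS]mpolyE !big_seq; apply: eq_bigr => m /hG dm /=.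
have dm' : (m 0%R + m 1%R + m ord_max = n)%N by rewrite -dm -mdeg3.
have h1 : (m 1%R < n.+1)%N by lia.
have h0 : (m 0%R < (n - m 1%R).+1)%N by lia.
have h2 : (n - m 1%R - m 0%R = m ord_max)%N by lia.
have C i j : (dehom (G@_m *: 'X_[m]))`_i`_j = if (i == m 1) && (j == m 0) then G@_m else 0.
  rewrite dehomZ dehom_mon mulrA -polyCM mul_polyC coefZ coefXn.
  case: eqP => _ /=; rewrite ?mulr1 ?mulr0 ?coef0 // mul_polyC coefZ coefXn.
  by case: eqP; rewrite ?mulr1 ?mulr0.
rewrite /rehom (bigD1 (Ordinal h1)) //= (bigD1 (Ordinal h0)) //= C !eqxx /= !big1 ?addr0.
- congr (_ *: 'X_[_]); apply/mnmP => i; rewrite mnmE; case: i => [[|[|[|k]]] hi] //=.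
  + by congr (m _); apply: val_inj.
  + by congr (m _); apply: val_inj.
  by rewrite h2; congr (m _); apply: val_inj.
- move=> i /eqP ni; apply: big1 => j _; rewrite C; case: eqP => [e|]; last by rewrite scale0r.
  by case: ni; apply: val_inj.
move=> j /eqP nj; rewrite C eqxx /=; case: eqP => [e|]; last by rewrite scale0r.
by case: nj; apply: val_inj.
Qed.

Lemma top_dehom n G y : G \is n.-homog -> (top n (dehom G)).[y] = G.[: pt 1 y 0].
Proof.
move=> hG; rewrite -{2}(rehom_dehom hG) /top horner_poly /rehom raddf_sum; apply: eq_bigr => i _ /=.
rewrite raddf_sum /= (bigD1 ord_max) //= big1 ?addr0 => [|j /eqP nj].
  rewrite mevalZ mevalX !big_ord_recl big_ord0 !mnmE /= !mxE /= subnn expr0 expr1n; ring.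
rewrite mevalZ mevalX !big_ord_recl big_ord0 !mnmE /= !mxE /=.
have : (n - i - j != 0)%N.
  apply/eqP => e; apply: nj; apply: val_inj => /=; case: j e => j /= ? ?; lia.
by move=> /negPf e; rewrite [0 ^+ (n - i - j)]expr0n e mul0r !mulr0.
Qed.

End Frames.
Arguments dehom {K} _.

Section Points.
Variable K : closedFieldType.
Implicit Types (F G : {mpoly K[3]}) (g : {poly {poly K}}) (x y : K) (p q u v w : 'rV[K]_3) (M : 'M[K]_3).

Definition i1 : 'I_3 := 1%R.
Definition i2 : 'I_3 := ord_max.

Lemma ord3P (i : 'I_3) : [\/ i = ord0, i = i1 | i = i2].
Proof.
case: i => [[|[|[|k]]] hi] //; [constructor 1|constructor 2|constructor 3]; exact: val_inj.
Qed.

Lemma ptE0 x y z : pt x y z 0 ord0 = x. Proof. by rewrite mxE. Qed.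
Lemma ptE1 x y z : pt x y z 0 i1 = y. Proof. by rewrite mxE. Qed.
Lemma ptE2 x y z : pt x y z 0 i2 = z. Proof. by rewrite mxE. Qed.
Definition ptE := (ptE0, ptE1, ptE2).

Lemma row3P p q : p 0 ord0 = q 0 ord0 -> p 0 i1 = q 0 i1 -> p 0 i2 = q 0 i2 -> p = q.
Proof. by move=> h0 h1 h2; apply/rowP => i; case: (ord3P i) => ->. Qed.

Lemma pt_eta p : p = pt (p 0 ord0) (p 0 i1) (p 0 i2).
Proof. by apply: row3P; rewrite !ptE. Qed.

Lemma sum3 (V : nmodType) (f : 'I_3 -> V) : \sum_i f i = f ord0 + f i1 + f i2.
Proof.
rewrite !big_ord_recl big_ord0 addr0 addrA; congr (_ + f _ + f _); exact: val_inj.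
Qed.

Definition frame u v w : 'M[K]_3 := \matrix_(i, j) nth 0 [:: u 0 j; v 0 j; w 0 j] i.

Lemma mul_pt_frame x y z u v w : pt x y z *m frame u v w = x *: u + y *: v + z *: w.
Proof. by apply/rowP => j; rewrite !mxE sum3 !mxE. Qed.

Definition det3 u v w : K :=
  u 0 ord0 * (v 0 i1 * w 0 i2 - v 0 i2 * w 0 i1)
  - u 0 i1 * (v 0 ord0 * w 0 i2 - v 0 i2 * w 0 ord0)
  + u 0 i2 * (v 0 ord0 * w 0 i1 - v 0 i1 * w 0 ord0).

Definition collinear p q : Prop := forall i j, p 0 i * q 0 j = p 0 j * q 0 i.

Lemma frame_unit u v w : det3 u v w != 0 -> frame u v w \in unitmx.
Proof.
move=> dn; set d := det3 u v w in dn.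
(* [c1] is the cross product; the three cross products of the rows are the columns of the adjugate
   matrix. *)
pose c1 (a b : 'rV[K]_3) := pt (a 0 i1 * b 0 i2 - a 0 i2 * b 0 i1)
  (a 0 i2 * b 0 ord0 - a 0 ord0 * b 0 i2) (a 0 ord0 * b 0 i1 - a 0 i1 * b 0 ord0).
have E : frame u v w *m (d^-1 *: (frame (c1 v w) (c1 w u) (c1 u v))^T) = 1%:M.
  rewrite -scalemxAr; apply/matrixP => i j; rewrite mxE.
  apply: (mulfI dn); rewrite mulVKf // !mxE sum3 /d /det3 /c1.
  by case: (ord3P i) => ->; case: (ord3P j) => -> /=; rewrite !mxE /=; ring.
by have [] := mulmx1_unit E.
Qed.

Lemma det3_exists v w : ~ collinear v w -> exists u, det3 u v w != 0.
Proof.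
move=> ncol; apply: contrapT => /forallNP H; apply: ncol.
have e0 := H (pt 1 0 0); have e1 := H (pt 0 1 0); have e2 := H (pt 0 0 1).
move: e0 e1 e2; rewrite /det3 !ptE !(mul1r, mul0r, addr0, add0r, subr0, sub0r, oppr0).
move=> /negP/negPn/eqP/subr0_eq e0 /negP/negPn; rewrite oppr_eq0 => /eqP/subr0_eq e1 /negP/negPn/eqP/subr0_eq e2 i j.
by case: (ord3P i) => ->; case: (ord3P j) => ->; rewrite ?e0 ?e1 ?e2.
Qed.

Lemma collinear_scale p q : p != 0 -> q != 0 -> collinear p q -> exists2 c, c != 0 & q = c *: p.
Proof.
move=> p0 q0 H; have [i pi] : exists i, p 0 i != 0.
  apply: contrapT => /forallNP e; move/eqP: p0; apply; apply/rowP => i; rewrite mxE.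
  by apply/eqP; apply/negPn/negP/e.
have E : q = (q 0 i / p 0 i) *: p.
  apply/rowP => j; rewrite mxE; apply: (mulfI pi).
  by rewrite (H i j); field.
exists (q 0 i / p 0 i) => //; apply: contraNneq q0 => c0; by rewrite E c0 scale0r.
Qed.

Lemma collinearZr p c : collinear p (c *: p).
Proof. by move=> i j; rewrite !mxE; ring. Qed.

Lemma collinear_sym p q : collinear p q -> collinear q p.
Proof. by move=> H i j; rewrite mulrC -H mulrC. Qed.

Lemma frame_exists v : v != 0 -> exists u w, det3 u v w != 0.
Proof.
move=> v0; have [w nc] : exists w, ~ collinear v w.
  apply: contrapT => /forallNP H; move/eqP: v0; apply.
  have /contrapT h0 := H (pt 1 0 0); have /contrapT h1 := H (pt 0 1 0).
  apply: row3P; rewrite mxE.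
  - by have := h1 ord0 i1; rewrite !ptE mulr1 mulr0.
  - by have := h0 i1 ord0; rewrite !ptE mulr1 mulr0.
  by have := h0 i2 ord0; rewrite !ptE mulr1 mulr0.
by have [u du] := det3_exists nc; exists u, w.
Qed.

Lemma form_nonzero_at m G : G \is m.-homog -> G != 0 -> exists p, G.[: p] != 0.
Proof.
move=> hG G0; have g0 : dehom G != 0.
  apply: contraNneq G0 => e; rewrite -(rehom_dehom hG) e /rehom; apply/eqP.
  by rewrite big1 // => i _; rewrite big1 // => j _; rewrite !coef0 scale0r.
have l0 : lead_coef (dehom G) != 0 by rewrite lead_coef_eq0.
have [x lx] := nonroot_exists l0.
have fx : fiber x (dehom G) != 0.
  by apply: contraNneq lx => e; rewrite /lead_coef -coef_fiber e coef0.
by have [y] := nonroot_exists fx; rewrite fiber_dehom; exists (pt x y 1).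
Qed.

Lemma nonzero_coord p : p != 0 -> exists i, p 0 i != 0.
Proof.
move=> p0; apply: contrapT => /forallNP e; move/eqP: p0; apply; apply/rowP => i; rewrite mxE.
by apply/eqP; apply/negPn/negP/e.
Qed.

Lemma dgradM F G p v : dgrad (F * G) p v = dgrad F p v * G.[: p] + F.[: p] * dgrad G p v.
Proof.
rewrite /dgrad mulr_suml mulr_sumr -big_split; apply: eq_bigr => i _ /=.
by rewrite mderivM mevalD !mevalM; ring.
Qed.

Lemma dgradB F G p v : dgrad (F - G) p v = dgrad F p v - dgrad G p v.
Proof.
rewrite /dgrad -sumrB; apply: eq_bigr => i _ /=.
by rewrite mderivB mevalB mulrBl.
Qed.

Lemma dgradZ c F p v : dgrad (c *: F) p v = c * dgrad F p v.
Proof.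
rewrite /dgrad mulr_sumr; apply: eq_bigr => i _ /=.
by rewrite mderivZ mevalZ mulrA.
Qed.

Lemma dgradZv F p c v : dgrad F p (c *: v) = c * dgrad F p v.
Proof. by rewrite /dgrad mulr_sumr; apply: eq_bigr => i _; rewrite mxE mulrCA. Qed.

(** A root of a fibre is simple exactly if the line joining the point to the centre (0 : 1 : 0) is
    not tangent there. *)
Lemma deriv_fiber_dehom x y G : ((fiber x (dehom G))^`()).[y] = dgrad G (pt x y 1) (pt 0 1 0).
Proof.
have -> : dgrad G (pt x y 1) (pt 0 1 0) = G^`M(i1).[: pt x y 1].
  by rewrite /dgrad sum3 !ptE !mulr0 mulr1 addr0 add0r.
move: G; apply: mpoly_alg_ind => [c|i|p q IHp IHq|p q IHp IHq].
- by rewrite dehomC fiberC derivC horner0 mderivC meval0.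
- rewrite dehomX mderivXi; case: (ord3P i) => ->; rewrite /dehom_var /=.
  + by rewrite fiberC derivC horner0 meval0.
  + by rewrite fiberX derivX hornerC meval1.
  by rewrite rmorph1 derivC horner0 meval0.
- by rewrite !rmorphD /= derivD hornerD IHp IHq mderivD mevalD.
rewrite !rmorphM /= derivM hornerD !hornerM IHp IHq mderivM mevalD !mevalM.
by rewrite !fiber_dehom.
Qed.

(** This is why the equation of a curve that avoids (0 : 1 : 0) can be made monic in y. *)
Lemma coef_top_dehom n G : G \is n.-homog -> (dehom G)`_n = (G.[: pt 0 1 0])%:P.
Proof.
move=> hG; have sz : (size ((dehom G)`_n)%R <= 1)%N.
  by have := tdeg_dehom hG n; rewrite subSnn.
rewrite [LHS](size1_polyC sz); congr (_%:P).
rewrite -{2}(rehom_dehom hG) /rehom raddf_sum /= (bigD1 ord_max) //= subnn big_ord_recl big_ord0 addr0.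
rewrite mevalZ mevalX !big_ord_recl big_ord0 !mnmE /= !mxE /= !expr1n !expr0 !mulr1.
rewrite big1 ?addr0 // => i /eqP ni; rewrite raddf_sum big1 // => j _ /=.
rewrite mevalZ mevalX !big_ord_recl big_ord0 !mnmE /= !mxE /= !expr1n !mul1r.
have [j0|j0] := eqVneq (val j) 0%N; last by rewrite expr0n (negPf j0) !mul0r mulr0.
have : (n - i - j != 0)%N.
  rewrite j0; apply/eqP => e; apply: ni; apply: val_inj => /=; case: i j e j0 => i /= ? [j ?] /= ? ?; lia.
by move=> /negPf e; rewrite [0 ^+ (n - i - j)]expr0n e !mul0r !mulr0.
Qed.

(* In [curve_points] the inequation [x != 0] is elaborated as one between functions. *)
Lemma curve_pointsP F p : curve_points F p <-> (p != 0 :> 'rV[K]_3) /\ F.[: p] = 0.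
Proof.
rewrite /curve_points /=; split=> -[h1 h2]; split=> //.
  apply: contraNneq h1 => ->; apply/eqP/funext => i; apply/funext => j; by rewrite mxE.
apply: contraNneq h1 => e; apply/eqP/matrixP => i j; by rewrite mxE e.
Qed.

End Points.

(** * Affine charts of a smooth curve *)

Section Chart.
Variable K : closedFieldType.
Variables (d : nat) (F : {mpoly K[3]}) (M : 'M[K]_3).
Hypotheses (d_gt0 : (0 < d)%N) (smF : smooth_plane_curve d F) (unitM : M \in unitmx).
Hypothesis (center_off : F.[: pt 0 1 0 *m M] != 0).
Implicit Types (G A B : {mpoly K[3]}) (g h : {poly {poly K}}) (x y : K) (p q : 'rV[K]_3).

Let homF : F \is d.-homog. Proof. by case: smF. Qed.

Definition chart G := dehom (lsub M G).
HB.instance Definition _ := GRing.RMorphism.copy chart (dehom \o lsub M).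
Definition unchart n g := lsub (invmx M) (rehom n g).
Definition cpt x y := pt x y 1 *m M.

Lemma cpt_neq0 x y : cpt x y != 0.
Proof.
apply/eqP => /(congr1 (fun z => z *m invmx M)); rewrite mulmxK // mul0mx => /rowP/(_ i2)/eqP.
by rewrite ptE mxE oner_eq0.
Qed.

Lemma fiber_chart x y G : (fiber x (chart G)).[y] = G.[: cpt x y].
Proof. by rewrite /chart fiber_dehom eval_lsub. Qed.

Lemma tdeg_chart n G : G \is n.-homog -> tdeg_lt n.+1 (chart G).
Proof. by move=> hG; apply: tdeg_dehom; apply: lsub_homog. Qed.

Lemma unchart_homog n g : unchart n g \is n.-homog.
Proof. by apply: lsub_homog; apply: rehom_homog. Qed.

Lemma chartK n G : G \is n.-homog -> unchart n (chart G) = G.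
Proof. by move=> hG; rewrite /unchart /chart rehom_dehom ?lsub_homog // lsubM mulVmx // lsub1. Qed.

Lemma unchartK n g : tdeg_lt n.+1 g -> chart (unchart n g) = g.
Proof. by move=> tg; rewrite /unchart /chart lsubM mulmxV // lsub1 dehom_rehom. Qed.

Lemma chart_inj n G1 G2 : G1 \is n.-homog -> G2 \is n.-homog -> chart G1 = chart G2 -> G1 = G2.
Proof. by move=> h1 h2 e; rewrite -(chartK h1) e chartK. Qed.

Lemma top_chart n G y : G \is n.-homog -> (top n (chart G)).[y] = G.[: pt 1 y 0 *m M].
Proof. by move=> hG; rewrite /chart top_dehom ?lsub_homog // eval_lsub. Qed.

Lemma chartZ c G : chart (c *: G) = c%:P%:P * chart G.
Proof. by rewrite /chart /lsub comp_mpolyZ dehomZ. Qed.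

Lemma chart_cases p : p != 0 -> [\/ exists c x y, c != 0 /\ p = c *: cpt x y,
  exists c y, c != 0 /\ p = c *: (pt 1 y 0 *m M) | exists c, c != 0 /\ p = c *: (pt 0 1 0 *m M)].
Proof.
move=> p0; set q := p *m invmx M.
have ep : p = q *m M by rewrite mulmxKV.
have q0 : q != 0 by apply: contraNneq p0 => e; rewrite ep e mul0mx. clearbody q.
have [z0|z0] := eqVneq (q 0 i2) 0; last first.
  constructor 1; exists (q 0 i2), (q 0 ord0 / q 0 i2), (q 0 i1 / q 0 i2); split=> //.
  rewrite /cpt scalemxAl ep; congr (_ *m _); apply: row3P; rewrite mxE !ptE ?mulr1 //.
  by rewrite mulrC mulfVK.
  by rewrite mulrC mulfVK.
have [x0|x0] := eqVneq (q 0 ord0) 0; last first.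
  constructor 2; exists (q 0 ord0), (q 0 i1 / q 0 ord0); split=> //.
  rewrite scalemxAl ep; congr (_ *m _); apply: row3P; rewrite mxE !ptE ?mulr1 ?mulr0 ?z0 //.
  by rewrite mulrC mulfVK.
constructor 3; exists (q 0 i1); split.
  apply: contraNneq q0 => y0; by apply/eqP; apply: row3P; rewrite ?x0 ?y0 ?z0 mxE.
rewrite scalemxAl ep; congr (_ *m _); apply: row3P; rewrite mxE !ptE ?mulr1 ?mulr0 ?z0 ?x0 //.
Qed.

Definition chart_eq := chart ((F.[: pt 0 1 0 *m M])^-1 *: F).
Local Notation f := chart_eq.

Lemma chart_eqE : f = ((F.[: pt 0 1 0 *m M])^-1)%:P%:P * chart F.
Proof. exact: chartZ. Qed.

Lemma chartF : chart F = (F.[: pt 0 1 0 *m M])%:P%:P * f.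
Proof. by rewrite chart_eqE mulrA -!polyCM mulfV // mul1r. Qed.

Let homF' : (F.[: pt 0 1 0 *m M])^-1 *: F \is d.-homog. Proof. by apply: dhomogZ. Qed.

Lemma chart_eq_tdeg : tdeg_lt d.+1 f.
Proof. exact: tdeg_chart. Qed.

Let coefd : f`_d = 1.
Proof. by rewrite /f /chart coef_top_dehom ?lsub_homog // eval_lsub mevalZ mulVf. Qed.

Lemma chart_eq_size : size f = d.+1.
Proof.
apply/eqP; rewrite eqn_leq; apply/andP; split.
  apply/leq_sizeP => j dj; apply/eqP; rewrite -size_poly_leq0; apply: leq_trans (chart_eq_tdeg j) _; lia.
rewrite ltnNge; apply/negP => /leq_sizeP/(_ d (leqnn _))/eqP.
by rewrite coefd oner_eq0.
Qed.

Lemma chart_eq_monic : f \is monic.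
Proof. by apply/eqP; rewrite /lead_coef chart_eq_size /= coefd. Qed.

Lemma fiber_chart_eq x y : (fiber x f).[y] = (F.[: pt 0 1 0 *m M])^-1 * F.[: cpt x y].
Proof. by rewrite fiber_chart mevalZ. Qed.

Lemma chart_root x y : (fiber x f).[y] = 0 -> curve_points F (cpt x y).
Proof.
rewrite fiber_chart_eq => /eqP; rewrite mulf_eq0 invr_eq0 (negPf center_off) => /eqP e.
by apply/curve_pointsP; split; [exact: cpt_neq0 | exact: e].
Qed.

Lemma chart_onroot x y : curve_points F (cpt x y) -> (fiber x f).[y] = 0.
Proof. by case/curve_pointsP=> _ e; rewrite fiber_chart_eq e mulr0. Qed.

Lemma curve_point_in_chart x : exists y, curve_points F (cpt x y).
Proof.
have [|y] := @root_exists _ (fiber x f).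
  by rewrite size_fiber_monic ?chart_eq_monic // chart_eq_size.
by move/chart_root; exists y.
Qed.

(** At a common zero of [A] and [B] both terms of the product rule vanish, so the curve would be
    singular there. *)
Lemma smooth_product_no_common_zero m n A B : A \is m.-homog -> B \is n.-homog ->
  (F.[: pt 0 1 0 *m M])^-1 *: F = A * B -> forall p, p != 0 -> A.[: p] = 0 -> B.[: p] = 0 -> False.
Proof.
move=> hA hB e p p0 Ap Bp; have eF : F = F.[: pt 0 1 0 *m M] *: (A * B) by rewrite -e scalerA mulfV ?scale1r.
have Cp : curve_points F p by apply/curve_pointsP; split=> //; rewrite eF mevalZ mevalM Ap mul0r mulr0.
case: smF => _ /(_ p Cp) [i /eqP]; apply.
by rewrite eF mderivZ mderivM mevalZ mevalD !mevalM Ap Bp mulr0 mul0r addr0 mulr0.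
Qed.

(** Two components of a plane curve meet, and the point where they meet is singular. *)
Lemma chart_eq_irreducible : irreducible_factors f.
Proof.
move=> F1 F2 ef; apply: contrapT => /not_orP [/negP/negbTE n1 /negP/negbTE n2].
rewrite leqNgt in n1; rewrite leqNgt in n2; move: n1 n2 => /negbFE s1 /negbFE s2.
have lu : lead_coef F1 * lead_coef F2 = 1.
  by rewrite -lead_coefM -ef (eqP chart_eq_monic).
have [a a0 ea] : exists2 a : K, a != 0 & lead_coef F1 = a%:P.
  have : size (lead_coef F1) == 1%N.
    have n1 : lead_coef F1 != 0 by apply/eqP => e; move: lu; rewrite e mul0r => /eqP; rewrite eq_sym oner_eq0.
    have n2 : lead_coef F2 != 0 by apply/eqP => e; move: lu; rewrite e mulr0 => /eqP; rewrite eq_sym oner_eq0.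
    have := size_mul n1 n2; rewrite lu size_poly1.
    by move: n1 n2; rewrite -!size_poly_gt0; move: (size _) (size _) => s t; lia.
  by move/size_poly1P => [a a0 ->]; exists a.
have ea2 : lead_coef F2 = a^-1%:P.
  have aP : a%:P != 0 :> {poly K} by rewrite polyC_eq0.
  by apply: (mulfI aP); rewrite -ea lu ea -polyCM mulfV.
(* The leading coefficients of the two factors have product 1, so they are constants and both
   factors can be made monic. *)
pose G1 := a^-1%:P *: F1; pose G2 := a%:P *: F2.
have aP : a%:P != 0 :> {poly K} by rewrite polyC_eq0.
have aP' : a^-1%:P != 0 :> {poly K} by rewrite polyC_eq0 invr_eq0.
have mG1 : G1 \is monic by apply/eqP; rewrite lead_coefZ ea -polyCM mulVf.
have mG2 : G2 \is monic by apply/eqP; rewrite lead_coefZ ea2 -polyCM mulfV.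
have eG : f = G1 * G2.
  by rewrite ef /G1 /G2 -scalerAl -scalerAr scalerA -polyCM mulVf // scale1r.
pose d1 := (size F1).-1; pose d2 := (size F2).-1.
have sG1 : size G1 = d1.+1 by rewrite size_scale // /d1 prednK // ltnW.
have sG2 : size G2 = d2.+1 by rewrite size_scale // /d2 prednK // ltnW.
have d12 : (d1 + d2 = d)%N.
  by have := chart_eq_size; rewrite eG size_monicM ?monic_neq0 // sG1 sG2 addSn /= addnS => -[].
have d10 : (0 < d1)%N by rewrite /d1 -ltnS prednK // ltnW.
have d20 : (0 < d2)%N by rewrite /d2 -ltnS prednK // ltnW.
have [t1 t2] : tdeg_lt d1.+1 G1 /\ tdeg_lt d2.+1 G2.
  by apply: (tdeg_factor mG1 mG2 sG1 sG2 d12); rewrite -eG; exact: chart_eq_tdeg.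
have eU : (F.[: pt 0 1 0 *m M])^-1 *: F = unchart d1 G1 * unchart d2 G2.
  apply: (chart_inj homF'); first by rewrite -d12; apply: dhomogM; apply: unchart_homog.
  by rewrite rmorphM /= !unchartK.
have nocommon := smooth_product_no_common_zero (unchart_homog d1 G1) (unchart_homog d2 G2) eU.
apply: (plane_curves_meet mG1 mG2 sG1 sG2 d10 d20 t1 t2) => [x y h1 h2|y h1 h2].
  by apply: (nocommon (cpt x y) (cpt_neq0 x y)); rewrite -fiber_chart unchartK.
apply: (nocommon (pt 1 y 0 *m M)).
- apply/eqP => /(congr1 (fun z => z *m invmx M)); rewrite mulmxK // mul0mx => /rowP/(_ ord0)/eqP.
  by rewrite ptE mxE oner_eq0.
- by rewrite -(top_chart _ (unchart_homog d1 G1)) unchartK.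
by rewrite -(top_chart _ (unchart_homog d2 G2)) unchartK.
Qed.

(** The quotient by the monic equation respects total degree and can be homogenised. For m < d the
    truncated degree m - d says nothing, so the last clause records that the quotient is zero. *)
Lemma chart_dvd_form m G g : G \is m.-homog -> chart G = f * g ->
  exists W, [/\ W \is (m - d).-homog, G = F * W & (m < d)%N -> W = 0].
Proof.
move=> hG e; have tg : tdeg_lt (m.+1 - d) g.
  by apply: (tdeg_quot chart_eq_monic chart_eq_size chart_eq_tdeg); rewrite -e; exact: tdeg_chart.
have [le|lt] := leqP d m; last first.
  have g0 : g = 0 by apply: tdeg_lt0; move: tg; have -> : (m.+1 - d = 0)%N by lia.
  exists 0; split=> //; first exact: dhomog0.
  rewrite mulr0; have h0 : (0 : {mpoly K[3]}) \is m.-homog by exact: dhomog0.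
  apply: (chart_inj hG h0).
  by rewrite e g0 mulr0 rmorph0.
have em : (m.+1 - d = (m - d).+1)%N by lia.
exists ((F.[: pt 0 1 0 *m M])^-1 *: unchart (m - d) g); split.
- by apply: dhomogZ; apply: unchart_homog.
- apply: (chart_inj hG); first by move: (dhomogM homF (dhomogZ ((F.[: pt 0 1 0 *m M])^-1) (unchart_homog (m - d) g))); rewrite subnKC.
  by rewrite rmorphM /= chartZ unchartK -?em // mulrCA mulrA -chart_eqE.
- by [].
Qed.

Lemma chart_dvd_vanishes m G g : G \is m.-homog -> chart G = f * g -> vanishes_on F G.
Proof.
move=> hG /(chart_dvd_form hG) [W [_ -> _]] p [_ Fp].
by rewrite mevalM Fp mul0r.
Qed.

Lemma chart_bezout g : ~ (exists w, g = f * w) ->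
  exists (c : {poly K}) u v, c != 0 /\ c%:P = u * f + v * g.
Proof. exact: irreducible_bezout chart_eq_monic chart_eq_irreducible. Qed.

Lemma chart_bezout_eval x y (c : {poly K}) (u v : {poly {poly K}}) G : c%:P = u * f + v * chart G ->
  curve_points F (cpt x y) -> c.[x] = (fiber x v).[y] * G.[: cpt x y].
Proof.
move=> e Cy; rewrite (bezout_eval x y e) -(fiber_chart x y G); apply: etrans (add0r _); congr (_ + _).
by apply: etrans (mulr0 _); congr (_ * _); exact: chart_onroot.
Qed.

(** If [f] did not divide the chart of [G], elimination would give a nonzero c(x) vanishing at the
    abscissa of every affine point of the curve; but every fibre contains such a point. *)
Lemma chart_null m G : G \is m.-homog -> (forall x y, F.[: cpt x y] = 0 -> G.[: cpt x y] = 0) ->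
  exists g, chart G = f * g.
Proof.
move=> hG H; apply: contrapT => /chart_bezout [c [u [v [c0 e]]]].
have [x cx] := nonroot_exists c0; have [y Cy] := curve_point_in_chart x.
case/curve_pointsP: (Cy) => _ Fy.
by move: cx; rewrite (chart_bezout_eval e Cy) (H _ _ Fy) mulr0 eqxx.
Qed.

Lemma chart_not_vanishing m G : G \is m.-homog -> ~ vanishes_on F G ->
  exists (c : {poly K}) u v, c != 0 /\ c%:P = u * f + v * chart G.
Proof. by move=> hG nv; apply: chart_bezout => -[w e]; apply: nv; apply: chart_dvd_vanishes hG e. Qed.

Lemma chart_nonzero_point m n A B : A \is m.-homog -> B \is n.-homog ->
  ~ vanishes_on F A -> ~ vanishes_on F B -> exists p, [/\ curve_points F p, A.[: p] != 0 & B.[: p] != 0].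
Proof.
move=> hA hB /(chart_not_vanishing hA) [c [u [v [c0 e]]]] /(chart_not_vanishing hB) [c' [u' [v' [c0' e']]]].
have [x] := nonroot_exists (mulf_neq0 c0 c0'); rewrite hornerM mulf_eq0 negb_or => /andP[cx cx'].
have [y Cy] := curve_point_in_chart x; exists (cpt x y); split=> //.
  apply: contraNneq cx => Ay; by rewrite (chart_bezout_eval e Cy) Ay mulr0.
apply: contraNneq cx' => By; by rewrite (chart_bezout_eval e' Cy) By mulr0.
Qed.

(** The affine zeros have abscissas among the roots of the eliminant c and lie in finite fibres. The
    points of C at infinity are the roots of the top form of [f], which is nonzero because it
    contains y^d. *)
Lemma chart_finite_zeros m G : G \is m.-homog -> ~ vanishes_on F G ->
  exists s : seq 'rV[K]_3, forall p, curve_points F p -> G.[: p] = 0 ->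
    exists2 q : 'rV[K]_3, q \in s & q != 0 /\ collinear q p.
Proof.
move=> hG /(chart_not_vanishing hG) [c [u [v [c0 e]]]].
pose rt (r : {poly K}) := sval (closed_field_poly_normal r).
have rtP (r : {poly K}) : r != 0 -> forall x, r.[x] = 0 -> x \in rt r.
  rewrite /rt => r0 x rx; case: (closed_field_poly_normal r) => l /= er; move/eqP: rx.
  by rewrite er hornerZ mulf_eq0 lead_coef_eq0 (negPf r0) -/(root _ _) root_prod_XsubC.
pose tp := top d f.
have tp0 : tp != 0.
  apply/eqP => /polyP/(_ d)/eqP; rewrite coef_poly ltnSn subnn coefd coef1 coef0.
  by rewrite oner_eq0.
exists ([seq cpt x y | x <- rt c, y <- rt (fiber x f)] ++ [seq pt 1 y 0 *m M | y <- rt tp]).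
move=> p Cp Gp; case/curve_pointsP: (Cp) => p0 Fp; case: (chart_cases p0) => [[k [x [y [k0 ep]]]]|[k [y [k0 ep]]]|[k [k0 ep]]].
- have Cxy : curve_points F (cpt x y).
    apply/curve_pointsP; split; first exact: cpt_neq0.
    by move/eqP: Fp; rewrite ep (homog_evalZ _ _ homF) mulf_eq0 expf_eq0 (negPf k0) andbF => /eqP.
  have Gxy : G.[: cpt x y] = 0.
    by move/eqP: Gp; rewrite ep (homog_evalZ _ _ hG) mulf_eq0 expf_eq0 (negPf k0) andbF => /eqP.
  exists (cpt x y); last by split; [exact: cpt_neq0 | rewrite ep; exact: collinearZr].
  rewrite mem_cat; apply/orP; left; apply: allpairs_f_dep.
    apply: rtP => //; by rewrite (chart_bezout_eval e Cxy) Gxy mulr0.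
  apply: rtP; last exact: chart_onroot.
  by apply: monic_neq0; apply: fiber_monic; exact: chart_eq_monic.
- exists (pt 1 y 0 *m M); last split.
  + rewrite mem_cat; apply/orP; right; apply: map_f; apply: rtP => //.
    move/eqP: Fp; rewrite ep (homog_evalZ _ _ homF) mulf_eq0 expf_eq0 (negPf k0) andbF => /eqP Fy.
    by rewrite /tp top_chart // mevalZ Fy mulr0.
  + apply/eqP => /(congr1 (fun z => z *m invmx M)); rewrite mulmxK // mul0mx => /rowP/(_ ord0)/eqP.
    by rewrite ptE mxE oner_eq0.
  by rewrite ep; apply: collinearZr.
move/eqP: Fp; rewrite ep (homog_evalZ _ _ homF) mulf_eq0 expf_eq0 (negPf k0) andbF (negPf center_off).
by [].
Qed.

End Chart.

Section SmoothCurve.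
Variable K : closedFieldType.
Variables (d : nat) (F : {mpoly K[3]}).
Hypotheses (d_gt1 : (1 < d)%N) (smF : smooth_plane_curve d F).
Implicit Types (G A B H W : {mpoly K[3]}) (p q : 'rV[K]_3).

Let d_gt0 : (0 < d)%N. Proof. exact: ltnW. Qed.

Lemma curve_homog : F \is d.-homog. Proof. by case: smF. Qed.
Local Notation homF := curve_homog.

Lemma curve_form_neq0 : F != 0.
Proof.
apply/eqP => F0; have Cp : curve_points F (pt 1 0 0).
  apply/curve_pointsP; split; last by rewrite F0 meval0.
  by apply/eqP => /rowP/(_ ord0)/eqP; rewrite ptE mxE oner_eq0.
by case: smF => _ /(_ _ Cp) [i /eqP]; rewrite F0 mderiv0 meval0; apply.
Qed.

Lemma off_curve_neq0 p : F.[: p] != 0 -> p != 0.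
Proof.
apply: contraNneq => ->; rewrite -(scale0r (0 : 'rV[K]_3)) (homog_evalZ _ _ homF).
by rewrite expr0n (gtn_eqF d_gt0) mul0r.
Qed.

Lemma curve_points_scale p c : c != 0 -> curve_points F p -> curve_points F (c *: p).
Proof.
move=> c0 /curve_pointsP [p0 Fp]; apply/curve_pointsP; split; first by rewrite scaler_eq0 negb_or c0.
by rewrite (homog_evalZ _ _ homF) Fp mulr0.
Qed.

Lemma center_chart (O : 'rV[K]_3) : F.[: O] != 0 ->
  exists M : 'M[K]_3, M \in unitmx /\ pt 0 1 0 *m M = O.
Proof.
move=> /off_curve_neq0/frame_exists [u [w duw]]; exists (frame u O w); split.
  exact: frame_unit.
by rewrite mul_pt_frame scale1r !scale0r add0r addr0.
Qed.

Lemma chart_exists : exists M : 'M[K]_3, M \in unitmx /\ F.[: pt 0 1 0 *m M] != 0.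
Proof.
have [O FO] := form_nonzero_at homF curve_form_neq0.
by have [M [uM e]] := center_chart FO; exists M; rewrite e.
Qed.

Lemma vanishes_multiple m G : G \is m.-homog -> vanishes_on F G ->
  exists W, [/\ W \is (m - d).-homog, G = F * W & (m < d)%N -> W = 0].
Proof.
move=> hG vG; have [M [uM FO]] := chart_exists.
have [|g e] := chart_null d_gt0 smF uM FO hG.
  by move=> x y Fxy; apply: vG; apply/curve_pointsP; split=> //; exact: cpt_neq0.
exact: (chart_dvd_form d_gt0 smF uM FO hG e).
Qed.

Lemma vanishes_low_degree m G : G \is m.-homog -> (m < d)%N -> vanishes_on F G -> G = 0.
Proof. by move=> hG lt /(vanishes_multiple hG) [W [_ -> /(_ lt) ->]]; rewrite mulr0. Qed.

Lemma nonvanishing_point m n A B : A \is m.-homog -> B \is n.-homog ->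
  ~ vanishes_on F A -> ~ vanishes_on F B -> exists p, [/\ curve_points F p, A.[: p] != 0 & B.[: p] != 0].
Proof.
move=> hA hB; have [M [uM FO]] := chart_exists.
exact: (chart_nonzero_point d_gt0 smF uM FO hA hB).
Qed.

Lemma vanishes_cancel m n A B : A \is m.-homog -> B \is n.-homog ->
  ~ vanishes_on F A -> vanishes_on F (A * B) -> vanishes_on F B.
Proof.
move=> hA hB nA vAB; apply: contrapT => nB.
have [p [Cp Ap Bp]] := nonvanishing_point hA hB nA nB.
by have /eqP := vAB p Cp; rewrite mevalM mulf_eq0 (negPf Ap) (negPf Bp).
Qed.

Lemma not_vanishesM m n A B : A \is m.-homog -> B \is n.-homog ->
  ~ vanishes_on F A -> ~ vanishes_on F B -> ~ vanishes_on F (A * B).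
Proof. by move=> hA hB nA nB /(vanishes_cancel hA hB nA). Qed.

Lemma finite_zeros m G : G \is m.-homog -> ~ vanishes_on F G ->
  exists s : seq 'rV[K]_3, forall p, curve_points F p -> G.[: p] = 0 ->
    exists2 q : 'rV[K]_3, q \in s & q != 0 /\ collinear q p.
Proof.
move=> hG nG; have [M [uM FO]] := chart_exists.
exact: (chart_finite_zeros d_gt0 smF uM FO hG nG).
Qed.

Lemma curve_nonempty : exists p, curve_points F p.
Proof.
have [M [uM FO]] := chart_exists.
by have [y Cy] := curve_point_in_chart d_gt0 smF uM FO 0; exists (cpt M 0 y).
Qed.

Lemma tangent_nonzero p : curve_points F p -> exists v, dgrad F p v != 0.
Proof.
case: smF => _ sm /sm [i Fi]; exists (delta_mx 0 i).
rewrite /dgrad (bigD1 i) //= big1 ?addr0 ?mxE ?eqxx ?mulr1 // => j ji.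
by rewrite mxE (negPf ji) andbF mulr0.
Qed.

Lemma euler_formula m G p : G \is m.-homog -> dgrad G p p = m%:R * G.[: p].
Proof.
move=> /dhomogP hG; rewrite /dgrad.
have E : \sum_i G^`M(i) * 'X_i = m%:R *: G.
  rewrite [in RHS](mpolyE G) scaler_sumr.
  transitivity (\sum_(i : 'I_3) \sum_(mm <- msupp G) (G@_mm *: ('X_[mm])^`M(i) * 'X_i)).
    apply: eq_bigr => i _; rewrite {1}(mpolyE G) (big_morph _ (@mderivD _ _ i) (@mderiv0 _ _ i)) mulr_suml.
    by apply: eq_bigr => mm _; rewrite mderivZ.
  rewrite exchange_big /= !big_seq; apply: eq_bigr => mm /hG dmm.
  transitivity (\sum_i (mm i)%:R *: (G@_mm *: 'X_[mm])).
    apply: eq_bigr => i _; rewrite mderivX -!scalerAl -mpolyXD scalerA mulrC -scalerA.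
    have [e|e] := eqVneq (mm i) 0%N; first by rewrite e !(scale0r, scaler0).
    rewrite submK //; apply/mnm_lepP => j; rewrite mnm1E.
    by case: eqP => // <-; rewrite lt0n.
  by rewrite -scaler_suml -natr_sum -dmm /= mdegE.
have : (\sum_i G^`M(i) * 'X_i).[: p] = (m%:R *: G).[: p] by rewrite E.
rewrite mevalZ raddf_sum /= => <-; apply: eq_bigr => i _; by rewrite mevalM mevalXU.
Qed.

End SmoothCurve.

(** * Orders of vanishing at a smooth point *)

Section RingIdentities.
Variable R : comNzRingType.
Implicit Types (a b c f g h k l s t u v w y : R).

Lemma alg1 u y h l k v f : f - y * u = l * v -> u * (y * h + l * k) = f * h + l * (u * k - v * h).
Proof. by move=> e; have -> : f = y * u + l * v by [rewrite -e addrC subrK]; ring. Qed.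

Lemma alg2 h c f u v g t l w : c = u * f + v * g -> h * g = f * t + l * w ->
  h * c = f * (h * u + v * t) + l * (v * w).
Proof.
move=> -> e; have -> : h * (u * f + v * g) = h * u * f + v * (h * g) by ring.
by rewrite e; ring.
Qed.

Lemma alg3 p l h s b a : h * (p * s) = a + l * p * b -> p * (h * s - l * b) = a.
Proof. by move=> e; have -> : a = h * (p * s) - l * p * b by [rewrite e addrK]; ring. Qed.

Lemma alg4 u h g f t ln l g' t1 g1 : h * g = f * t + ln * g' -> u * g' = f * t1 + l * g1 ->
  u * h * g = f * (u * t + ln * t1) + l * ln * g1.
Proof.
move=> e e1; have -> : u * h * g = u * (h * g) by ring.
rewrite e; have -> : u * (f * t + ln * g') = f * u * t + ln * (u * g') by ring.
by rewrite e1; ring.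
Qed.

Lemma alg5 h1 g1 h2 g2 a1 a2 f t1 t2 q ln : h1 * g1 = f * t1 + q * ln * a1 -> h2 * g2 = f * t2 + ln * a2 ->
  h1 * a2 * g1 - h2 * a1 * q * g2 = f * (a2 * t1 - a1 * q * t2).
Proof.
move=> e1 e2; have -> : h1 * a2 * g1 = a2 * (h1 * g1) by ring.
have -> : h2 * a1 * q * g2 = a1 * q * (h2 * g2) by ring.
by rewrite e1 e2; ring.
Qed.

End RingIdentities.

Section LocalOrder.
Variable K : closedFieldType.
Implicit Types (f g h t w : {poly {poly K}}).
Local Notation l := (('X - (0 : K)%:P)%:P : {poly {poly K}}).
Local Notation at0 g := ((fiber 0 g).[0]).

Lemma bipoly_ext f g : (forall x y, (fiber x f).[y] = (fiber x g).[y]) -> f = g.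
Proof.
move=> H; apply/eqP; rewrite -subr_eq0; apply/negPn/negP => n0.
have l0 : lead_coef (f - g) != 0 by rewrite lead_coef_eq0.
have [x lx] := nonroot_exists l0.
have fx : fiber x (f - g) != 0.
  by apply: contraNneq lx => e; rewrite /lead_coef -coef_fiber e coef0.
have [y] := nonroot_exists fx.
by rewrite fiberB_eval H subrr eqxx.
Qed.

Lemma at0_l : at0 l = 0.
Proof. by rewrite fiberXsubC subrr hornerC. Qed.

(* The coordinate [l] is a uniformiser at the origin, where [f] is smooth. *)
Lemma local_order f g : f \is monic -> irreducible_factors f -> at0 f = 0 ->
  (fiber 0 f)^`().[0] != 0 -> ~ (exists w, g = f * w) ->
  exists n h t g', [/\ at0 h != 0, at0 g' != 0 & h * g = f * t + l ^+ n * g'].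
Proof.
move=> mf irr f0 df0 ng.
have [f1 ef1] := factor_root f0.
have u0 : f1.[0] != 0.
  by move: df0; rewrite ef1 derivM derivXsubC mul1r hornerD hornerM hornerXsubC subrr mul0r addr0.
(* Here f = Y u + l v with u a unit at the origin. Modulo f and up to a unit, Y is therefore a
   multiple of l, and so is every function that vanishes at the origin. *)
pose u := map_poly polyC f1; pose Y : {poly {poly K}} := map_poly polyC ('X - 0%:P).
have au : at0 u != 0 by rewrite fiber_lift.
have [v ev] : exists v, f - Y * u = l * v.
  by apply: fiber_eq0; rewrite fiberB fiberM !fiber_lift ef1 subrr.
have step h : at0 h = 0 -> exists t h', u * h = f * t + l * h'.
  move=> h0; have [h1 eh1] := factor_root h0.
  have [h2 eh2] : exists h2, h - Y * map_poly polyC h1 = l * h2.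
    by apply: fiber_eq0; rewrite fiberB fiberM !fiber_lift eh1 subrr.
  exists (map_poly polyC h1), (u * h2 - v * map_poly polyC h1).
  have -> : h = Y * map_poly polyC h1 + l * h2 by rewrite -eh2 addrC subrK.
  exact: alg1 ev.
(* The multiplicity k of 0 as a root of the eliminant bounds the order of g. If l^(k+1) divided g up
   to a unit, cancelling l^k would make f divide a polynomial that does not vanish at the origin. *)
have [c [u' [v' [c0 e]]]] := irreducible_bezout mf irr ng.
have [k [s s0 es]] := multiplicity_XsubC c 0; rewrite c0 /= in s0.
suff H n : (exists n' h t g', [/\ at0 h != 0, at0 g' != 0 & h * g = f * t + l ^+ n' * g']) \/
    exists h t g', at0 h != 0 /\ h * g = f * t + l ^+ n * g'.
  case: (H k.+1) => // -[h [t [g' [h0 eg]]]]; exfalso.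
  have E : l ^+ k * (h * s%:P - l * (v' * g')) = f * (h * u' + v' * t).
    have := alg2 e eg; rewrite es polyCM rmorphXn /= [s%:P * _]mulrC exprS => E; exact: alg3 E.
  have lk0 : ('X - 0%:P) ^+ k != 0 :> {poly K} by rewrite expf_neq0 // polyXsubC_eq0.
  rewrite -rmorphXn /= in E; have [w ew] := monic_dvd_scale mf lk0 E.
  have : at0 (h * s%:P - l * (v' * g')) = 0 by rewrite ew fiberM_eval f0 mul0r.
  rewrite fiberB_eval !fiberM_eval at0_l mul0r subr0 fiberC hornerC => /eqP.
  by rewrite mulf_eq0 (negPf h0) /=; apply/negP; exact: s0.
elim: n => [|n [IH|[h [t [g' [h0 eg]]]]]]; first right.
    exists 1, 0, g; split; first by rewrite rmorph1 hornerC oner_neq0.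
    by rewrite expr0 !mul1r mulr0 add0r.
  by left.
have [g0|g0] := eqVneq (at0 g') 0; last by left; exists n, h, t, g'.
have [t1 [g1 e1]] := step g' g0.
right; exists (u * h), (u * t + l ^+ n * t1), g1; split.
  by rewrite fiberM_eval mulf_neq0.
by rewrite exprS; exact: alg4 eg e1.
Qed.

(** The local ring of a smooth point is a discrete valuation ring: of two functions, the one of
    larger order is a multiple of the other. *)
Lemma local_valuation f g1 g2 : f \is monic -> irreducible_factors f -> at0 f = 0 ->
  (fiber 0 f)^`().[0] != 0 ->
  exists h1 h2 w, (at0 h1 != 0 \/ at0 h2 != 0) /\ h1 * g1 - h2 * g2 = f * w.
Proof.
move=> mf irr f0 df0.
have at01 : at0 (1 : {poly {poly K}}) != 0 by rewrite rmorph1 hornerC oner_neq0.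
have [[w ->]|n1] := EM (exists w, g1 = f * w).
  by exists 1, 0, w; split; [left | rewrite mul1r mul0r subr0].
have [[w ->]|n2] := EM (exists w, g2 = f * w).
  by exists 0, 1, (- w); split; [right | rewrite mul1r mul0r sub0r mulrN].
have [m [h1 [t1 [a1 [h10 a10 e1]]]]] := local_order mf irr f0 df0 n1.
have [n [h2 [t2 [a2 [h20 a20 e2]]]]] := local_order mf irr f0 df0 n2.
wlog le : m n g1 g2 h1 h2 t1 t2 a1 a2 n1 n2 h10 h20 a10 a20 e1 e2 / (n <= m)%N.
  move=> W; have [le|/ltnW le] := leqP n m; first exact: (W m n g1 g2 h1 h2 t1 t2 a1 a2).
  have [k1 [k2 [w [k0 e]]]] := W n m g2 g1 h2 h1 t2 t1 a2 a1 n2 n1 h20 h10 a20 a10 e2 e1 le.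
  exists k2, k1, (- w); split; first by case: k0; [right|left].
  by rewrite mulrN -e opprB.
exists (h1 * a2), (h2 * a1 * l ^+ (m - n)), (a2 * t1 - a1 * l ^+ (m - n) * t2); split.
  by left; rewrite fiberM_eval mulf_neq0.
by apply: alg5 e2; rewrite -exprD subnK.
Qed.

End LocalOrder.

(** * Regular quotients of forms *)

Section RegularFunctions.
Variable K : closedFieldType.
Variables (d : nat) (F : {mpoly K[3]}).
Hypotheses (d_gt1 : (1 < d)%N) (smF : smooth_plane_curve d F).
Implicit Types (G A B H W L Q N : {mpoly K[3]}) (p q : 'rV[K]_3).

Let d_gt0 : (0 < d)%N. Proof. exact: ltnW. Qed.
Let homF : F \is d.-homog. Proof. exact: curve_homog smF. Qed.

Lemma chartM (M : 'M[K]_3) A B : chart M (A * B) = chart M A * chart M B.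
Proof. by rewrite /chart /lsub comp_mpolyM /dehom; exact: rmorphM. Qed.

Lemma chartB (M : 'M[K]_3) A B : chart M (A - B) = chart M A - chart M B.
Proof. by rewrite /chart /lsub comp_mpolyB /dehom mmapB. Qed.

Lemma linear_formD L p q : L \is 1.-homog -> L.[: p + q] = L.[: p] + L.[: q].
Proof.
move=> /dhomogP hL; rewrite !mevalE -big_split !big_seq; apply: eq_bigr => m /hL /= /eqP/mdeg1P [i /eqP ->].
have E (v : 'rV[K]_3) : \prod_j v 0 j ^+ U_(i)%MM j = v 0 i.
  rewrite (bigD1 i) //= mnm1E eqxx expr1 big1 ?mulr1 // => j ji.
  by rewrite mnm1E eq_sym (negPf ji) expr0.
by rewrite !E mxE mulrDr.
Qed.

Lemma linear_formZ L p c : L \is 1.-homog -> L.[: c *: p] = c * L.[: p].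
Proof. by move=> hL; rewrite (homog_evalZ _ _ hL) expr1. Qed.

Definition form_of (l : 'rV[K]_3) : {mpoly K[3]} := \sum_i l 0 i *: 'X_i.

Lemma form_of_homog l : form_of l \is 1.-homog.
Proof. by apply: rpred_sum => i _; apply: dhomogZ; rewrite dhomogX /= mdeg1. Qed.

Lemma eval_form_of l p : (form_of l).[: p] = \sum_i l 0 i * p 0 i.
Proof. by rewrite raddf_sum; apply: eq_bigr => i _; rewrite /= mevalZ mevalXU. Qed.

Lemma chart_divides M G m : M \in unitmx -> F.[: pt 0 1 0 *m M] != 0 -> G \is m.-homog -> vanishes_on F G ->
  exists w, chart M G = chart_eq F M * w.
Proof.
move=> uM FO hG /(vanishes_multiple d_gt1 smF hG) [W [_ -> _]].
exists ((F.[: pt 0 1 0 *m M])%:P%:P * chart M W).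
by rewrite chartM (chartF FO) mulrCA !mulrA.
Qed.

(** The frame puts p at the origin of a chart whose centre O lies neither on C nor on the tangent at
    p. Then the fibre through p has a simple root there, as [local_valuation] requires. *)
Lemma valuation_ring p m n A B : curve_points F p -> A \is m.-homog -> B \is n.-homog ->
  exists e H G, [/\ H \is (e + n).-homog, G \is (e + m).-homog,
    (H.[: p] != 0 \/ G.[: p] != 0) & vanishes_on F (H * A - G * B)].
Proof.
move=> Cp hA hB; have [v dv] := tangent_nonzero smF Cp.
pose D := form_of (\row_i F^`M(i).[: p]).
have ED (w : 'rV[K]_3) : D.[: w] = dgrad F p w by rewrite eval_form_of; apply: eq_bigr => i _; rewrite mxE.
have D0 : D != 0 by apply: contraNneq dv => e; rewrite -ED e meval0.
have hFD := dhomogM homF (form_of_homog (\row_i F^`M(i).[: p])).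
have [O] := form_nonzero_at hFD (mulf_neq0 (curve_form_neq0 smF) D0).
rewrite mevalM mulf_eq0 negb_or ED => /andP[FO dO].
have /curve_pointsP [p0 Fp] := Cp.
have ncol : ~ collinear O p.
  move=> /collinear_sym/(collinear_scale p0 (off_curve_neq0 d_gt1 smF FO)) [c c0 eO].
  by move: FO; rewrite eO (homog_evalZ _ _ homF) Fp mulr0 eqxx.
have [u du] := det3_exists ncol.
pose M := frame u O p; have uM : M \in unitmx by exact: frame_unit.
have eO : pt 0 1 0 *m M = O by rewrite mul_pt_frame scale1r !scale0r add0r addr0.
have ep : cpt M 0 0 = p by rewrite /cpt mul_pt_frame scale1r !scale0r !add0r.
have FOM : F.[: pt 0 1 0 *m M] != 0 by rewrite eO.
have mf := chart_eq_monic d_gt0 smF uM FOM; have irr := chart_eq_irreducible d_gt0 smF uM FOM.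
set f := chart_eq F M in mf irr.
have f0 : (fiber 0 f).[0] = 0 by apply: chart_onroot; rewrite ep.
have df0 : (fiber 0 f)^`().[0] != 0.
  rewrite /f /chart_eq /chart deriv_fiber_dehom dgrad_lsub eO dgradZ.
  by rewrite -/(cpt M 0 0) ep mulf_neq0 // invr_eq0 -eO.
have [h1 [h2 [w [h0 e]]]] := local_valuation (chart M A) (chart M B) mf irr f0 df0.
have [n1 t1] := tdeg_lt_exists h1; have [n2 t2] := tdeg_lt_exists h2.
(* [s] leaves enough room in the degree to homogenise both local multipliers. *)
pose s := (n1 + n2)%N; exists s, (unchart M (s + n) h1), (unchart M (s + m) h2).
have T1 : tdeg_lt (s + n).+1 h1 by apply: tdeg_ltW t1; rewrite /s -addnA leqW // leq_addr.
have T2 : tdeg_lt (s + m).+1 h2 by apply: tdeg_ltW t2; rewrite /s [(n1 + n2)%N]addnC -addnA leqW // leq_addr.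
split; [exact: unchart_homog|exact: unchart_homog| |].
  by case: h0 => h0; [left|right]; move: h0; rewrite -ep -(fiber_chart M 0 0 (unchart _ _ _)) unchartK.
apply: (@chart_dvd_vanishes _ _ _ M d_gt0 smF uM FOM (s + n + m) _ w).
  apply: rpredB; first by apply: dhomogM; [exact: unchart_homog|].
  rewrite -addnA [(n + m)%N]addnC addnA; apply: dhomogM; [exact: unchart_homog|done].
by rewrite chartB !chartM !unchartK.
Qed.

(** Subtracting from G the multiple t of f, with t taken constant in x, changes nothing on C and
    makes G vanish on the whole line over x, so that the equation of this line can be divided
    out. *)
Lemma chart_divide_by_line M x m G t : M \in unitmx -> F.[: pt 0 1 0 *m M] != 0 -> G \is m.+1.-homog ->
  fiber x (chart M G) = fiber x (chart_eq F M) * t ->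
  exists G1, G1 \is m.-homog /\ vanishes_on F (G - unchart M 1 ('X - x%:P)%:P * G1).
Proof.
move=> uM FOM hG et; have mf := chart_eq_monic d_gt0 smF uM FOM.
set f := chart_eq F M in et mf; have sf : size f = d.+1 := chart_eq_size d_gt0 smF uM FOM.
pose T := map_poly polyC t.
have [g1 eg1] : exists g1, chart M G - f * T = ('X - x%:P)%:P * g1.
  apply: fiber_eq0; rewrite (fiberB x (chart M G) (f * T)) (fiberM x f T) (fiber_lift x t).
  by apply/eqP; rewrite subr_eq0; apply/eqP; exact: et.
have tG := tdeg_chart M hG.
have st : (size t <= m.+2 - d)%N.
  have [->|t0] := eqVneq t 0; first by rewrite size_poly0.
  have : (size (fiber x (chart M G)) <= m.+2)%N.
    apply/leq_sizeP => j mj; rewrite coef_fiber (_ : (chart M G)`_j = 0) ?horner0 //.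
    by apply/eqP; rewrite -size_poly_leq0; apply: leq_trans (tG j) _; move: mj; clear; lia.
  rewrite et size_monicM ?fiber_monic // size_fiber_monic // sf addSn /=.
  by move: (size t); clear; lia.
have tT : tdeg_lt (m.+2 - d) T.
  move=> i; rewrite coef_map /=; have [lt|le] := ltnP i (size t); last by rewrite nth_default // size_poly0.
  by apply: leq_trans (size_polyC_leq1 _) _; move: st lt; move: (size t); clear; lia.
have tfT : tdeg_lt m.+2 (f * T).
  have [le|gt] := leqP d m.+2.
    by move: (tdeg_ltM tT (chart_eq_tdeg M smF)); rewrite (subnK le) -/f (mulrC T f).
  have -> : T = 0 by apply: tdeg_lt0; move: tT; have -> : (m.+2 - d = 0)%N by move: gt; clear; lia.
  by rewrite mulr0; exact: tdeg_lt0r.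
have tg1 : tdeg_lt m.+1 g1.
  move=> i; have := tdeg_ltB tG tfT i; rewrite eg1 coefCM.
  have [->|g10] := eqVneq g1`_i 0; first by rewrite size_poly0.
  rewrite size_monicM ?monicXsubC // size_XsubC; move: (size _); clear => a /=; lia.
have tX : tdeg_lt 2 (('X - x%:P)%:P : {poly {poly K}}) by apply: tdeg_ltC; rewrite size_XsubC.
exists (unchart M m g1); split; first exact: unchart_homog.
apply: (@chart_dvd_vanishes _ _ _ M d_gt0 smF uM FOM m.+1 _ T).
  by apply: rpredB => //; exact: (dhomogM (unchart_homog M 1 _) (unchart_homog M m g1)).
by rewrite chartB chartM !unchartK // -/f -[f * T](subKr (chart M G)) eg1.
Qed.

(** In a frame where L is the line x = 0 through the centre O, the local conditions say that the
    fibre of f divides the fibre of G at each root, with multiplicities. *)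
Lemma divide_by_line (O : 'rV[K]_3) L m G : F.[: O] != 0 -> L \is 1.-homog -> L != 0 -> L.[: O] = 0 ->
  G \is m.+1.-homog ->
  (forall p, curve_points F p -> L.[: p] = 0 ->
    exists e H Q, [/\ H \is e.-homog, Q \is (e + m).-homog, H.[: p] != 0 & vanishes_on F (H * G - L * Q)]) ->
  exists G1, G1 \is m.-homog /\ vanishes_on F (G - L * G1).
Proof.
move=> FO hL L0 LO hG hreg.
have [u' Lu'] := form_nonzero_at hL L0.
have [u Lu] : exists u : 'rV[K]_3, L.[: u] = 1.
  by exists ((L.[: u'])^-1 *: u'); rewrite linear_formZ // mulVf.
have O0 := off_curve_neq0 d_gt1 smF FO.
have ncol : ~ collinear u O.
  have u0 : u != 0 by apply/eqP => e; move/eqP: Lu; rewrite e -(scale0r (0 : 'rV[K]_3)) linear_formZ // mul0r eq_sym oner_eq0.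
  move=> /(collinear_scale u0 O0) [c c0 eO].
  by move/eqP: LO; rewrite eO linear_formZ // Lu mulr1 (negPf c0).
have [w' dw'] := det3_exists ncol.
have [w [Lw dw]] : exists w : 'rV[K]_3, L.[: w] = 0 /\ det3 u O w != 0.
  exists (w' + (- L.[: w']) *: u); split.
    by rewrite linear_formD // linear_formZ // Lu mulr1 subrr.
  by move: dw'; congr (_ != _); rewrite /det3 !mxE; ring.
pose M := frame u O w; have uM : M \in unitmx by exact: frame_unit.
have eO : pt 0 1 0 *m M = O by rewrite mul_pt_frame scale1r !scale0r add0r addr0.
have FOM : F.[: pt 0 1 0 *m M] != 0 by rewrite eO.
have cL x y : L.[: cpt M x y] = x.
  by rewrite /cpt mul_pt_frame !linear_formD // !linear_formZ // Lu LO Lw !mulr0 !addr0 mulr1.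
have eL : chart M L = 'X%:P.
  by apply: bipoly_ext => x y; rewrite fiber_chart cL fiberC !hornerX hornerC.
have mf := chart_eq_monic d_gt0 smF uM FOM; set f := chart_eq F M in mf.
have [t et] : exists t, fiber 0 (chart M G) = fiber 0 f * t.
  apply: dvd_by_local_units; first by rewrite monic_neq0 // fiber_monic.
  move=> y /(chart_root uM FOM) Cy.
  have [e [H [Q [hH hQ Hp vHQ]]]] := hreg _ Cy (cL 0 y).
  have [|w1 ew1] := chart_divides (m := e + m.+1) uM FOM _ vHQ.
    apply: rpredB; first exact: dhomogM.
    by rewrite addnS; exact: (dhomogM hL hQ).
  exists (fiber 0 (chart M H)), (fiber 0 w1); split; first by rewrite fiber_chart.
  rewrite -[RHS]fiberM /f -ew1 chartB fiberB chartM fiberM; apply/esym; apply: etrans (subr0 _).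
  by congr (_ - _); rewrite chartM eL fiberM fiberC hornerX mul0r.
have eL1 : L = unchart M 1 ('X - 0%:P)%:P by rewrite polyC0 subr0 -eL chartK.
by rewrite eL1; exact: chart_divide_by_line et.
Qed.

End RegularFunctions.

Section GlobalRegular.
Variable K : closedFieldType.
Variables (d : nat) (F : {mpoly K[3]}).
Hypotheses (d_gt1 : (1 < d)%N) (smF : smooth_plane_curve d F).
Implicit Types (G A B H W L Q N : {mpoly K[3]}) (p q : 'rV[K]_3).

Let d_gt0 : (0 < d)%N. Proof. exact: ltnW. Qed.
Let homF : F \is d.-homog. Proof. exact: curve_homog smF. Qed.

(** A / B, a quotient of degree m - n, equals G / H on C with H(p) != 0. The equation e + m = e' + n
    states that the degrees agree without a subtraction. *)
Definition regular_quot m n A B p : Prop :=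
  exists e e' H G, [/\ H \is e.-homog, G \is e'.-homog, (e + m = e' + n)%N,
    H.[: p] != 0 & vanishes_on F (H * A - G * B)].

Lemma vanishesD A B : vanishes_on F A -> vanishes_on F B -> vanishes_on F (A + B).
Proof. by move=> vA vB p Cp; rewrite mevalD vA // vB // addr0. Qed.

Lemma vanishesMl A B : vanishes_on F B -> vanishes_on F (A * B).
Proof. by move=> vB p Cp; rewrite mevalM vB // mulr0. Qed.

Lemma linear_not_vanishing L : L \is 1.-homog -> L != 0 -> ~ vanishes_on F L.
Proof. by move=> hL /eqP L0 /(vanishes_low_degree d_gt1 smF hL d_gt1). Qed.

Lemma lines_homog (s : seq {mpoly K[3]}) : (forall L, L \in s -> L \is 1.-homog) ->
  \prod_(L <- s) L \is (size s).-homog.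
Proof.
elim: s => [|L s IH] H; first by rewrite big_nil dhomog1.
rewrite big_cons; apply: (dhomogM (d := 1)); first by apply: H; rewrite mem_head.
by apply: IH => L' Ls; apply: H; rewrite inE Ls orbT.
Qed.

Lemma lines_not_vanishing (s : seq {mpoly K[3]}) :
  (forall L, L \in s -> L \is 1.-homog /\ L != 0) -> ~ vanishes_on F (\prod_(L <- s) L).
Proof.
elim: s => [|L s IH] H.
  rewrite big_nil => v; have [p Cp] := curve_nonempty d_gt1 smF.
  by have /eqP := v p Cp; rewrite meval1 oner_eq0.
have [hL L0] := H L (mem_head _ _).
have Hs L' : L' \in s -> L' \is 1.-homog /\ L' != 0 by move=> Ls; apply: H; rewrite inE Ls orbT.
rewrite big_cons; apply: (not_vanishesM d_gt1 smF hL).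
- by apply: lines_homog => L' /Hs [].
- exact: linear_not_vanishing.
exact: IH.
Qed.

Lemma divide_by_lines (O : 'rV[K]_3) (s : seq {mpoly K[3]}) m G : F.[: O] != 0 ->
  (forall L, L \in s -> [/\ L \is 1.-homog, L != 0 & L.[: O] = 0]) -> G \is (size s + m).-homog ->
  (forall p, curve_points F p -> regular_quot (size s + m) (size s) G (\prod_(L <- s) L) p) ->
  exists N, N \is m.-homog /\ vanishes_on F (G - N * \prod_(L <- s) L).
Proof.
move=> FO; elim: s G => [|L s IH] G Hs hG reg.
  exists G; split=> //; rewrite big_nil mulr1 subrr => p _; exact: meval0.
have [hL L0 LO] := Hs L (mem_head _ _).
have Hs' L' : L' \in s -> [/\ L' \is 1.-homog, L' != 0 & L'.[: O] = 0].
  by move=> Ls; apply: Hs; rewrite inE Ls orbT.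
set P := \prod_(L' <- s) L' in IH.
have eP : \prod_(L' <- L :: s) L' = L * P by rewrite big_cons.
have hP : P \is (size s).-homog by apply: lines_homog => L' /Hs' [].
rewrite eP in reg *.
have [|G1 [hG1 vG1]] := divide_by_line (m := size s + m) d_gt1 smF FO hL L0 LO hG.
  move=> p Cp Lp; have [e [e' [H [Q [hH hQ ee Hp v]]]]] := reg p Cp.
  exists e, H, (Q * P); split=> //.
    have -> : (e + (size s + m) = e' + size s)%N by move: ee => /=; move: (size s); clear; lia.
    exact: dhomogM.
  by move: v; congr (vanishes_on F (_ - _)); ring.
have [|N [hN vN]] := IH G1 Hs' hG1.
  move=> p Cp; have [e [e' [H [Q [hH hQ ee Hp v]]]]] := reg p Cp.
  have ee' : (e + (size s + m) = e' + size s)%N by move: ee => /=; move: (size s); clear; lia.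
  exists e, e', H, Q; split=> //.
  apply: (vanishes_cancel (n := e + (size s + m)) d_gt1 smF hL).
  - apply: rpredB; first exact: dhomogM.
    by rewrite ee'; exact: dhomogM.
  - exact: linear_not_vanishing.
  have -> : L * (H * G1 - Q * P) = (H * G - Q * (L * P)) + (- H) * (G - L * G1) by ring.
  by apply: vanishesD => //; apply: vanishesMl.
exists N; split=> //.
have -> : G - N * (L * P) = (G - L * G1) + L * (G1 - N * P) by ring.
by apply: vanishesD => //; apply: vanishesMl.
Qed.

(** The eliminant c = u f + v B is a polynomial in x alone, hence a product of lines through the
    centre of projection. The degree is filled up with copies of the line at infinity, which passes
    through the centre as well. *)
Lemma multiple_is_lines n B : B \is n.-homog -> ~ vanishes_on F B ->
  exists (O : 'rV[K]_3) k V (s : seq {mpoly K[3]}), [/\ F.[: O] != 0, V \is k.-homog,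
    (k + n)%N = size s, (forall L, L \in s -> [/\ L \is 1.-homog, L != 0 & L.[: O] = 0]) &
    vanishes_on F (V * B - \prod_(L <- s) L)].
Proof.
move=> hB nB; have [M [uM FOM]] := chart_exists d_gt1 smF.
have [c [u [v [c0 e]]]] := chart_not_vanishing d_gt0 smF uM FOM hB nB.
have [r er] := closed_field_poly_normal c.
have l0 : lead_coef c != 0 by rewrite lead_coef_eq0.
have [k0 tv] := tdeg_lt_exists v.
pose k := (k0 + size r)%N.
pose Lx (x : K) : {mpoly K[3]} := unchart M 1 ('X - x%:P)%:P.
pose Z : {mpoly K[3]} := unchart M 1 1.
have tX x : tdeg_lt 2 (('X - x%:P)%:P : {poly {poly K}}) by apply: tdeg_ltC; rewrite size_XsubC.
have t1 : tdeg_lt 2 (1 : {poly {poly K}}) by rewrite -polyC1; apply: tdeg_ltC; rewrite size_poly1.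
have cX x : chart M (Lx x) = ('X - x%:P)%:P by rewrite unchartK.
have cZ : chart M Z = 1 by rewrite unchartK.
have chart_prod (s : seq {mpoly K[3]}) : chart M (\prod_(L <- s) L) = \prod_(L <- s) chart M L.
  elim: s => [|L s IH]; first by rewrite !big_nil /chart /lsub comp_mpoly1 /dehom; exact: rmorph1.
  by rewrite !big_cons chartM IH.
pose s := [seq Lx x | x <- r] ++ nseq (k + n - size r) Z.
have ss : size s = (k + n)%N.
  by rewrite size_cat size_map size_nseq subnKC // /k -addnA addnCA leq_addr.
have cs : chart M (\prod_(L <- s) L) = (\prod_(x <- r) ('X - x%:P))%:P.
  rewrite chart_prod /s big_cat big_map /= [X in _ * X]big1_seq ?mulr1; last first.
    by move=> L /= /nseqP [-> _].
  by rewrite rmorph_prod; apply: eq_bigr => x _; rewrite cX.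
have tv' : tdeg_lt k.+1 v by apply: tdeg_ltW tv; rewrite /k leqW // leq_addr.
pose V := (lead_coef c)^-1 *: unchart M k v.
have hs L : L \in s -> L \is 1.-homog.
  rewrite mem_cat => /orP[/mapP [x _ ->]|/nseqP [-> _]]; exact: unchart_homog.
exists (pt 0 1 0 *m M), k, V, s; split=> //.
- by apply: dhomogZ; exact: unchart_homog.
- move=> L Ls; split; first exact: hs.
    apply/eqP => L0; move: Ls; rewrite L0 mem_cat => /orP[/mapP [x _ eL]|/nseqP [eL _]].
      by move/eqP: (cX x); rewrite -eL /chart /lsub comp_mpoly0 /dehom mmap0 eq_sym (negPf (XsubC2_neq0 x)).
    by move/eqP: cZ; rewrite -eL /chart /lsub comp_mpoly0 /dehom mmap0 eq_sym oner_eq0.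
  have E g : (size (g : {poly {poly K}}) <= 1)%N -> tdeg_lt 2 g -> (unchart M 1 g).[: pt 0 1 0 *m M] = 0.
    move=> sg tg; have := coef_top_dehom (lsub_homog M (unchart_homog M 1 g)).
    rewrite -/(chart M _) unchartK // eval_lsub (coef_ge sg) // => /esym/eqP.
    by rewrite polyC_eq0 => /eqP.
  move: Ls; rewrite mem_cat => /orP[/mapP [x _ ->]|/nseqP [-> _]]; apply: E => //.
    exact: size_polyC_leq1.
  by rewrite size_poly1.
apply: (@chart_dvd_vanishes _ _ _ M d_gt0 smF uM FOM (k + n) _ (- ((lead_coef c)^-1%:P%:P * u))).
  apply: rpredB; last by rewrite -ss; exact: lines_homog.
  by apply: dhomogM => //; apply: dhomogZ; exact: unchart_homog.
rewrite chartB chartM chartZ unchartK // cs.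
have -> : \prod_(x <- r) ('X - x%:P) = (lead_coef c)^-1%:P * c.
  transitivity ((lead_coef c)^-1%:P * (lead_coef c *: \prod_(x <- r) ('X - x%:P))).
    by rewrite -mul_polyC mulrA -polyCM mulVf // mul1r.
  by rewrite -er.
rewrite polyCM e.
by move: (chart_eq F M) (chart M B) ((lead_coef c)^-1%:P)%:P => f b a; clear; ring.
Qed.

Lemma regular_is_form m n A B : A \is (n + m).-homog -> B \is n.-homog -> ~ vanishes_on F B ->
  (forall p, curve_points F p -> regular_quot (n + m) n A B p) ->
  exists N, N \is m.-homog /\ vanishes_on F (A - N * B).
Proof.
move=> hA hB nB reg; have [O [k [V [s [FO hV es hs vV]]]]] := multiple_is_lines hB nB.
set P := \prod_(L <- s) L in vV.
have hP : P \is (k + n).-homog by rewrite es; apply: lines_homog => L /hs [].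
have nP : ~ vanishes_on F P by apply: lines_not_vanishing => L /hs [].
have hVA : V * A \is (size s + m).-homog by rewrite -es -addnA; exact: dhomogM.
have [|N [hN vN]] := divide_by_lines FO hs hVA.
  move=> p Cp; have [e [e' [H [G [hH hG ee Hp v]]]]] := reg p Cp.
  exists e, e', H, G; split=> //; first by move: ee; rewrite -es; clear; lia.
  have -> : H * (V * A) - G * P = V * (H * A - G * B) + G * (V * B - P) by ring.
  by apply: vanishesD; exact: vanishesMl.
exists N; split=> //.
have nV : ~ vanishes_on F V.
  move=> v; apply: nP; have -> : P = B * V + (-1) * (V * B - P) by ring.
  by apply: vanishesD; exact: vanishesMl.
apply: (vanishes_cancel (n := n + m) d_gt1 smF hV) => //.
  by apply: rpredB => //; rewrite addnC; exact: dhomogM.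
have -> : V * (A - N * B) = (V * A - N * P) + (- N) * (V * B - P) by ring.
by apply: vanishesD => //; exact: vanishesMl.
Qed.

End GlobalRegular.

(** * The residue theorem *)

Section Transversal.
Variable K : closedFieldType.
Variables (d : nat) (F : {mpoly K[3]}).
Hypotheses (d_gt1 : (1 < d)%N) (smF : smooth_plane_curve d F).
Implicit Types (G A B H W L Q N : {mpoly K[3]}) (p q : 'rV[K]_3).

Let d_gt0 : (0 < d)%N. Proof. exact: ltnW. Qed.
Let homF : F \is d.-homog. Proof. exact: curve_homog smF. Qed.

(** General position: list the forms to be avoided and take a point where their product is
    nonzero. *)
Lemma common_nonzero (s : seq {mpoly K[3]}) : (forall G, G \in s -> exists m, G \is m.-homog /\ G != 0) ->
  exists O : 'rV[K]_3, forall G, G \in s -> G.[: O] != 0.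
Proof.
move=> H; have [m [hP P0]] : exists m, \prod_(G <- s) G \is m.-homog /\ \prod_(G <- s) G != 0.
  elim: s H => [|G s IH] H; first by exists 0%N; rewrite big_nil dhomog1 oner_neq0.
  have [|m [hm m0]] := IH; first by move=> G' Gs; apply: H; rewrite inE Gs orbT.
  have [n [hn n0]] := H G (mem_head _ _).
  by exists (n + m)%N; rewrite big_cons mulf_neq0 //; split=> //; exact: dhomogM.
have [O PO] := form_nonzero_at hP P0; exists O => G Gs; move: PO.
by rewrite (perm_big _ (perm_to_rem Gs)) big_cons mevalM mulf_eq0 negb_or => /andP[].
Qed.

(** For p on C this is the equation of the tangent line at p. *)
Definition polar p : {mpoly K[3]} := form_of (\row_i F^`M(i).[: p]).

Lemma eval_polar p q : (polar p).[: q] = dgrad F p q.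
Proof. by rewrite eval_form_of; apply: eq_bigr => i _; rewrite mxE. Qed.

Lemma polar_neq0 p : curve_points F p -> polar p != 0.
Proof.
by move=> Cp; have [v] := tangent_nonzero smF Cp; apply: contraNneq => e; rewrite -eval_polar e meval0.
Qed.

Lemma off_curve_not_collinear p q : curve_points F p -> F.[: q] != 0 -> ~ collinear q p.
Proof.
move=> /curve_pointsP [p0 Fp] Fq /collinear_sym/(collinear_scale p0 (off_curve_neq0 d_gt1 smF Fq)) [c c0 e].
by move: Fq; rewrite e (homog_evalZ _ _ homF) Fp mulr0 eqxx.
Qed.

Lemma cpt_collinear (M : 'M[K]_3) x y x' y' : M \in unitmx ->
  collinear (cpt M x y) (cpt M x' y') -> x = x' /\ y = y'.
Proof.
move=> uM /(collinear_scale (cpt_neq0 uM _ _) (cpt_neq0 uM _ _)) [c c0].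
rewrite /cpt scalemxAl => /(congr1 (fun z => z *m invmx M)); rewrite !mulmxK // => e.
have e0 := congr1 (fun z : 'rV_3 => z 0 ord0) e; have e1 := congr1 (fun z : 'rV_3 => z 0 i1) e.
have e2 := congr1 (fun z : 'rV_3 => z 0 i2) e; move: e0 e1 e2; rewrite !mxE /= mulr1.
by move=> -> -> <-; rewrite !mul1r.
Qed.

Lemma eval_unchart_line (M : 'M[K]_3) x : M \in unitmx -> let L := unchart M 1 ('X - x%:P)%:P in
  [/\ forall x' y, L.[: cpt M x' y] = x' - x, forall y, L.[: pt 1 y 0 *m M] = 1 & L.[: pt 0 1 0 *m M] = 0].
Proof.
move=> uM L; have tX : tdeg_lt 2 (('X - x%:P)%:P : {poly {poly K}}) by apply: tdeg_ltC; rewrite size_XsubC.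
have hL : L \is 1.-homog := unchart_homog M 1 _.
have cL : chart M L = ('X - x%:P)%:P by rewrite unchartK.
split=> [x' y|y|].
- by rewrite -(fiber_chart M x' y L) cL fiberXsubC hornerC.
- rewrite -(top_chart M y hL) cL (_ : top 1 _ = 1) ?hornerC //.
  apply/polyP => -[|[|i]]; rewrite coef_poly /= ?coefC /= ?coef1 //=.
  by rewrite subn0 coefB coefX coefC subr0.
have := coef_top_dehom (lsub_homog M hL).
rewrite -/(chart M _) cL eval_lsub coefC /= => /esym/eqP.
by rewrite polyC_eq0 => /eqP.
Qed.

Lemma transversal_line : exists L (q : 'I_d -> 'rV[K]_3), [/\ L \is 1.-homog, L != 0,
  forall i, [/\ curve_points F (q i), L.[: q i] = 0 & exists v : 'rV[K]_3, L.[: v] = 0 /\ dgrad F (q i) v != 0],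
  forall i j, collinear (q i) (q j) -> i = j &
  forall p, curve_points F p -> L.[: p] = 0 -> exists i, collinear p (q i)].
Proof.
have [p0 Cp0] := curve_nonempty d_gt1 smF.
(* O is chosen off the tangent at p0, so the derivative of f in y does not vanish at p0 and is no
   multiple of f. In positive characteristic this excludes an inseparable projection. *)
have [|O HO] := @common_nonzero [:: F; polar p0].
  move=> G; rewrite !inE => /orP[/eqP ->|/eqP ->]; first by exists d; split=> //; exact: curve_form_neq0 smF.
  by exists 1%N; split; [exact: form_of_homog|exact: polar_neq0].
have FO : F.[: O] != 0 by apply: HO; rewrite !inE eqxx.
have dO : dgrad F p0 O != 0 by rewrite -eval_polar; apply: HO; rewrite !inE eqxx orbT.
have [u du] := det3_exists (off_curve_not_collinear Cp0 FO).
pose M := frame u O p0; have uM : M \in unitmx by exact: frame_unit.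
have eO : pt 0 1 0 *m M = O by rewrite mul_pt_frame scale1r !scale0r add0r addr0.
have ep : cpt M 0 0 = p0 by rewrite /cpt mul_pt_frame scale1r !scale0r !add0r.
have FOM : F.[: pt 0 1 0 *m M] != 0 by rewrite eO.
clearbody M.
have mf := chart_eq_monic d_gt0 smF uM FOM; have sf := chart_eq_size d_gt0 smF uM FOM.
set f := chart_eq F M in mf sf.
have df x y : (fiber x f)^`().[y] = (F.[: O])^-1 * dgrad F (cpt M x y) O.
  by rewrite /f /chart_eq /chart deriv_fiber_dehom dgrad_lsub eO dgradZ.
have fd x : fiber x f^`() = (fiber x f)^`() by rewrite /fiber deriv_map.
have [|c [a [b [c0 e]]]] := chart_bezout d_gt0 smF uM FOM (g := f^`()).
  move=> [w ew]; have : (fiber 0 f^`()).[0] = 0.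
    by rewrite ew fiberM_eval (chart_onroot (x := 0) (y := 0)) ?mul0r // ep.
  by rewrite fd df ep => /eqP; rewrite mulf_eq0 invr_eq0 (negPf FO) (negPf dO).
(* c eliminates y from f and its derivative in y; over a non-root x of c the fibre has d distinct
   points, and the line over x is transversal. *)
have [x cx] := nonroot_exists c0.
have [r er] := closed_field_poly_normal (fiber x f).
rewrite (eqP (fiber_monic x mf)) scale1r in er.
have ur : uniq r.
  rewrite -separable_prod_XsubC -er separable_poly.unlock; apply: no_common_root_coprimep.
    by rewrite monic_neq0 // fiber_monic.
  move=> y fy f'y; move: cx; rewrite (bezout_eval x y e) -/f fy fd f'y !mulr0 addr0.
  by rewrite eqxx.
have sr : size r = d.
  by apply/eqP; rewrite -eqSS -(size_prod_XsubC r id) -er (size_fiber_monic x mf) sf.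
pose q (i : 'I_d) := cpt M x (nth 0 r i).
have Cq i : curve_points F (q i).
  apply: (chart_root uM FOM); rewrite -/f er; apply/rootP; rewrite root_prod_XsubC.
  by rewrite mem_nth // sr.
have [L1 L2 L3] := eval_unchart_line x uM.
set L := unchart M 1 ('X - x%:P)%:P in L1 L2 L3.
exists L, q; split.
- exact: unchart_homog.
- by apply/eqP => L0; have := L2 0; rewrite L0 meval0 => /eqP; rewrite eq_sym oner_eq0.
- move=> i; split=> //; first by rewrite L1 subrr.
  exists O; split; first by rewrite -eO.
  have : (fiber x f^`()).[nth 0 r i] != 0.
    apply: contraNneq cx => f'y; rewrite (bezout_eval x (nth 0 r i) e) f'y.
    by rewrite -/f (chart_onroot (Cq i)) !mulr0 addr0.
  by rewrite fd df mulf_eq0 negb_or => /andP[].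
- move=> i j /(cpt_collinear uM) [_ e']; apply: val_inj.
  have hi : (i < size r)%N by rewrite sr.
  have hj : (j < size r)%N by rewrite sr.
  by have := nth_uniq 0 hi hj ur; rewrite e' eqxx => /esym/eqP.
move=> p Cp Lp; have /curve_pointsP [pn0 Fp] := Cp.
case: (chart_cases uM pn0) => [[k [x' [y [k0 ek]]]]|[k [y [k0 ek]]]|[k [k0 ek]]].
- have xx : x' = x.
    move/eqP: Lp; rewrite ek linear_formZ ?unchart_homog // mulf_eq0 (negPf k0) L1 /=.
    by move/eqP/subr0_eq.
  rewrite {x'}xx in ek.
  have Fy : curve_points F (cpt M x y).
    apply/curve_pointsP; split; first exact: cpt_neq0.
    by move/eqP: Fp; rewrite ek (homog_evalZ _ _ homF) mulf_eq0 expf_eq0 (negPf k0) andbF => /eqP.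
  have yr : y \in r by rewrite -root_prod_XsubC -er; apply/rootP; exact: chart_onroot Fy.
  have ly : (index y r < d)%N by rewrite -sr index_mem.
  exists (Ordinal ly); rewrite /q /= nth_index // ek; apply: collinear_sym; exact: collinearZr.
- move/eqP: Lp; rewrite ek linear_formZ ?unchart_homog // L2 mulr1; by rewrite (negPf k0).
move/eqP: Fp; rewrite ek (homog_evalZ _ _ homF) mulf_eq0 expf_eq0 (negPf k0) andbF (negPf FOM).
by [].
Qed.

End Transversal.

Section Lagrange.
Variable K : fieldType.

(** The sum is the coefficient of X^(m-1) in the polynomial of degree less than m that interpolates
    t at the m points. This is t itself, of degree at most m - 2. *)
Lemma lagrange_residue m (x : 'I_m -> K) (t : {poly K}) : injective x -> (size t <= m.-1)%N ->
  \sum_i t.[x i] / \prod_(j | j != i) (x i - x j) = 0.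
Proof.
move=> inj_x st; case: m => [|m] in x t inj_x st *; first by rewrite big_ord0.
have dn i : \prod_(j | j != i) (x i - x j) != 0.
  by apply/prodf_neq0 => j ji; rewrite subr_eq0; apply: contraNneq ji => /inj_x ->.
pose w i := \prod_(j | j != i) ('X - (x j)%:P).
have sw i : size (w i) = m.+1.
  have -> : w i = \prod_(y <- [seq x j | j <- enum (predC1 i)]) ('X - y%:P).
    by rewrite big_map big_enum; apply: eq_bigl => j; rewrite !inE.
  by rewrite (size_prod_XsubC _ id) size_map -cardE cardC1 card_ord.
have mw i : w i \is monic by apply: monic_prod => j _; exact: monicXsubC.
pose c i := t.[x i] / \prod_(j | j != i) (x i - x j).
pose T := \sum_i c i *: w i - t.
have sT : (size T <= m.+1)%N.
  apply: leq_trans (size_polyD _ _) _; rewrite size_polyN geq_max (leq_trans st) // andbT.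
  apply: (big_ind (fun p : {poly K} => size p <= m.+1)%N) => [|p q sp sq|i _]; first by rewrite size_poly0.
    by rewrite (leq_trans (size_polyD _ _)) // geq_max sp sq.
  by rewrite (leq_trans (size_scale_leq _ _)) // sw.
have rT i : T.[x i] = 0.
  rewrite hornerD hornerN horner_sum (bigD1 i) //= big1 ?addr0 => [|j ji].
    rewrite hornerZ horner_prod (eq_bigr (fun j => x i - x j)) => [|j _]; last by rewrite hornerXsubC.
    by rewrite /c mulfVK // subrr.
  rewrite hornerZ horner_prod (bigD1 i) //=; last by rewrite eq_sym.
  by rewrite hornerXsubC subrr mul0r mulr0.
have T0 : T = 0.
  apply/eqP; apply: contraLR sT => Tn0; rewrite -ltnNge.
  have := @max_poly_roots _ T [seq x i | i <- enum 'I_m.+1] Tn0.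
  rewrite size_map size_enum_ord; apply; last by rewrite map_inj_uniq ?enum_uniq.
  by apply/allP => y /mapP [i _ ->]; apply/rootP.
have := congr1 (fun p : {poly K} => p`_m) T0.
rewrite coefB coef_sum coef0 [t`_m]nth_default // subr0 => E; rewrite -[RHS]E; apply: eq_bigr => i _.
have e1 : (w i)`_m = 1 by have := eqP (mw i); rewrite /lead_coef sw.
by rewrite coefZ e1 mulr1.
Qed.
End Lagrange.

Section Residues.
Variable K : closedFieldType.
Variables (d : nat) (F : {mpoly K[3]}).
Hypotheses (d_gt1 : (2 < d)%N) (smF : smooth_plane_curve d F).
Implicit Types (G A B H W L Q N T : {mpoly K[3]}) (p q u v w : 'rV[K]_3) (M : 'M[K]_3).

Let d_gt2 : (1 < d)%N. Proof. exact: ltnW. Qed.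
Let d_gt0 : (0 < d)%N. Proof. exact: ltnW. Qed.
Let homF : F \is d.-homog. Proof. exact: curve_homog smF. Qed.

Lemma fiber_mod_product x (a b c e : {poly {poly K}}) : fiber x e = 0 ->
  fiber x (a * b - c * e) = fiber x a * fiber x b.
Proof. by move=> e0; rewrite fiberB !fiberM e0 mulr0 subr0. Qed.

Lemma fiber_remainder x (n g f w r : {poly {poly K}}) (R t l : {poly K}) : n * g = f * w + r ->
  fiber x n = R * t -> fiber x f = l * R -> fiber x r = R * (t * fiber x g - l * fiber x w).
Proof.
move=> e en ef; have := congr1 (fiber x) e; rewrite fiberD !fiberM en ef => e'.
by rewrite mulrBr mulrA e' mulrA [R * l]mulrC addrC addKr.
Qed.

Lemma dhomog_mderiv m G i : G \is m.-homog -> G^`M(i) \is m.-1.-homog.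
Proof.
move=> /dhomogP hG; rewrite (mpolyE G) (big_morph _ (@mderivD _ _ i) (@mderiv0 _ _ i)) big_seq.
apply: rpred_sum => mm /hG /= dmm; rewrite mderivZ mderivX; apply: dhomogZ.
have [->|e] := eqVneq (mm i) 0%N; first by rewrite scale0r dhomog0.
apply: dhomogZ; rewrite dhomogX /= -dmm.
have {2}-> : mm = (mm - U_(i) + U_(i))%MM.
  by rewrite submK //; apply/mnm_lepP => j; rewrite mnm1E; case: eqP => // <-; rewrite lt0n.
by rewrite mdegD mdeg1 addn1.
Qed.

Lemma dgrad_scale m G p c v : G \is m.-homog -> dgrad G (c *: p) v = c ^+ m.-1 * dgrad G p v.
Proof.
move=> hG; rewrite /dgrad mulr_sumr; apply: eq_bigr => i _.
by rewrite (homog_evalZ _ _ (dhomog_mderiv i hG)) mulrA.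
Qed.

Lemma dhomog0_const G : G \is 0.-homog -> exists k, G = k%:MP.
Proof.
move=> hG; exists G@_0; apply/mpolyP => mm; rewrite mcoeffC.
have [->|m0] := eqVneq mm 0%MM; first by rewrite mulr1.
rewrite mulr0; apply: dhomog_nemf_coeff hG _.
by rewrite /= mdeg_eq0.
Qed.

Lemma det3_form v w : exists l : 'rV[K]_3, forall u, det3 u v w = (form_of l).[: u].
Proof.
exists (pt (v 0 i1 * w 0 i2 - v 0 i2 * w 0 i1) (- (v 0 ord0 * w 0 i2 - v 0 i2 * w 0 ord0))
  (v 0 ord0 * w 0 i1 - v 0 i1 * w 0 ord0)) => u.
by rewrite eval_form_of sum3 !ptE /det3; ring.
Qed.

Lemma det3_rot u v w : det3 u v w = det3 v w u.
Proof. by rewrite /det3; ring. Qed.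

Lemma collinear_unscale p q c : c != 0 -> collinear p (c *: q) -> collinear p q.
Proof.
move=> c0 H i j; apply: (mulfI c0); have := H i j; rewrite !mxE.
by rewrite mulrCA => ->; rewrite mulrCA.
Qed.

(** O avoids C, the tangents at the points [p i] and the lines joining two of them, so each [p i] is
    a simple root of its fibre and the abscissas are distinct. The choice of u keeps the points off
    the line at infinity, which joins u and O. *)
Lemma good_frame m (p : 'I_m -> 'rV[K]_3) : (forall i, curve_points F (p i)) ->
  (forall i j, collinear (p i) (p j) -> i = j) ->
  exists M, [/\ M \in unitmx, F.[: pt 0 1 0 *m M] != 0,
    forall i, dgrad F (p i) (pt 0 1 0 *m M) != 0 &
    exists c x y : 'I_m -> K, (forall i, c i != 0 /\ p i = c i *: cpt M (x i) (y i)) /\ injective x].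
Proof.
move=> Cp pinj.
pose lineform (i j : 'I_m) := form_of (sval (cid (det3_form (p i) (p j)))).
have lineE i j u : (lineform i j).[: u] = det3 u (p i) (p j).
  by rewrite /lineform; case: (cid _) => l /= ->.
have [|O HO] := @common_nonzero _ (F :: [seq polar F (p i) | i <- enum 'I_m] ++
    [seq lineform ij.1 ij.2 | ij <- enum {: 'I_m * 'I_m} & ij.1 != ij.2]).
  move=> G; rewrite inE mem_cat => /or3P[/eqP ->|/mapP [i _ ->]|/mapP [[i j]]].
  - by exists d; split=> //; exact: curve_form_neq0 smF.
  - by exists 1%N; split; [exact: form_of_homog|exact: polar_neq0 smF _ (Cp i)].
  rewrite mem_filter /= => /andP[ij _] ->; exists 1%N; split; first exact: form_of_homog.
  have [u du] : exists u, det3 u (p i) (p j) != 0.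
    by apply: det3_exists => /pinj e; rewrite e eqxx in ij.
  by apply: contraNneq du => e; rewrite -lineE e meval0.
have FO : F.[: O] != 0 by apply: HO; rewrite inE eqxx.
have dO i : dgrad F (p i) O != 0.
  have pm : polar F (p i) \in [seq polar F (p i) | i <- enum 'I_m].
    by apply: (map_f (fun i => polar F (p i))); rewrite mem_enum.
  by rewrite -eval_polar; apply: HO; rewrite inE mem_cat pm orbT.
have lO i j : i != j -> det3 O (p i) (p j) != 0.
  move=> ij; rewrite -lineE; apply: HO; rewrite inE mem_cat.
  apply/or3P; apply: Or33; apply: (map_f (fun z => lineform z.1 z.2) (x := (i, j))).
  by rewrite mem_filter /= ij mem_enum.
have O0 := off_curve_neq0 d_gt2 smF FO.
have [u0 [w0 du0]] := frame_exists O0.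
pose f1 (w : 'rV[K]_3) := form_of (sval (cid (det3_form O w))).
have f1E w u : (f1 w).[: u] = det3 u O w by rewrite /f1; case: (cid _) => l /= ->.
have [|u Hu] := @common_nonzero _ (f1 w0 :: [seq f1 (p i) | i <- enum 'I_m]).
  move=> G; rewrite inE => /orP[/eqP ->|/mapP [i _ ->]]; exists 1%N; (split; first exact: form_of_homog).
    by apply: contraNneq du0 => e; rewrite -f1E e meval0.
  have [v dv] := det3_exists (off_curve_not_collinear d_gt2 smF (Cp i) FO).
  by apply: contraNneq dv => e; rewrite -f1E e meval0.
have du : det3 u O w0 != 0 by rewrite -f1E; apply: Hu; rewrite inE eqxx.
have dup i : det3 u O (p i) != 0 by rewrite -f1E; apply: Hu; rewrite inE (map_f (fun i => f1 (p i))) ?orbT ?mem_enum.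
pose M := frame u O w0; have uM : M \in unitmx by exact: frame_unit.
have eO : pt 0 1 0 *m M = O by rewrite mul_pt_frame scale1r !scale0r add0r addr0.
have E i : exists cxy : K * K * K, cxy.1.1 != 0 /\ p i = cxy.1.1 *: cpt M cxy.1.2 cxy.2.
  have /curve_pointsP [pn0 Fp] := Cp i.
  case: (chart_cases uM pn0) => [[c [x [y ?]]]|[c [y [c0 e]]]|[c [c0 e]]].
  - by exists ((c, x), y).
  - have := dup i; rewrite e mul_pt_frame /det3 !mxE => /eqP; case; ring.
  have := dup i; rewrite e eO /det3 !mxE => /eqP; case; ring.
pose s i := sval (cid (E i)); have sP i : (s i).1.1 != 0 /\ p i = (s i).1.1 *: cpt M (s i).1.2 (s i).2.
  by rewrite /s; case: (cid (E i)).
exists M; split=> //; rewrite ?eO //.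
exists (fun i => (s i).1.1), (fun i => (s i).1.2), (fun i => (s i).2); split=> // i j xij.
apply/eqP; apply/negPn/negP => /lO /eqP; apply.
have [_ ->] := sP i; have [_ ->] := sP j; rewrite xij /cpt !mul_pt_frame /det3 !mxE; ring.
Qed.

Lemma regular_quot_scale m n A B p c : c != 0 -> regular_quot F m n A B p -> regular_quot F m n A B (c *: p).
Proof.
move=> c0 [e [e' [H [G [hH hG ee Hp v]]]]]; exists e, e', H, G; split=> //.
by rewrite (homog_evalZ _ _ hH) mulf_neq0 // expf_neq0.
Qed.

Lemma regular_quotMl k m n T A B p : T \is k.-homog -> regular_quot F m n A B p ->
  regular_quot F (k + m) n (T * A) B p.
Proof.
move=> hT [e [e' [H [G [hH hG ee Hp v]]]]]; exists e, (k + e')%N, H, (T * G); split=> //.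
- exact: dhomogM.
- by move: ee; clear; lia.
have -> : H * (T * A) - T * G * B = T * (H * A - G * B) by ring.
exact: vanishesMl.
Qed.

(* The proof is by Lagrange interpolation on the fibres of the projection from a general point. *)
Lemma residue_relation m (p : 'I_m -> 'rV[K]_3) n A B :
  (forall i, curve_points F (p i)) -> (forall i j, collinear (p i) (p j) -> i = j) ->
  A \is n.-homog -> B \is n.-homog -> ~ vanishes_on F B ->
  (forall q, curve_points F q -> (forall i, ~ collinear q (p i)) -> regular_quot F n n A B q) ->
  (forall i e T, T \is e.-homog -> T.[: p i] = 0 -> regular_quot F (e + n) n (T * A) B (p i)) ->
  (exists c, vanishes_on F (A - c *: B)) \/
  exists a : 'I_m -> K, (exists i, a i != 0) /\
    forall G, G \is (d - 3).-homog -> \sum_i a i * G.[: p i] = 0.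
Proof.
move=> Cp pinj hA hB nB reg1 reg2.
have [M [uM FOM dO [c [x [y [pE xinj]]]]]] := good_frame Cp pinj.
have c0 i : c i != 0 by case: (pE i).
have ep i : p i = c i *: cpt M (x i) (y i) by case: (pE i).
have [L eL] : exists L : 'I_m -> {mpoly K[3]}, L = fun i => unchart M 1 ('X - (x i)%:P)%:P by eexists.
have hL i : L i \is 1.-homog by rewrite eL; exact: unchart_homog.
have [LE Linf LO] : [/\ forall i x' y, (L i).[: cpt M x' y] = x' - x i, forall i y, (L i).[: pt 1 y 0 *m M] = 1
    & forall i, (L i).[: pt 0 1 0 *m M] = 0].
  by rewrite eL; split=> i; case: (eval_unchart_line (x i) uM).
(* [L i] is the vertical line through [p i]. Multiplying by their product P clears the simple poles,
   so that A / B = N / P on C with a form N of degree m. *)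
have [P eP] : exists P, P = \prod_i L i by eexists.
have hP : P \is m.-homog.
  have := @lines_homog K [seq L i | i <- enum 'I_m]; rewrite big_map big_enum size_map size_enum_ord eP; apply.
  by move=> _ /mapP [i _ ->].
have Pp i : P.[: p i] = 0.
  by rewrite eP (bigD1 i) //= mevalM ep linear_formZ // LE subrr mulr0 mul0r.
have nP : ~ vanishes_on F P.
  have := @lines_not_vanishing K d F d_gt2 smF [seq L i | i <- enum 'I_m]; rewrite big_map big_enum eP; apply.
  move=> _ /mapP [i _ ->]; split=> //; apply/eqP => L0.
  by have := Linf i 0; rewrite L0 meval0 => /eqP; rewrite eq_sym oner_eq0.
have hPA : P * A \is (n + m).-homog by rewrite addnC; exact: dhomogM.
have [|N [hN vN]] := regular_is_form d_gt2 smF hPA hB nB.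
  move=> q Cq; have [[i qi]|/forallNP nq] := EM (exists i, collinear q (p i)).
    have /curve_pointsP [pi0 _] := Cp i; have /curve_pointsP [q0 _] := Cq.
    have [k k0 ->] := collinear_scale pi0 q0 (collinear_sym qi).
    by apply: regular_quot_scale => //; rewrite addnC; exact: reg2.
  by rewrite addnC; apply: regular_quotMl => //; exact: reg1.
set f := chart_eq F M.
have mf : f \is monic := chart_eq_monic d_gt0 smF uM FOM.
have sf : size f = d.+1 := chart_eq_size d_gt0 smF uM FOM.
have Cxy i : curve_points F (cpt M (x i) (y i)).
  have := curve_points_scale smF (c := (c i)^-1) _ (Cp i).
  by rewrite ep scalerA mulVf // scale1r; apply; rewrite invr_eq0.
have f0 i : (fiber (x i) f).[y i] = 0 by exact: chart_onroot.
have df0 i : (fiber (x i) f)^`().[y i] != 0.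
  rewrite /f /chart_eq /chart deriv_fiber_dehom dgrad_lsub dgradZ mulf_neq0 ?invr_eq0 //.
  by have := dO i; rewrite ep (dgrad_scale _ _ _ homF) mulf_eq0 negb_or => /andP[].
have cLx i : chart M (L i) = ('X - (x i)%:P)%:P.
  by rewrite eL unchartK //; apply: tdeg_ltC; rewrite size_XsubC.
have cP0 i : fiber (x i) (chart M P) = 0.
  by rewrite eP (bigD1 i) //= chartM fiberM cLx fiberXsubC subrr mul0r.
(* [R i] is the equation of the fibre through [p i] with the simple root [y i] removed. *)
have /choice [R RE] i : exists R, fiber (x i) f = ('X - (y i)%:P) * R by exact: factor_root (f0 i).
have Ry i : (R i).[y i] != 0.
  by move: (df0 i); rewrite RE derivM derivXsubC mul1r hornerD hornerM hornerXsubC subrr mul0r addr0.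
have sR i : size (R i) = d.
  have R0 : R i != 0 by apply: contraNneq (Ry i) => ->; rewrite horner0.
  by have := size_fiber_monic (x i) mf; rewrite RE size_monicM ?monicXsubC // size_XsubC sf => -[].
have mR i : R i \is monic.
  by have := fiber_monic (x i) mf; rewrite RE monicMl ?monicXsubC.
(* At the other points of this fibre A / B is regular, so N vanishes there at least as P does and is
   divisible by [R i]. Up to a nonzero factor, the value of [t i] at [y i] is the residue at
   [p i]. *)
have /choice [t tE] i : exists t, fiber (x i) (chart M N) = R i * t.
  apply: dvd_by_local_units; first exact: monic_neq0.
  move=> z Rz; have yz : z <> y i by move=> e; move: (Ry i); rewrite -e Rz eqxx.
  have Cz : curve_points F (cpt M (x i) z).
    by apply: (chart_root uM FOM); rewrite -/f RE hornerM Rz mulr0.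
  have [j|e [e' [H [G [hH hG ee Hp v]]]]] := reg1 _ Cz.
    by rewrite ep => /(collinear_unscale (c0 j))/(cpt_collinear uM) [/xinj ij zz]; apply: yz; rewrite zz ij.
  have hHN : H * N - G * P \is (e + m).-homog.
    apply: rpredB; first exact: dhomogM.
    by have -> : (e + m = e' + m)%N by [move: ee; clear; lia]; exact: dhomogM.
  have vHN : vanishes_on F (H * N - G * P).
    apply: (vanishes_cancel d_gt2 smF hB hHN nB).
    have -> : B * (H * N - G * P) = (P * (H * A - G * B)) + (- H) * (P * A - N * B) by ring.
    by apply: vanishesD; exact: vanishesMl.
  have [w ew] := chart_divides d_gt2 smF uM FOM hHN vHN.
  exists (fiber (x i) (chart M H)), (('X - (y i)%:P) * fiber (x i) w); split.
    by rewrite (fiber_chart M (x i) z H).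
  have : fiber (x i) (chart M (H * N - G * P)) = fiber (x i) (chart M H) * fiber (x i) (chart M N).
    apply: etrans (fiber_mod_product _ _ _ (cP0 i)); congr (fiber _ _).
    by apply: etrans (chartB _ _ _) _; congr (_ - _); exact: chartM.
  move=> <-; apply: etrans (congr1 (fiber (x i)) ew) _; rewrite fiberM -/f RE.
  by rewrite mulrA [R i * _]mulrC.
(* If some residue is nonzero, the residues are the coefficients of the relation; if all vanish, A /
   B is constant. *)
have [tz|/existsNP [i0 ti0]] := EM (forall i, (t i).[y i] = 0); last first.
  right; pose D i := \prod_(j | j != i) (x i - x j).
  have D0 i : D i != 0.
    by apply/prodf_neq0 => j ji; rewrite subr_eq0; apply: contraNneq ji => /xinj ->.
  (* The product D i comes from the other factors of P, the power of [c i] from the scaling of the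
     coordinates of [p i] in a form of degree d - 3. *)
  exists (fun i => (t i).[y i] / D i / c i ^+ (d - 3)); split.
    exists i0; rewrite !mulf_neq0 ?invr_eq0 ?expf_neq0 //; exact/eqP.
  move=> G hG; have tNG := tdeg_chart M (dhomogM hN hG).
  have [W [r [eW sr tr _]]] := tdeg_div mf sf (chart_eq_tdeg M smF) tNG.
  (* N G has degree m + d - 3, so the coefficient of y^(d-1) in its remainder has degree at most m -
     2 in x. This is exactly the bound needed for the Lagrange identity, and it is where d - 3 comes
     from. *)
  have st : (size (r`_d.-1)%R <= m.-1)%N.
    apply: leq_trans (tr d.-1) _; move: d_gt1; clear; lia.
  rewrite -[RHS](lagrange_residue xinj st); apply: eq_bigr => i _.
  rewrite ep (homog_evalZ _ _ hG) -/(D i).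
  suff -> : (r`_d.-1).[x i] = (t i).[y i] * G.[: cpt M (x i) (y i)].
    by field; rewrite D0 expf_neq0.
  have er : fiber (x i) r = R i * (t i * fiber (x i) (chart M G) - ('X - (y i)%:P) * fiber (x i) W).
    by apply: (fiber_remainder _ (tE i) (RE i)); rewrite -eW; apply/esym; exact: chartM.
  set Q := t i * _ - _ in er.
  (* The remainder has degree less than d in y and [R i] has degree d - 1, so the cofactor Q is a
     constant, which can be read off at [y i]. *)
  have sQ : (size Q <= 1)%N.
    rewrite leqNgt; apply/negP => s1.
    have : (size (fiber (x i) r) <= d)%N.
      by apply/leq_sizeP => j dj; rewrite coef_fiber (coef_ge sr dj) horner0.
    rewrite er size_monicM // ?sR; last by rewrite -size_poly_gt0 ltnW.
    by move: s1 d_gt1; move: (size Q); clear; lia.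
  rewrite -coef_fiber er (size1_polyC sQ) mulrC coefCM.
  have -> : (R i)`_d.-1 = 1 by have := eqP (mR i); rewrite /lead_coef sR.
  rewrite mulr1 -(hornerC Q`_0 (y i)) -(size1_polyC sQ) /Q hornerD hornerN !hornerM hornerXsubC subrr mul0r subr0.
  by rewrite (fiber_chart M (x i) (y i) G).
left; have hN0 : N \is (m + 0).-homog by rewrite addn0.
have [|C [hC vC]] := regular_is_form d_gt2 smF hN0 hP nP; last first.
  have [k ek] := dhomog0_const hC; exists k.
  apply: (vanishes_cancel (n := n) d_gt2 smF hP _ nP).
    by apply: rpredB => //; exact: dhomogZ.
  have -> : P * (A - k *: B) = (P * A - N * B) + B * (N - C * P).
    by rewrite ek -[k *: B]mul_mpolyC; ring.
  by apply: vanishesD => //; exact: vanishesMl.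
move=> q Cq; rewrite addn0; have [Pq|Pq] := eqVneq P.[: q] 0; last first.
  exists m, m, P, N; split=> //.
  have -> : P * N - N * P = 0 by ring.
  by move=> z _; exact: meval0.
have [i Lq] : exists i, (L i).[: q] = 0.
  apply: contrapT => /forallNP H; move/eqP: Pq; rewrite eP rmorph_prod /=.
  by apply/negP/prodf_neq0 => i _; apply/eqP; exact: H.
have /curve_pointsP [q0 Fq] := Cq.
have [k [y' [k0 eq]]] : exists k y', k != 0 /\ q = k *: cpt M (x i) y'.
  case: (chart_cases uM q0) => [[k [x' [y' [k0 ek]]]]|[k [y' [k0 ek]]]|[k [k0 ek]]].
  - exists k, y'; split=> //; move/eqP: Lq; rewrite ek linear_formZ // LE mulf_eq0 (negPf k0) /=.
    by move=> /eqP/subr0_eq ->.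
  - by move/eqP: Lq; rewrite ek linear_formZ // Linf mulr1 (negPf k0).
  by move/eqP: Fq; rewrite ek (homog_evalZ _ _ homF) mulf_eq0 expf_eq0 (negPf k0) andbF (negPf FOM).
have m1 : (m.-1.+1 = m)%N by rewrite prednK // (leq_ltn_trans _ (ltn_ord i)).
(* As the residue at [p i] vanishes, N vanishes on the whole fibre and can be divided by [L i] on C;
   what is left of P is nonzero at q. *)
have [t' et'] := factor_root (tz i).
have hN1 : N \is m.-1.+1.-homog by rewrite m1.
have [|G1 [hG1 vG1]] := chart_divide_by_line (x := x i) (t := t') d_gt2 smF uM FOM hN1.
  apply: etrans (tE i) _; apply: etrans (congr1 (fun z => z * t') (esym (RE i))).
  by rewrite et' mulrA [R i * _]mulrC.
pose P' := \prod_(j | j != i) L j.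
have eP' : P = L i * P' by rewrite eP (bigD1 i).
have hP' : P' \is m.-1.-homog.
  have := @lines_homog K [seq L j | j <- enum (predC1 i)].
  rewrite big_map big_enum size_map -cardE cardC1 card_ord => H.
  have -> : P' = \prod_(j in predC1 i) L j by apply: eq_bigl => j; rewrite inE.
  by apply: H => _ /mapP [j _ ->].
exists m.-1, m.-1, P', G1; split=> //.
  rewrite /P' rmorph_prod /=; apply/prodf_neq0 => j ji.
  by rewrite eq linear_formZ // mulf_neq0 // LE subr_eq0; apply: contraNneq ji => /xinj ->.
have -> : P' * N - G1 * P = P' * (N - L i * G1) by rewrite eP'; ring.
by rewrite eL; exact: vanishesMl.
Qed.

End Residues.

(** * Linearity of birational self-maps *)

Section LinearForms.
Variable K : closedFieldType.
Implicit Types (G H L N T : {mpoly K[3]}) (p q u v w l : 'rV[K]_3) (M : 'M[K]_3).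

Lemma linear_form_coefs L : L \is 1.-homog -> exists l, L = form_of l.
Proof.
move=> hL; exists (\row_i L@_U_(i)); apply/mpolyP => mm; rewrite raddf_sum /=.
have [/eqP/mdeg1P [i /eqP ->]|nm] := eqVneq (mdeg mm) 1%N.
  rewrite (bigD1 i) //= big1 ?addr0 => [|j ji]; first by rewrite mcoeffZ mxE mcoeffXU eqxx mulr1.
  by rewrite mcoeffZ mcoeffXU (negPf ji) mulr0.
rewrite (dhomog_nemf_coeff hL nm) big1 // => j _; rewrite mcoeffZ mcoeffX.
by case: eqP => [e|_]; rewrite ?mulr0 //; rewrite -e /= mdeg1 eqxx in nm.
Qed.

Lemma form_of_eq0 l : form_of l = 0 -> l = 0.
Proof.
move=> e; apply/rowP => i; rewrite mxE.
have : (form_of l).[: (delta_mx 0 i : 'rV[K]_3)] = 0 by rewrite e meval0.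
rewrite eval_form_of (bigD1 i) //= big1 ?addr0.
  by rewrite mxE !eqxx mulr1.
by move=> j ji; rewrite mxE (negPf ji) andbF mulr0.
Qed.

Lemma dgrad_linear L p v : L \is 1.-homog -> dgrad L p v = L.[: v].
Proof.
move=> hL; have := euler_formula v hL; rewrite mul1r => <-; apply: eq_bigr => i _.
by have [k ->] := dhomog0_const (dhomog_mderiv i hL); rewrite !mevalC.
Qed.

Lemma collinear_linear_forms L N p q : L \is 1.-homog -> N \is 1.-homog -> collinear p q ->
  L.[: p] * N.[: q] = N.[: p] * L.[: q].
Proof.
move=> /linear_form_coefs [l ->] /linear_form_coefs [n ->] H; rewrite !eval_form_of !mulr_suml.
transitivity (\sum_i \sum_j l 0 i * n 0 j * (p 0 i * q 0 j)).
  by apply: eq_bigr => i _; rewrite mulr_sumr; apply: eq_bigr => j _; ring.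
rewrite exchange_big; apply: eq_bigr => j _; rewrite mulr_sumr; apply: eq_bigr => i _.
by rewrite /= (H i j); ring.
Qed.

Lemma collinear_trans_mid p q w : q != 0 -> collinear p q -> collinear q w -> collinear p w.
Proof.
move=> /nonzero_coord [k qk] H1 H2 i j; apply: (mulfI qk).
have -> : q 0 k * (p 0 i * w 0 j) = p 0 i * q 0 k * w 0 j by ring.
rewrite (H1 i k); have -> : p 0 k * q 0 i * w 0 j = p 0 k * (q 0 i * w 0 j) by ring.
rewrite (H2 i j); have -> : p 0 k * (q 0 j * w 0 i) = (p 0 k * q 0 j) * w 0 i by ring.
by rewrite -(H1 j k); ring.
Qed.

Lemma collinear_scale_mid p q : q != 0 -> collinear p q -> exists c, p = c *: q.
Proof.
move=> /nonzero_coord [k qk] H; exists (p 0 k / q 0 k); apply/rowP => i; rewrite mxE.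
by apply: (mulIf qk); rewrite (H i k); field.
Qed.

Lemma line_through_two L N p q : L \is 1.-homog -> N \is 1.-homog -> N != 0 -> ~ collinear p q ->
  L.[: p] = 0 -> L.[: q] = 0 -> N.[: p] = 0 -> N.[: q] = 0 -> forall x : 'rV[K]_3, N.[: x] = 0 -> L.[: x] = 0.
Proof.
move=> hL hN N0 /det3_exists [u du] Lp Lq Np Nq x.
have ex : x = x *m invmx (frame u p q) *m frame u p q by rewrite mulmxKV // frame_unit.
have E (G : {mpoly K[3]}) : G \is 1.-homog -> G.[: p] = 0 -> G.[: q] = 0 -> forall y : 'rV[K]_3, G.[: y *m frame u p q] = y 0 ord0 * G.[: u].
  move=> hG Gp Gq y; rewrite (pt_eta y) mul_pt_frame !linear_formD // !linear_formZ // Gp Gq ptE.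
  by rewrite !mulr0 !addr0.
have Nu : N.[: u] != 0.
  have [z] := form_nonzero_at hN N0; apply: contraNneq => Nu.
  have -> : z = z *m invmx (frame u p q) *m frame u p q by rewrite mulmxKV // frame_unit.
  by rewrite E // Nu mulr0.
rewrite ex (E N) // (E L) // => /eqP; rewrite mulf_eq0 (negPf Nu) orbF => /eqP ->.
by rewrite mul0r.
Qed.

Lemma line_avoiding p q : ~ collinear p q -> exists L, [/\ L \is 1.-homog, L.[: p] = 0 & L.[: q] != 0].
Proof.
move=> /det3_exists [w dw]; have [l lE] := det3_form w p; exists (form_of l).
split; [exact: form_of_homog | rewrite -lE /det3; ring |].
by rewrite -lE det3_rot.
Qed.

Lemma line_joining p q : ~ collinear p q ->
  exists L, [/\ L \is 1.-homog, L != 0, L.[: p] = 0, L.[: q] = 0 & forall x : 'rV[K]_3, det3 x p q = L.[: x]].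
Proof.
move=> /det3_exists [w dw]; have [l lE] := det3_form p q; exists (form_of l).
split=> //; [exact: form_of_homog | | rewrite -lE /det3; ring | rewrite -lE /det3; ring].
by apply: contraNneq dw => e; rewrite lE e meval0.
Qed.

(** Suppose [p k] is off the line through [p i0] and [p j0]. The line through [p k] and [p j0],
    together with one line avoiding [p i0] through each remaining point, gives a form of degree m -
    2 that vanishes at all the points except [p i0]. The relation then forces the coefficient of
    [p i0] to be zero. *)
Lemma dependent_points_aligned m (p : 'I_m -> 'rV[K]_3) (a : 'I_m -> K) : (1 < m)%N ->
  (forall i j, collinear (p i) (p j) -> i = j) -> (exists i, a i != 0) ->
  (forall G, G \is (m - 2).-homog -> \sum_i a i * G.[: p i] = 0) ->
  exists L, [/\ L \is 1.-homog, L != 0 & forall i, L.[: p i] = 0].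
Proof.
move=> m1 pinj [i0 ai0] rel.
have [j0 j0i] : exists j0, j0 != i0.
  have : (0 < #|predC1 i0|)%N by rewrite cardC1 card_ord; move: m1; clear; case: m => [|[]].
  by move=> /card_gt0P [j0]; rewrite inE => ?; exists j0.
have ncol i j : i != j -> ~ collinear (p i) (p j) by move=> ij /pinj e; rewrite e eqxx in ij.
have [L [hL L0 Lj Li LE]] := line_joining (ncol _ _ j0i).
exists L; split=> // k; rewrite -LE.
have [->|kj] := eqVneq k j0; first by rewrite /det3; ring.
have [->|ki] := eqVneq k i0; first by rewrite /det3; ring.
apply/eqP/negPn/negP => dk; move/eqP: ai0; apply.
have /choice [g gP] i : exists g, i != i0 -> [/\ g \is 1.-homog, g.[: p i] = 0 & g.[: p i0] != 0].
  have [->|ii] := eqVneq i i0; first by exists 0.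
  by have [N [hN Ni Ni0]] := line_avoiding (ncol _ _ ii); exists N.
have [N [hN N0 Nk Nj NE]] := line_joining (ncol _ _ kj).
pose h i := if i == k then N else g i.
pose I := [predD1 (predC1 i0) & j0].
have hP i : i \in I -> [/\ h i \is 1.-homog, (h i).[: p i] = 0 & (h i).[: p i0] != 0].
  rewrite !inE /h => /andP[_ ii]; case: eqP => [->|_]; last exact: gP.
  by split=> //; rewrite -NE det3_rot.
have cI : #|I| = (m - 2)%N.
  have := cardD1 j0 (predC1 i0); rewrite cardC1 card_ord inE j0i -/I => e.
  by have -> : (m - 2 = m.-1 - 1)%N by [clear; lia]; rewrite e addKn.
pose G := \prod_(i in I) h i.
have hG : G \is (m - 2).-homog.
  have := @lines_homog K [seq h i | i <- enum I]; rewrite big_map big_enum size_map -cardE cI; apply.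
  by move=> _ /mapP [i iI ->]; rewrite mem_enum in iI; case: (hP _ iI).
have := rel G hG; rewrite (bigD1 i0) //= big1 ?addr0.
  move=> /eqP; rewrite mulf_eq0 => /orP[/eqP //|]; rewrite /G rmorph_prod /=.
  by move/negPn/negP; case; apply/prodf_neq0 => i iI; case: (hP _ iI).
move=> i ii; apply/eqP; rewrite mulf_eq0; apply/orP; right; apply/eqP; rewrite /G.
have [->|ij] := eqVneq i j0.
  rewrite (bigD1 k) /= ?mevalM; last by rewrite !inE kj.
  by rewrite {1}/h eqxx Nj mul0r.
by rewrite (bigD1 i) /= ?mevalM; [case: (hP i) => [|_ -> _]; rewrite ?mul0r // !inE ij|rewrite !inE ij].
Qed.

End LinearForms.

Section RationalMaps.
Variable K : closedFieldType.
Variables (d : nat) (F : {mpoly K[3]}).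
Hypotheses (d_gt3 : (3 < d)%N) (smF : smooth_plane_curve d F).
Implicit Types (G A B H W L N T : {mpoly K[3]}) (p q x : 'rV[K]_3) (Phi Psi : 3.-tuple {mpoly K[3]}).

Let d_gt2 : (2 < d)%N. Proof. exact: ltnW. Qed.
Let d_gt1 : (1 < d)%N. Proof. exact: ltnW. Qed.
Let d_gt0 : (0 < d)%N. Proof. exact: ltnW. Qed.
Let homF : F \is d.-homog. Proof. exact: curve_homog smF. Qed.

Definition evt Phi x : 'rV[K]_3 := \row_i (tnth Phi i).[: x].

Lemma evtE Phi x i : evt Phi x 0 i = (tnth Phi i).[: x]. Proof. by rewrite mxE. Qed.

Lemma eval_comp G Phi x : (G \mPo Phi).[: x] = G.[: evt Phi x].
Proof. by rewrite comp_mpoly_meval; apply: meval_eq => i; rewrite evtE. Qed.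

Definition forms e Phi : Prop := forall i, tnth Phi i \is e.-homog.
Definition nontrivial Phi : Prop := exists i, ~ vanishes_on F (tnth Phi i).
(** A zero row is collinear with everything, so no condition is imposed at points where one of the
    tuples vanishes. *)
Definition agree Phi Psi : Prop := forall x, curve_points F x -> collinear (evt Phi x) (evt Psi x).
Definition selfmap Phi : Prop := vanishes_on F (F \mPo Phi).

Lemma evt_scale e Phi c x : forms e Phi -> evt Phi (c *: x) = c ^+ e *: evt Phi x.
Proof. by move=> hP; apply/rowP => i; rewrite !mxE (homog_evalZ _ _ (hP i)). Qed.

Lemma comp_homog G m e Phi : G \is m.-homog -> forms e Phi -> G \mPo Phi \is (m * e).-homog.
Proof. by move=> hG hP; exact: dhomog_comp. Qed.

Lemma agree_sym Phi Psi : agree Phi Psi -> agree Psi Phi.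
Proof. by move=> H x Cx; apply: collinear_sym; exact: H. Qed.

Lemma evt_neq0 Phi x i : (tnth Phi i).[: x] != 0 -> evt Phi x != 0.
Proof. by move=> Px; apply/eqP => /rowP/(_ i)/eqP; rewrite evtE mxE (negPf Px). Qed.

(** Equality where a nontrivial tuple is defined suffices: multiplied by a component of the tuple,
    the form vanishes on C, and that component can be cancelled. *)
Lemma vanishes_where e m Phi G : forms e Phi -> nontrivial Phi -> G \is m.-homog ->
  (forall x, curve_points F x -> evt Phi x != 0 -> G.[: x] = 0) -> vanishes_on F G.
Proof.
move=> hP [i nPi] hG H; apply: (vanishes_cancel d_gt1 smF (hP i) hG nPi) => x Cx.
rewrite mevalM; have [->|Px] := eqVneq (tnth Phi i).[: x] 0; first by rewrite mul0r.
by rewrite H ?mulr0 //; exact: evt_neq0 Px.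
Qed.

Definition cross_form Phi Psi i j := tnth Phi i * tnth Psi j - tnth Phi j * tnth Psi i.

Lemma agree_where e m n Phi Psi Theta : forms e Theta -> nontrivial Theta -> forms m Phi -> forms n Psi ->
  (forall x, curve_points F x -> evt Theta x != 0 -> collinear (evt Phi x) (evt Psi x)) -> agree Phi Psi.
Proof.
move=> hT nT hP hQ H x Cx i j; rewrite !evtE; apply/eqP; rewrite -subr_eq0; apply/eqP.
have : vanishes_on F (cross_form Phi Psi i j).
  apply: (vanishes_where (m := m + n) hT nT).
    by apply: rpredB; apply: dhomogM.
  by move=> z Cz Tz; have := H z Cz Tz i j; rewrite mevalB !mevalM !evtE => ->; rewrite subrr.
by move=> /(_ x Cx); rewrite mevalB !mevalM.
Qed.

Lemma agree_trans e m n Phi Psi Theta : forms e Phi -> forms m Psi -> forms n Theta -> nontrivial Psi ->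
  agree Phi Psi -> agree Psi Theta -> agree Phi Theta.
Proof.
move=> h1 h2 h3 nP a1 a2; apply: (agree_where h2 nP h1 h3) => x Cx Px.
exact: collinear_trans_mid Px (a1 x Cx) (a2 x Cx).
Qed.

Lemma selfmap_point Phi x : selfmap Phi -> curve_points F x -> evt Phi x != 0 -> curve_points F (evt Phi x).
Proof.
move=> sP Cx Px; apply/curve_pointsP; split=> //.
by rewrite -eval_comp; exact: sP.
Qed.

Lemma agree_selfmap e m Phi Psi : forms e Phi -> nontrivial Phi -> forms m Psi ->
  agree Phi Psi -> selfmap Phi -> selfmap Psi.
Proof.
move=> hP nP hQ aPQ sP; apply: (vanishes_where hP nP (comp_homog homF hQ)) => x Cx Px.
have [c ec] := collinear_scale_mid Px (collinear_sym (aPQ x Cx)).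
by rewrite eval_comp ec (homog_evalZ _ _ homF) -eval_comp sP // mulr0.
Qed.

Definition comp Phi Psi : 3.-tuple {mpoly K[3]} := compose_forms Phi Psi.

Lemma evt_comp Phi Psi x : evt (comp Phi Psi) x = evt Phi (evt Psi x).
Proof. by apply/rowP => i; rewrite !evtE tnth_mktuple eval_comp. Qed.

Lemma comp_forms e m Phi Psi : forms e Phi -> forms m Psi -> forms (e * m) (comp Phi Psi).
Proof. by move=> hP hQ i; rewrite tnth_mktuple; exact: comp_homog. Qed.

Definition Xtuple : 3.-tuple {mpoly K[3]} := [tuple 'X_i | i < 3].

Lemma evt_X x : evt Xtuple x = x.
Proof. by apply/rowP => i; rewrite evtE tnth_mktuple mevalXU. Qed.

Lemma forms_X : forms 1 Xtuple.
Proof. by move=> i; rewrite tnth_mktuple dhomogX /= mdeg1. Qed.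

Lemma evt_linear_forms (M : 'M[K]_3) x : evt (linear_forms M) x = x *m M.
Proof. by apply/rowP => i; rewrite evtE eval_linear_forms. Qed.

(** A composite of rational maps is given by some suitable pair of representatives. The identity is
    checked at points where that pair is nonzero and is carried by cancellation to every other
    pair. *)
Lemma comp_inverse_indep e1 e2 m1 m2 Phi1 Psi1 Phi Psi :
  forms e1 Phi1 -> forms m1 Psi1 -> forms e2 Phi -> forms m2 Psi ->
  selfmap Psi1 -> nontrivial Psi1 -> agree Phi1 Phi -> agree Psi1 Psi ->
  nontrivial (comp Phi1 Psi1) -> agree (comp Phi1 Psi1) Xtuple ->
  forall x, curve_points F x -> collinear (evt Phi (evt Psi x)) x.
Proof.
move=> h1 k1 h2 k2 sPsi nPsi aPhi aPsi nt aX.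
suff : agree (comp Phi Psi) Xtuple by move=> H x /H; rewrite evt_comp evt_X.
move=> x Cx i j; rewrite !evtE; apply/eqP; rewrite -subr_eq0; apply/eqP.
have hG : cross_form (comp Phi Psi) Xtuple i j \is (e2 * m2 + 1).-homog.
  by apply: rpredB; (apply: dhomogM; [exact: comp_forms|exact: forms_X]).
suff : vanishes_on F (cross_form (comp Phi Psi) Xtuple i j).
  by move=> /(_ x Cx); rewrite mevalB !mevalM.
have [k nk] := nPsi; apply: (vanishes_cancel d_gt1 smF (k1 k) hG nk).
apply: (vanishes_where (comp_forms h1 k1) nt (dhomogM (k1 k) hG)) => {Cx}x Cx.
rewrite evt_comp mevalM => nz; have [->|uk] := eqVneq (tnth Psi1 k).[: x] 0; first by rewrite mul0r.
have un0 := evt_neq0 uk; have Cu := selfmap_point sPsi Cx un0.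
have := aX x Cx; rewrite evt_comp evt_X => colx.
have [c ec] := collinear_scale_mid un0 (collinear_sym (aPsi x Cx)).
have col : collinear (evt Phi (evt Psi x)) x.
  rewrite ec (evt_scale _ _ h2) => a b; rewrite !mxE -!evtE -!mulrA; congr (_ * _).
  exact: (collinear_trans_mid nz (collinear_sym (aPhi _ Cu)) colx).
apply/eqP; rewrite mulf_eq0; apply/orP; right.
by rewrite mevalB !mevalM -!evtE evt_comp evt_X (col i j) subrr.
Qed.

Lemma total_max3 (le : 'I_3 -> 'I_3 -> Prop) : (forall i j, le i j \/ le j i) ->
  (forall i j k, le i j -> le j k -> le i k) -> exists i, forall j, le j i.
Proof.
move=> tot trans; have refl i : le i i by case: (tot i i).
have [a [a0 a1]] : exists a, le ord0 a /\ le i1 a.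
  by case: (tot ord0 i1) => h; [exists i1 | exists ord0].
case: (tot a i2) => h; [exists i2 | exists a] => j; case: (ord3P j) => -> //; exact: trans h.
Qed.

(** In the valuation ring of the smooth point p the three components are totally preordered by
    divisibility. Dividing by one that divides the others removes the common zero at p. *)
Lemma regular_representative e Phi p : forms e Phi -> nontrivial Phi -> curve_points F p ->
  exists m Phi', [/\ forms m Phi', agree Phi Phi' & evt Phi' p != 0].
Proof.
move=> hP [i0 ni0] Cp.
pose le (i j : 'I_3) := exists m H G, [/\ H \is m.-homog, G \is m.-homog, H.[: p] != 0 &
  vanishes_on F (H * tnth Phi i - G * tnth Phi j)].
have tot i j : le i j \/ le j i.
  have [m [H [G [hH hG [Hp|Gp] v]]]] := valuation_ring d_gt1 smF Cp (hP i) (hP j).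
    by left; exists (m + e)%N, H, G.
  right; exists (m + e)%N, G, H; split=> // x Cx; have := v x Cx.
  by rewrite !mevalB => /eqP; rewrite subr_eq0 => /eqP ->; rewrite subrr.
have trans i j k : le i j -> le j k -> le i k.
  move=> [m [H [G [hH hG Hp v]]]] [m' [H' [G' [hH' hG' Hp' v']]]].
  exists (m' + m)%N, (H' * H), (G' * G); split; [exact: dhomogM|exact: dhomogM| |].
    by rewrite mevalM mulf_neq0.
  have -> : H' * H * tnth Phi i - G' * G * tnth Phi k =
      H' * (H * tnth Phi i - G * tnth Phi j) + G * (H' * tnth Phi j - G' * tnth Phi k) by ring.
  by apply: vanishesD; exact: vanishesMl.
have [i /choice [m /choice [H /choice [G iP]]]] := total_max3 tot trans.
have hH j : H j \is (m j).-homog by case: (iP j).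
have hG j : G j \is (m j).-homog by case: (iP j).
have Hp j : (H j).[: p] != 0 by case: (iP j).
have HG j x : curve_points F x -> (H j).[: x] * (tnth Phi j).[: x] = (G j).[: x] * (tnth Phi i).[: x].
  by move=> Cx; case: (iP j) => _ _ _ /(_ x Cx); rewrite mevalB !mevalM => /subr0_eq.
have nvi : ~ vanishes_on F (tnth Phi i).
  move=> v; apply: ni0; apply: (vanishes_cancel d_gt1 smF (hH i0) (hP i0)).
    by move=> /(_ p Cp) /eqP; rewrite (negPf (Hp i0)).
  by move=> x Cx; rewrite mevalM HG // v // mulr0.
(* The products Q bring the quotients G j / H j to a common denominator, so that all components get
   the same degree. *)
pose Q j := \prod_(k | k != j) H k.
pose Phi' : 3.-tuple {mpoly K[3]} := [tuple G j * Q j | j < 3].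
have [E eE] : exists E, E = (\sum_k m k)%N by eexists.
have hQ j : G j * Q j \is E.-homog.
  have -> : E = (m j + \sum_(k | k != j) m k)%N by rewrite eE (bigD1 j).
  apply: dhomogM => //; rewrite /Q.
  apply: (big_ind2 (fun (q : {mpoly K[3]}) n => q \is n.-homog)) => //; first exact: dhomog1.
  by move=> *; apply: dhomogM.
have QE j x : (H j).[: x] * (Q j).[: x] = \prod_k (H k).[: x] by rewrite /Q rmorph_prod /= [RHS](bigD1 j).
have key j x : curve_points F x -> (\prod_k (H k).[: x]) * (tnth Phi j).[: x] = (tnth Phi' j).[: x] * (tnth Phi i).[: x].
  by move=> Cx; rewrite tnth_mktuple mevalM -(QE j) mulrAC HG //; ring.
have hPr : \prod_k H k \is E.-homog.
  rewrite eE.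
  apply: (big_ind2 (fun (q : {mpoly K[3]}) n => q \is n.-homog)) => //; first exact: dhomog1.
  by move=> *; apply: dhomogM.
have Pp : (\prod_k H k).[: p] != 0 by rewrite rmorph_prod /=; apply/prodf_neq0 => k _.
exists E, Phi'; split.
- by move=> j; rewrite tnth_mktuple.
- move=> x Cx j k; apply/eqP; rewrite -subr_eq0 !evtE; apply/eqP.
  suff : vanishes_on F (cross_form Phi Phi' j k) by move=> /(_ x Cx); rewrite mevalB !mevalM.
  apply: (vanishes_cancel (n := e + E) d_gt1 smF hPr).
  + by apply: rpredB; (apply: dhomogM; [exact: hP|rewrite tnth_mktuple]).
  + by move=> /(_ p Cp)/eqP; rewrite (negPf Pp).
  move=> z Cz; rewrite mevalM mevalB !mevalM rmorph_prod /= mulrBr !mulrA (key j z Cz) (key k z Cz).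
  by ring.
have : (tnth Phi' i).[: p] != 0.
  have : vanishes_on F (\prod_k H k - tnth Phi' i).
    apply: (vanishes_cancel (n := E) d_gt1 smF (hP i) _ nvi); first by apply: rpredB; rewrite ?tnth_mktuple.
    by move=> z Cz; rewrite mevalM mevalB rmorph_prod /= mulrBr mulrC key // mulrC subrr.
  by move=> /(_ p Cp); rewrite mevalB => /subr0_eq <-.
exact: evt_neq0.
Qed.

End RationalMaps.

(** * Pullbacks of lines under a birational self-map *)

Section Linearity.
Variable K : closedFieldType.
Variables (d : nat) (F : {mpoly K[3]}).
Hypotheses (d_gt3 : (3 < d)%N) (smF : smooth_plane_curve d F).
Implicit Types (G A B H W L N T : {mpoly K[3]}) (p x : 'rV[K]_3).
Variables (e e' : nat) (Phi Psi : 3.-tuple {mpoly K[3]}).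
Hypotheses (hPhi : forms e Phi) (hPsi : forms e' Psi) (nPhi : nontrivial F Phi) (nPsi : nontrivial F Psi)
  (sPhi : selfmap F Phi) (sPsi : selfmap F Psi).
Hypothesis inv1 : forall m n Phi' Psi', forms m Phi' -> forms n Psi' -> agree F Phi Phi' -> agree F Psi Psi' ->
  forall x, curve_points F x -> collinear (evt Phi' (evt Psi' x)) x.
Hypothesis inv2 : forall m n Phi' Psi', forms m Phi' -> forms n Psi' -> agree F Phi Phi' -> agree F Psi Psi' ->
  forall x, curve_points F x -> collinear (evt Psi' (evt Phi' x)) x.

Let d_gt2 : (2 < d)%N. Proof. exact: ltnW. Qed.
Let d_gt1 : (1 < d)%N. Proof. exact: ltnW. Qed.
Let d_gt0 : (0 < d)%N. Proof. exact: ltnW. Qed.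
Let homF : F \is d.-homog. Proof. exact: curve_homog smF. Qed.

Let cpt_neq0 x : curve_points F x -> x != 0. Proof. by case/curve_pointsP. Qed.

Lemma pullback_homog m Phi' N : forms m Phi' -> N \is 1.-homog -> N \mPo Phi' \is m.-homog.
Proof. by move=> h hN; rewrite -[m]mul1n; exact: comp_homog. Qed.

Lemma vanishes_crossP A B G H :
  vanishes_on F (A * B - G * H) <-> forall x, curve_points F x -> A.[: x] * B.[: x] = G.[: x] * H.[: x].
Proof.
split=> v x Cx; first by apply/subr0_eq; rewrite -!mevalM -mevalB; exact: v.
by rewrite mevalB !mevalM v // subrr.
Qed.

Lemma agree_refl Theta : agree F Theta Theta.
Proof. by move=> x _ i j; rewrite mulrC. Qed.

Lemma pullback_ratio m Phi' N L x : forms m Phi' -> agree F Phi Phi' -> N \is 1.-homog -> L \is 1.-homog ->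
  curve_points F x ->
  (N \mPo Phi).[: x] * (L \mPo Phi').[: x] = (L \mPo Phi).[: x] * (N \mPo Phi').[: x].
Proof.
by move=> h' a' hN hL Cx; rewrite !eval_comp; apply: collinear_linear_forms => //; exact: a'.
Qed.

(** The map is dominant: at [evt Psi x] a regular representative takes the value x up to a scalar,
    so a line whose pullback vanishes on C would contain C. *)
Lemma pullback_not_vanishing N : N \is 1.-homog -> N != 0 -> ~ vanishes_on F (N \mPo Phi).
Proof.
move=> hN N0 v; apply: (linear_not_vanishing d_gt1 smF hN N0).
apply: (vanishes_where d_gt3 smF hPsi nPsi hN) => x Cx Px.
have Cy := selfmap_point sPsi Cx Px.
have [m [Phi' [h' a' n0]]] := regular_representative d_gt3 smF hPhi nPhi Cy.
have v' : vanishes_on F (N \mPo Phi').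
  apply: (vanishes_where d_gt3 smF hPhi nPhi (pullback_homog h' hN)) => z Cz Pz.
  have [c ec] := collinear_scale_mid Pz (collinear_sym (a' z Cz)).
  by rewrite eval_comp ec linear_formZ // -eval_comp v // mulr0.
have [c ec] := collinear_scale_mid n0 (collinear_sym (inv1 h' hPsi a' (@agree_refl Psi) Cx)).
by rewrite ec linear_formZ // -eval_comp v' // mulr0.
Qed.

(* A birational self-map of the curve is unramified, so pullbacks of transversal lines have simple zeros. *)
Lemma pullback_uniformizer m n Phi' Psi' q L T t : forms m Phi' -> forms n Psi' -> agree F Phi Phi' ->
  agree F Psi Psi' -> curve_points F q -> evt Psi' q != 0 -> evt Phi' (evt Psi' q) != 0 ->
  L \is 1.-homog -> L != 0 -> L.[: q] = 0 -> (exists v : 'rV[K]_3, L.[: v] = 0 /\ dgrad F q v != 0) ->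
  T \is t.-homog -> T.[: evt Psi' q] = 0 ->
  regular_quot F t m T (L \mPo Phi') (evt Psi' q).
Proof.
move=> h' k' a' b' Cq nq nqq hL L0 Lq [v [Lv dv]] hT Tp.
have sPsi' := agree_selfmap d_gt3 smF hPsi nPsi k' b' sPsi.
have Cp := selfmap_point sPsi' Cq nq.
set p := evt Psi' q in nq nqq Tp Cp *.
have hLP := pullback_homog h' hL.
have [s [H [G [hH hG HG vHG]]]] := valuation_ring d_gt1 smF Cp hT hLP.
exists (s + m)%N, (s + t)%N, H, G; split=> //; first by clear; lia.
have [Hp|//] := eqVneq H.[: p] 0; exfalso.
have Gp : G.[: p] != 0 by case: HG => //; rewrite Hp eqxx.
have [k qk] := nonzero_coord (cpt_neq0 Cq).
have Pk : (tnth Phi' k).[: p] != 0.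
  have [c ec] := collinear_scale_mid (cpt_neq0 Cq) (inv1 h' k' a' b' Cq).
  rewrite -evtE /p ec mxE mulf_neq0 //; apply: contraNneq nqq => c0.
  by rewrite /p ec c0 scale0r.
(* If H vanished at p, then H T = G (L o Phi') would pull back along [Psi'] to b c = a L on C, with
   a(q) != 0 and with b and c both zero at q. The left side would have order at least 2 at q,
   whereas the transversal line L has order 1. *)
pose a := (G \mPo Psi') * (tnth Phi' k \mPo Psi').
pose b := 'X_k * (H \mPo Psi').
pose c := T \mPo Psi'.
have hD : H * T - G * (L \mPo Phi') \is (s + m + t).-homog.
  apply: rpredB; first exact: dhomogM.
  have -> : (s + m + t = s + t + m)%N by clear; lia.
  exact: dhomogM.
have v0 : vanishes_on F (a * L - b * c).
  have v1 : vanishes_on F ((H * T - G * (L \mPo Phi')) \mPo Psi').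
    have nPsi' : nontrivial F Psi'.
      have [i qi] := nonzero_coord nq; exists i => vi; by move: qi; rewrite /p evtE vi // eqxx.
    apply: (vanishes_where d_gt3 smF k' nPsi' (comp_homog hD k')) => x Cx nx.
    by rewrite eval_comp; apply: vHG; exact: selfmap_point.
  move=> x Cx; have := v1 x Cx.
  have := collinear_linear_forms hL (form_of_homog (delta_mx 0 k)) (inv1 h' k' a' b' Cx).
  have dk (y : 'rV[K]_3) : (form_of (delta_mx 0 k)).[: y] = y 0 k.
    rewrite eval_form_of (bigD1 k) //= big1 ?addr0 ?mxE ?eqxx ?mul1r // => j jk.
    by rewrite mxE (negPf jk) andbF mul0r.
  rewrite !dk evtE => E1.
  rewrite [X in X = 0 -> _]eval_comp mevalB !mevalM (eval_comp L) => /eqP; rewrite subr_eq0 => /eqP E2.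
  rewrite mevalB !mevalM mevalXU !eval_comp.
  have -> : G.[: evt Psi' x] * (tnth Phi' k).[: evt Psi' x] * L.[: x] =
     G.[: evt Psi' x] * (L.[: evt Phi' (evt Psi' x)] * x 0 k) by rewrite E1 mulrA.
  rewrite mulrA -E2; apply/eqP; rewrite subr_eq0; apply/eqP.
  by rewrite mulrC mulrA.
have ha : a \is ((s + t) * n + m * n).-homog by apply: dhomogM; [exact: comp_homog|exact: comp_homog (h' k) k'].
have hb : b \is (1 + (s + m) * n).-homog by apply: dhomogM; [rewrite dhomogX /= mdeg1|exact: comp_homog].
have hc : c \is (t * n).-homog by exact: comp_homog.
have hE : a * L - b * c \is ((s + t) * n + m * n + 1).-homog.
  apply: rpredB; first exact: dhomogM.
  have -> : ((s + t) * n + m * n + 1 = 1 + (s + m) * n + t * n)%N by clear; lia.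
  exact: dhomogM.
have aq : a.[: q] != 0 by rewrite mevalM !eval_comp mulf_neq0.
have bq : b.[: q] = 0 by rewrite mevalM eval_comp Hp mulr0.
have cq : c.[: q] = 0 by rewrite eval_comp Tp.
clearbody a b c.
have Fq : F.[: q] = 0 by case/curve_pointsP: Cq.
have [W [_ eW _]] := vanishes_multiple d_gt1 smF hE v0.
(* a L - b c = F W is differentiated at q. The direction v of the line gives W(q) = 0, and a
   direction off the line then gives a contradiction. *)
have dE (u : 'rV[K]_3) : a.[: q] * L.[: u] = dgrad F q u * W.[: q].
  have : dgrad (a * L - b * c) q u = dgrad (F * W) q u by rewrite eW.
  rewrite dgradB !dgradM (dgrad_linear q u hL) Lq bq cq Fq.
  by rewrite !(mulr0, mul0r) addr0 subr0 add0r addr0.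
have Wq : W.[: q] = 0.
  by apply/eqP; have /eqP := dE v; rewrite Lv mulr0 eq_sym mulf_eq0 (negPf dv).
have [y Ly] := form_nonzero_at hL L0.
by move/eqP: (dE y); rewrite Wq mulr0 mulf_eq0 (negPf aq) (negPf Ly).
Qed.

Lemma pullback_not_vanishing_rep m Phi' N : forms m Phi' -> agree F Phi Phi' -> nontrivial F Phi' ->
  N \is 1.-homog -> N != 0 -> ~ vanishes_on F (N \mPo Phi').
Proof.
move=> h' a' n' hN N0 v; apply: (pullback_not_vanishing hN N0).
apply: (vanishes_where d_gt3 smF h' n' (pullback_homog hPhi hN)) => x Cx nx.
have [c ec] := collinear_scale_mid nx (a' x Cx).
by rewrite eval_comp ec linear_formZ // -eval_comp v // mulr0.
Qed.

Lemma nonzero_nontrivial Theta p : curve_points F p -> evt Theta p != 0 -> nontrivial F Theta.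
Proof.
move=> Cp n; have [i qi] := nonzero_coord n; exists i => vi.
by move: qi; rewrite evtE vi // eqxx.
Qed.

Section Poles.
Variables (m : nat) (L : {mpoly K[3]}) (q p : 'I_m -> 'rV[K]_3).
Hypotheses (hL : L \is 1.-homog) (L0 : L != 0).
Hypothesis tq : forall i, [/\ curve_points F (q i), L.[: q i] = 0 &
  exists v : 'rV[K]_3, L.[: v] = 0 /\ dgrad F (q i) v != 0].
Hypothesis qinj : forall i j, collinear (q i) (q j) -> i = j.
Hypothesis qall : forall x, curve_points F x -> L.[: x] = 0 -> exists i, collinear x (q i).
Hypothesis pE : forall i, exists n Psi', [/\ forms n Psi', agree F Psi Psi', p i = evt Psi' (q i) & p i != 0].

Lemma pole_on_curve i : curve_points F (p i).
Proof.
have [n [Psi' [k' b' ep n0]]] := pE i; have [Cq _ _] := tq i.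
rewrite ep; apply: (selfmap_point _ Cq); last by rewrite -ep.
exact: (agree_selfmap d_gt3 smF hPsi nPsi k' b' sPsi).
Qed.

Lemma image_of_pole i n Phi' : forms n Phi' -> agree F Phi Phi' -> collinear (evt Phi' (p i)) (q i).
Proof.
move=> h' a'; have [s [Psi' [k' b' -> _]]] := pE i; have [Cq _ _] := tq i.
exact: (inv1 h' k' a' b').
Qed.

Lemma poles_distinct i j : collinear (p i) (p j) -> i = j.
Proof.
move=> col; have [n [Phi' [h' a' n0]]] := regular_representative d_gt3 smF hPhi nPhi (pole_on_curve i).
have pj0 := cpt_neq0 (pole_on_curve j).
have [c c0 ec] := collinear_scale (cpt_neq0 (pole_on_curve i)) pj0 col.
apply: qinj; apply: (collinear_trans_mid n0 (collinear_sym (image_of_pole i h' a'))).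
apply: (@collinear_trans_mid _ _ (evt Phi' (p j))).
- by rewrite ec (evt_scale _ _ h') scaler_eq0 negb_or n0 expf_neq0.
- by rewrite ec (evt_scale _ _ h'); exact: collinearZr.
exact: image_of_pole h' a'.
Qed.

Lemma pole_above x n Phi' : curve_points F x -> forms n Phi' -> agree F Phi Phi' -> evt Phi' x != 0 ->
  L.[: evt Phi' x] = 0 -> exists i, collinear x (p i).
Proof.
move=> Cx h' a' nx Lx; have sP := agree_selfmap d_gt3 smF hPhi nPhi h' a' sPhi.
have [i col] := qall (selfmap_point sP Cx nx) Lx; exists i.
have [s [Psi' [k' b' ep n0]]] := pE i; have [Cq _ _] := tq i.
have [c c0 ec] := collinear_scale (cpt_neq0 Cq) nx (collinear_sym col).
have := inv2 h' k' a' b' Cx; rewrite ec (evt_scale _ _ k') -ep => H.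
apply: collinear_sym; apply: (collinear_trans_mid _ _ H); last exact: collinearZr.
by rewrite scaler_eq0 negb_or n0 expf_neq0.
Qed.

Lemma regular_off_poles N x : N \is 1.-homog -> curve_points F x -> (forall i, ~ collinear x (p i)) ->
  regular_quot F e e (N \mPo Phi) (L \mPo Phi) x.
Proof.
move=> hN Cx nx; have [n [Phi' [h' a' n0]]] := regular_representative d_gt3 smF hPhi nPhi Cx.
exists n, n, (L \mPo Phi'), (N \mPo Phi'); split; [exact: pullback_homog|exact: pullback_homog|by []| |].
  by rewrite eval_comp; apply/eqP => /(pole_above Cx h' a' n0) [i /nx].
apply/vanishes_crossP => y Cy.
exact: etrans (mulrC _ _) (etrans (pullback_ratio h' a' hN hL Cy) (mulrC _ _)).
Qed.

(** By [pullback_uniformizer] the pulled back line is a uniformiser at [p i], so any form through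
    [p i] compensates its zero. *)
Lemma simple_pole i N t T : N \is 1.-homog -> T \is t.-homog -> T.[: p i] = 0 ->
  regular_quot F (t + e) e (T * (N \mPo Phi)) (L \mPo Phi) (p i).
Proof.
move=> hN hT Tp; have [n [Phi' [h' a' n0]]] := regular_representative d_gt3 smF hPhi nPhi (pole_on_curve i).
have [s [Psi' [k' b' ep p0]]] := pE i; have [Cq Lq tv] := tq i.
move: Tp p0 n0; rewrite ep => Tp p0 n0.
have [s1 [s2 [H [G [hH hG es Hp v]]]]] := pullback_uniformizer h' k' a' b' Cq p0 n0 hL L0 Lq tv hT Tp.
exists s1, (s2 + n)%N, H, (G * (N \mPo Phi')); split; [exact: hH| | |exact: Hp|].
- by apply: dhomogM; [exact: hG|exact: pullback_homog].
- by move: es; clear; lia.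
move/vanishes_crossP: v => v; apply/vanishes_crossP => y Cy.
rewrite (mevalM _ T) (mevalM _ G) mulrA (v y Cy) -!mulrA; congr (_ * _).
exact: etrans (mulrC _ _) (etrans (pullback_ratio h' a' hN hL Cy) (mulrC _ _)).
Qed.

(** Here the numerator itself vanishes at [p i] and can serve as the form T of
    [pullback_uniformizer]. *)
Lemma removable_pole i N : N \is 1.-homog -> N.[: q i] = 0 ->
  regular_quot F e e (N \mPo Phi) (L \mPo Phi) (p i).
Proof.
move=> hN Nq; have [n [Phi' [h' a' n0]]] := regular_representative d_gt3 smF hPhi nPhi (pole_on_curve i).
have nt := nonzero_nontrivial (pole_on_curve i) n0.
have [c ec] := collinear_scale_mid (cpt_neq0 (let: And3 C _ _ := tq i in C)) (image_of_pole i h' a').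
have Tp : (N \mPo Phi').[: p i] = 0 by rewrite eval_comp ec linear_formZ // Nq mulr0.
have [s [Psi' [k' b' ep p0]]] := pE i; have [Cq Lq tv] := tq i.
move: Tp p0 n0; rewrite ep => Tp p0 n0.
have hT := pullback_homog h' hN; have hLP := pullback_homog h' hL.
have [s1 [s2 [H [G [hH hG es Hp v]]]]] := pullback_uniformizer h' k' a' b' Cq p0 n0 hL L0 Lq tv hT Tp.
have es' : s1 = s2 by move: es; clear; lia.
move: hG; rewrite -es' => hG; exists s1, s1, H, G; split; [exact: hH|exact: hG|by []|exact: Hp|].
apply: (vanishes_cancel (m := n) (n := s1 + e) d_gt1 smF hLP).
- by apply: rpredB; (apply: dhomogM; [by []|exact: pullback_homog]).
- exact: pullback_not_vanishing_rep h' a' nt hL L0.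
move/vanishes_crossP: v => v y Cy.
have E1 := v y Cy; have E2 := pullback_ratio h' a' hN hL Cy; move: E1 E2.
rewrite (mevalM _ _ (_ - _)) (mevalB _ (H * _)) (mevalM _ H) (mevalM _ G).
move: H.[: y] G.[: y] (N \mPo Phi).[: y] (L \mPo Phi).[: y] (N \mPo Phi').[: y] (L \mPo Phi').[: y].
move=> h g u w u' w' E1 E2.
have -> : w' * (h * u - g * w) = h * (u * w') - g * w' * w by ring.
by rewrite E2 -E1; ring.
Qed.

End Poles.

Lemma others k : exists f : 'I_d.-1 -> 'I_d, [/\ injective f, forall i, f i != k & forall j, j != k -> exists i, j = f i].
Proof.
move: d_gt0 k; clear; case: d => // d' _ k; exists (lift k); split; first exact: lift_inj.
  by move=> i; rewrite eq_sym neq_lift.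
by move=> j jk; case: (unliftP k j) => [i ->|e]; [exists i | rewrite e eqxx in jk].
Qed.

Theorem birational_linear : exists M c, [/\ M \in unitmx, agree F Phi (linear_forms M), c != 0 & lsub M F = c *: F].
Proof.
have [L [q [hL L0 tq qinj qall]]] := transversal_line d_gt1 smF.
have /choice [p pE] i : exists p, exists n Psi', [/\ forms n Psi', agree F Psi Psi', p = evt Psi' (q i) & p != 0].
  have [Cq _ _] := tq i.
  have [n [Psi' [k' b' n0]]] := regular_representative d_gt3 smF hPsi nPsi Cq.
  by exists (evt Psi' (q i)), n, Psi'.
have Cp := pole_on_curve tq pE.
have pinj := poles_distinct tq qinj pE.
have nLP := pullback_not_vanishing hL L0.
have hLP := pullback_homog hPhi hL.
have aligned k : exists N, [/\ N \is 1.-homog, N != 0 & forall i, i != k -> N.[: p i] = 0].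
  have [f [finj fk fall]] := others k.
  have [j [jk nqk]] : exists j, j != k /\ ~ collinear (q k) (q j).
    have [j jk] : exists j : 'I_d, j != k.
      have : (0 < #|predC1 k|)%N by rewrite cardC1 card_ord; move: d_gt3; clear; lia.
      by rewrite lt0n => /pred0Pn [j]; exists j.
    by exists j; split; [exact: jk|move=> /qinj kj; move: jk; rewrite kj eqxx].
  (* N passes through [q k], so its pullback has no pole at [p k]; it misses [q j], so it is no
     multiple of L and the quotient of the pullbacks is not constant. *)
  have [N [hN Nq Nqj]] := line_avoiding nqk.
  have [_ Lqj _] := tq j; have [_ Lqk _] := tq k.
  have d1 : (1 < d.-1)%N by move: d_gt3; clear; lia.
  have injf i i' : collinear (p (f i)) (p (f i')) -> i = i' by move=> /pinj /finj.
  have [|||||||[c v]|[a [a0 rel]]] := @residue_relation K d F d_gt2 smF d.-1 (fun i => p (f i)) e (N \mPo Phi) (L \mPo Phi).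
  - by move=> i; exact: Cp.
  - exact: injf.
  - exact: pullback_homog.
  - exact: hLP.
  - exact: nLP.
  - move=> x Cx nx; case: (pselect (collinear x (p k))) => [col|ncol].
      have [b eb] := collinear_scale_mid (cpt_neq0 (Cp k)) col.
      have b0 : b != 0 by apply: contraTneq (cpt_neq0 Cx) => b0; rewrite eb b0 scale0r eqxx.
      by rewrite eb; apply: regular_quot_scale b0 _; exact: (removable_pole hL L0 tq pE).
    apply: (regular_off_poles hL tq qall pE hN Cx) => i col.
    have [ik|/fall [i' ei]] := eqVneq i k; first by apply: ncol; rewrite -ik.
    by apply: (nx i'); rewrite -ei.
  - by move=> i t T hT Tp; exact: (simple_pole hL L0 tq pE).
  - exfalso; have hNL : N - c *: L \is 1.-homog by apply: rpredB; [exact: hN|exact: dhomogZ].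
    apply: (pullback_not_vanishing hNL).
      by apply: contraNneq Nqj => /subr0_eq ->; rewrite mevalZ Lqj mulr0.
    by rewrite comp_mpolyB comp_mpolyZ.
  (* The degree of the residue relation is the number of remaining points minus 2, as
     [dependent_points_aligned] demands. *)
  have e3 : (d.-1 - 2 = d - 3)%N by move: d_gt3; clear; lia.
  have [|M [hM M0 Mp]] := @dependent_points_aligned K d.-1 (fun i => p (f i)) a d1 injf a0.
    by rewrite e3; exact: rel.
  by exists M; split; [exact: hM|exact: M0|move=> i ik; have [i' ->] := fall i ik; exact: Mp].
have [ell [hell ell0 ellp]] : exists N, [/\ N \is 1.-homog, N != 0 & forall i, N.[: p i] = 0].
  (* Four distinct indices exist because d >= 4. The line that may omit [p k0] and the line that may
     omit [p k1] share [p k2] and [p k3], so they coincide. *)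
  pose k0 := Ordinal d_gt0; pose k1 := Ordinal d_gt1; pose k2 := Ordinal d_gt2; pose k3 := Ordinal d_gt3.
  have [L0' [h0 n0 v0]] := aligned k0; have [L1 [h1 n1 v1]] := aligned k1.
  exists L0'; split; [exact: h0|exact: n0|move=> i]; have [ik|ik] := eqVneq i k0; last exact: v0.
  have n23 : ~ collinear (p k2) (p k3) by move=> /pinj.
  rewrite ik; have v00 j : j != k0 -> L0'.[: p j] = 0 by exact: v0.
  have v11 j : j != k1 -> L1.[: p j] = 0 by exact: v1.
  exact: (line_through_two h0 h1 n1 n23 (v00 k2 isT) (v00 k3 isT) (v11 k2 isT) (v11 k3 isT) (v11 k0 isT)).
have reg x N : N \is 1.-homog -> curve_points F x ->
    regular_quot F (1 + e) e (ell * (N \mPo Phi)) (L \mPo Phi) x.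
  move=> hN Cx; case: (pselect (exists i, collinear x (p i))) => [[i col]|/forallNP nc].
    have [b eb] := collinear_scale_mid (cpt_neq0 (Cp i)) col.
    have b0 : b != 0 by apply: contraTneq (cpt_neq0 Cx) => b0; rewrite eb b0 scale0r eqxx.
    by rewrite eb; apply: regular_quot_scale b0 _; exact: (simple_pole hL L0 tq pE).
  by apply: (regular_quotMl hell); exact: (regular_off_poles hL tq qall pE).
(* [ell] vanishes at every pole, so ell times a component of [Phi], divided by the pullback of L, is
   regular of degree 1 and hence a linear form on C. *)
have /choice [N NE] j : exists N, N \is 1.-homog /\ vanishes_on F (ell * tnth Phi j - N * (L \mPo Phi)).
  have hj : ell * tnth Phi j \is (e + 1).-homog by rewrite addnC; exact: dhomogM.
  apply: (regular_is_form d_gt1 smF hj hLP nLP) => x Cx; rewrite addnC -comp_mpolyX1.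
  by apply: (reg _ _ _ Cx); rewrite dhomogX /= mdeg1.
have /choice [l lE] j : exists l, N j = form_of l by apply: linear_form_coefs; case: (NE j).
pose M : 'M[K]_3 := \matrix_(i, j) l j 0 i.
have eN j : tnth (linear_forms M) j = N j.
  by rewrite tnth_mktuple lE; apply: eq_bigr => i _; rewrite mxE.
have NP j : forall x, curve_points F x -> ell.[: x] * (tnth Phi j).[: x] = (N j).[: x] * (L \mPo Phi).[: x].
  by apply/vanishes_crossP; case: (NE j).
have aM : agree F Phi (linear_forms M).
  move=> x Cx i j; rewrite !evtE !eN.
  move: x Cx; apply/vanishes_crossP.
  apply: (vanishes_cancel (n := e + 1) d_gt1 smF hLP _ nLP).
    have [[hi _] [hj _]] := (NE i, NE j).
    by apply: rpredB; (apply: dhomogM; [exact: hPhi|]).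
  move=> x Cx; rewrite (mevalM _ _ (_ - _)) (mevalB _ (_ * _)) (mevalM _ (tnth Phi i)) (mevalM _ (tnth Phi j)).
  have := NP i x Cx; have := NP j x Cx.
  move: (tnth Phi i).[: x] (tnth Phi j).[: x] (N i).[: x] (N j).[: x] (L \mPo Phi).[: x] ell.[: x].
  move=> u v n n' w s E1 E2.
  have -> : w * (u * n' - v * n) = u * (n' * w) - v * (n * w) by ring.
  by rewrite -E1 -E2; ring.
(* A linear relation between the columns of M is a line whose pullback vanishes on C. *)
have uM : M \in unitmx.
  rewrite -unitmx_tr -row_free_unit -kermx_eq0; apply/eqP/row_matrixP => i; rewrite row0.
  have : row i (kermx M^T) *m M^T = 0 by rewrite -row_mul mulmx_ker row0.
  move: (row i _) => r rM; apply/eqP/contraT => r0.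
  have fr0 : form_of r != 0 by apply: contraNneq r0 => /form_of_eq0 ->.
  exfalso; apply: (pullback_not_vanishing (form_of_homog r) fr0).
  apply: (vanishes_cancel d_gt1 smF hell (pullback_homog hPhi (form_of_homog r))).
    exact: (linear_not_vanishing d_gt1 smF hell ell0).
  move=> x Cx; rewrite mevalM eval_comp eval_form_of mulr_sumr.
  transitivity (\sum_j r 0 j * (x *m M) 0 j * (L \mPo Phi).[: x]).
    apply: eq_bigr => j _; rewrite evtE mulrCA (NP j x Cx) -eN eval_linear_forms.
    exact: mulrA.
  rewrite -mulr_suml; have -> : \sum_j r 0 j * (x *m M) 0 j = (r *m (x *m M)^T) 0 0.
    by rewrite [RHS]mxE; apply: eq_bigr => j _; rewrite [_^T j 0]mxE.
  by rewrite trmx_mul mulmxA rM mul0mx mxE mul0r.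
have sM : vanishes_on F (lsub M F).
  by apply: (agree_selfmap d_gt3 smF hPhi nPhi _ aM sPhi) => j; exact: linear_forms_homog.
have [W [hW eW _]] := vanishes_multiple d_gt1 smF (lsub_homog M homF) sM.
move: hW; rewrite subnn => /dhomog0_const [c eWc].
have eF : lsub M F = c *: F by rewrite eW eWc mulrC mul_mpolyC.
exists M, c; split; [exact: uM|exact: aM| |exact: eF].
have /eqP F0 := curve_form_neq0 smF; apply/eqP => c0; apply: F0.
by rewrite -[F]lsub1 -(mulVmx uM) -lsubM eF c0 scale0r rmorph0.
Qed.

End Linearity.

(** * Automorphisms as matrices *)

Section RationalMapSets.
Variable K : closedFieldType.
Variables (d : nat) (F : {mpoly K[3]}).
Hypotheses (d_gt3 : (3 < d)%N) (smF : smooth_plane_curve d F).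
Implicit Types (p x P : 'rV[K]_3) (M N B : 'M[K]_3).

Let d_gt2 : (2 < d)%N. Proof. exact: ltnW. Qed.
Let d_gt1 : (1 < d)%N. Proof. exact: ltnW. Qed.
Let homF : F \is d.-homog. Proof. exact: curve_homog smF. Qed.

Lemma eval_cross m (Phi Psi : m.-tuple {mpoly K[3]}) :
  (forall i j, vanishes_on F (tnth Phi i * tnth Psi j - tnth Phi j * tnth Psi i)) <->
  forall x, curve_points F x -> forall i j, (tnth Phi i).[: x] * (tnth Psi j).[: x] = (tnth Phi j).[: x] * (tnth Psi i).[: x].
Proof.
split=> [H x Cx i j|H i j]; last by apply/vanishes_crossP => x Cx; exact: H.
by move/vanishes_crossP: (H i j) => /(_ x Cx).
Qed.

Lemma same_ratmap_refl m (Phi : m.-tuple {mpoly K[3]}) : represents_ratmap F Phi -> same_ratmap F Phi Phi.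
Proof. by move=> r; split=> //; apply/eval_cross => x _ i j; rewrite mulrC. Qed.

Lemma same_ratmap_sym m (Phi Psi : m.-tuple {mpoly K[3]}) : same_ratmap F Phi Psi -> same_ratmap F Psi Phi.
Proof.
move=> [r s /eval_cross H]; split=> //; apply/eval_cross => x Cx i j.
by rewrite mulrC -H // mulrC.
Qed.

(** A component of the middle tuple that does not vanish identically on C is cancelled. *)
Lemma same_ratmap_trans m (Phi Psi Theta : m.-tuple {mpoly K[3]}) :
  same_ratmap F Phi Psi -> same_ratmap F Psi Theta -> same_ratmap F Phi Theta.
Proof.
move=> [[[e h] r] [[n k] [a na]] /eval_cross H] [_ [[t l] s] /eval_cross H']; split=> //; try by split=> //; eexists.
move=> i j; apply: (vanishes_cancel (n := e + t) d_gt1 smF (k a) _ na).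
  by apply: rpredB; apply: dhomogM.
move=> x Cx; rewrite (mevalM _ _ (_ - _)) (mevalB _ (_ * _)) (mevalM _ (tnth Phi i)) (mevalM _ (tnth Phi j)).
have := H x Cx a i; have := H x Cx a j; have := H' x Cx i j.
move: (tnth Phi i).[: x] (tnth Phi j).[: x] (tnth Phi a).[: x] (tnth Psi i).[: x] (tnth Psi j).[: x]
  (tnth Psi a).[: x] (tnth Theta i).[: x] (tnth Theta j).[: x] => f f' fa g g' ga t1 t2 E1 E2 E3.
have -> : ga * (f * t2 - f' * t1) = (f * ga) * t2 - (f' * ga) * t1 by ring.
by rewrite -E2 -E3 -!mulrA E1 subrr.
Qed.

Lemma ratmap_of_eq m (Phi Psi : m.-tuple {mpoly K[3]}) : represents_ratmap F Phi -> represents_ratmap F Psi ->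
  (ratmap_of F Phi = ratmap_of F Psi) <-> same_ratmap F Phi Psi.
Proof.
move=> r s; split=> [e|H].
  have : ratmap_of F Psi Psi by exact: same_ratmap_refl.
  by rewrite -e.
apply/seteqP; split=> T /= HT; last exact: same_ratmap_trans HT.
exact: same_ratmap_trans (same_ratmap_sym H) HT.
Qed.

Lemma same_ratmapP Phi Psi : same_ratmap F Phi Psi <-> [/\ represents_ratmap F Phi, represents_ratmap F Psi & agree F Phi Psi].
Proof.
split=> [[r s /eval_cross H]|[r s H]]; split=> //.
  by move=> x Cx i j; rewrite !evtE; exact: H.
by apply/eval_cross => x Cx i j; rewrite -!evtE; exact: H.
Qed.

Definition lin M := ratmap_of F (linear_forms M).
Definition linear_aut M := M \in unitmx /\ exists2 c, c != 0 & lsub M F = c *: F.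

Lemma linear_aut_point M x : linear_aut M -> curve_points F x -> curve_points F (x *m M).
Proof.
move=> [uM [c c0 e]] /curve_pointsP [x0 Fx]; apply/curve_pointsP; split.
  by apply: contraNneq x0 => e0; rewrite -[x](mulmxK uM) e0 mul0mx.
by rewrite -eval_lsub e mevalZ Fx mulr0.
Qed.

Lemma lsubZ M c G : lsub M (c *: G) = c *: lsub M G.
Proof. exact: comp_mpolyZ. Qed.

Lemma form_eq m G H : G \is m.-homog -> H \is m.-homog -> (forall x, G.[: x] = H.[: x]) -> G = H.
Proof.
move=> hG hH e; apply/subr0_eq/eqP/contraT => n0.
have [|p] := form_nonzero_at (m := m) _ n0; first exact: rpredB.
by rewrite mevalB e subrr eqxx.
Qed.

Lemma linear_autV M : linear_aut M -> linear_aut (invmx M).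
Proof.
move=> [uM [c c0 e]]; split; first by rewrite unitmx_inv.
exists c^-1; first by rewrite invr_eq0.
have E : c *: lsub (invmx M) F = F by rewrite -lsubZ -e lsubM mulVmx // lsub1.
by rewrite -{2}E scalerA mulVf // scale1r.
Qed.

Lemma linear_autM M N : linear_aut M -> linear_aut N -> linear_aut (M *m N).
Proof.
move=> [uM [c c0 e]] [uN [b b0 f]]; split; first by rewrite unitmx_mul uM.
exists (b * c); first by rewrite mulf_neq0.
by rewrite -lsubM f lsubZ e scalerA.
Qed.

Lemma linear_aut1 : linear_aut 1%:M.
Proof. by split; [exact: unitmx1|exists 1; [exact: oner_neq0|rewrite lsub1 scale1r]]. Qed.

Lemma linear_aut_scale M c : c != 0 -> linear_aut M -> linear_aut (c *: M).
Proof.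
move=> c0 aM; rewrite -mul_scalar_mx; apply: linear_autM => //.
split; first by rewrite -scalemx1 unitmxZ ?unitmx1 ?unitfE.
exists (c ^+ d); first exact: expf_neq0.
apply: (form_eq (lsub_homog _ homF)); first exact: dhomogZ.
by move=> x; rewrite eval_lsub mul_mx_scalar mevalZ (homog_evalZ _ _ homF).
Qed.

Lemma mul_linear_forms_neq0 M x : M \in unitmx -> x != 0 -> x *m M != 0.
Proof. by move=> uM; apply: contraNneq => e0; rewrite -[x](mulmxK uM) e0 mul0mx. Qed.

Lemma represents_linear M : linear_aut M -> represents_ratmap F (linear_forms M).
Proof.
move=> aM; split; first by exists 1%N => i; exact: linear_forms_homog.
have [x Cx] := curve_nonempty d_gt1 smF; have := linear_aut_point aM Cx.
move=> /curve_pointsP [n0 _]; have [i ni] := nonzero_coord n0; exists i => /(_ x Cx).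
by rewrite eval_linear_forms => /eqP; rewrite (negPf ni).
Qed.

Lemma tnth_compose m (Phi : m.-tuple {mpoly K[3]}) Psi i x :
  (tnth (compose_forms Phi Psi) i).[: x] = (tnth Phi i).[: evt Psi x].
Proof. by rewrite tnth_mktuple eval_comp. Qed.

Lemma represents_compose m (Phi : m.-tuple {mpoly K[3]}) M : linear_aut M -> represents_ratmap F Phi ->
  represents_ratmap F (compose_forms Phi (linear_forms M)).
Proof.
move=> aM [[e hP] [i ni]]; split.
  by exists e => j; rewrite tnth_mktuple; exact: lsub_homog.
exists i => v; apply: ni => x Cx; have [uM _] := aM.
have := v _ (linear_aut_point (linear_autV aM) Cx).
by rewrite tnth_compose evt_linear_forms mulmxKV.
Qed.

Lemma comp_linear m (Phi : m.-tuple {mpoly K[3]}) M : represents_ratmap F Phi -> linear_aut M ->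
  ratmap_comp F (ratmap_of F Phi) (lin M) = ratmap_of F (compose_forms Phi (linear_forms M)).
Proof.
move=> rP aM; have rM := represents_linear aM; have rC := represents_compose aM rP.
apply/seteqP; split=> T /=; last first.
  by move=> s; exists Phi, (linear_forms M); split=> //; exact: same_ratmap_refl.
move=> [Phi' [Psi' [sP [_ _ /eval_cross sM] sC]]]; apply: (same_ratmap_trans _ sC).
have [_ [[e' hP'] _] /eval_cross cP] := sP; split; [exact: rC|by case: sC|].
apply/eval_cross => x Cx i j; rewrite !tnth_compose evt_linear_forms.
have CxM := linear_aut_point aM Cx.
have [c ->] : exists c, evt Psi' x = c *: (x *m M).
  apply: collinear_scale_mid; first by case/curve_pointsP: CxM.
  by move=> k l; rewrite !evtE -!eval_linear_forms mulrC -sM // mulrC.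
rewrite !(homog_evalZ _ _ (hP' _)) mulrCA [RHS]mulrCA; congr (_ * _); exact: cP.
Qed.

Lemma compose_linear_forms M N : compose_forms (linear_forms M) (linear_forms N) = linear_forms (N *m M).
Proof.
apply: eq_from_tnth => i; rewrite tnth_mktuple -!comp_mpolyX1.
exact: (lsubM N M 'X_i).
Qed.

Lemma linear_forms1 : linear_forms 1%:M = Xtuple K.
Proof. by apply: eq_from_tnth => i; rewrite [RHS]tnth_mktuple -comp_mpolyX1; exact: (lsub1 'X_i). Qed.

(** The order is reversed because matrices act on row vectors from the right. *)
Lemma lin_comp M N : linear_aut M -> linear_aut N -> ratmap_comp F (lin M) (lin N) = lin (N *m M).
Proof. by move=> aM aN; rewrite comp_linear ?compose_linear_forms //; exact: represents_linear. Qed.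

Lemma lin1 : lin 1%:M = ratmap_id F.
Proof. by rewrite /lin linear_forms1. Qed.

Lemma lin_inverse M : linear_aut M -> mutually_inverse F (lin M) (lin (invmx M)).
Proof.
move=> aM; have [uM _] := aM; have aV := linear_autV aM.
by split; rewrite lin_comp // ?mulmxV ?mulVmx // lin1.
Qed.

Lemma lin_regular M : linear_aut M -> regular_selfmap F (lin M).
Proof.
move=> aM; have [uM [c c0 e]] := aM; split.
  exists (linear_forms M); split=> //; first exact: represents_linear.
  by move=> x /curve_pointsP [_ Fx]; rewrite -[_ \mPo _]/(lsub M F) e mevalZ Fx mulr0.
move=> x Cx; exists (linear_forms M); split; first exact/same_ratmap_refl/represents_linear.
have /curve_pointsP [n0 _] := linear_aut_point aM Cx; have [i ni] := nonzero_coord n0.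
by exists i; rewrite eval_linear_forms.
Qed.

Lemma lin_Aut M : linear_aut M -> curve_Aut F (lin M).
Proof.
move=> aM; split; first exact: lin_regular.
by exists (lin (invmx M)); [exact/lin_regular/linear_autV|exact: lin_inverse].
Qed.

Lemma Aut_Bir sigma : curve_Aut F sigma -> curve_Bir F sigma.
Proof. by move=> [[r _] [tau [s _] i]]; split=> //; exists tau. Qed.

Lemma comp_id_collinear Phi Psi : represents_ratmap F Phi -> represents_ratmap F Psi -> vanishes_on F (F \mPo Psi) ->
  ratmap_comp F (ratmap_of F Phi) (ratmap_of F Psi) = ratmap_id F ->
  forall m n Phi' Psi', forms m Phi' -> forms n Psi' -> agree F Phi Phi' -> agree F Psi Psi' ->
  forall x, curve_points F x -> collinear (evt Phi' (evt Psi' x)) x.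
Proof.
move=> rP rQ sQ e m n Phi' Psi' h' k' a' b'.
have rX : represents_ratmap F (Xtuple K) by rewrite -linear_forms1; apply/represents_linear/linear_aut1.
have : ratmap_id F (Xtuple K) by exact: same_ratmap_refl.
rewrite -e => -[Phi1 [Psi1 [sP1 sQ1 /same_ratmapP [[_ nt] _ ac]]]].
have [[[e1 h1] n1] [[e2 h2] n2] a1] := (let: conj f _ := same_ratmapP _ _ in f) sP1.
have [[[f1 k1] m1] [[f2 k2] m2] b1] := (let: conj f _ := same_ratmapP _ _ in f) sQ1.
apply: (comp_inverse_indep d_gt3 smF h2 k2 h' k') => //.
- exact: (agree_selfmap d_gt3 smF k1 m1 k2 b1 sQ).
- exact: (agree_trans d_gt3 smF h2 h1 h' n1 (agree_sym a1) a').
- exact: (agree_trans d_gt3 smF k2 k1 k' m1 (agree_sym b1) b').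
Qed.

Theorem Bir_linear sigma : curve_Bir F sigma -> exists2 M, linear_aut M & sigma = lin M.
Proof.
move=> [[Phi [rP sP ->]] [tau [Psi [rQ sQ ->]] [e1 e2]]].
have [[e hP] nP] := rP; have [[e' hQ] nQ] := rQ.
have i1 := comp_id_collinear rP rQ sQ e1; have i2 := comp_id_collinear rQ rP sP e2.
have [||M [c [uM aM c0 eM]]] := birational_linear d_gt3 smF hP hQ nP nQ sP sQ.
- exact: i1.
- by move=> m n Phi' Psi' h k a b; exact: (i2 n m Psi' Phi').
have lM : linear_aut M by split=> //; exists c.
exists M => //; apply/ratmap_of_eq => //; first exact: represents_linear.
by apply/same_ratmapP; split=> //; exact: represents_linear.
Qed.

Lemma BirE : curve_Bir F = curve_Aut F.
Proof.
apply/seteqP; split=> sigma; last exact: Aut_Bir.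
by move=> /Bir_linear [M aM ->]; exact: lin_Aut.
Qed.

End RationalMapSets.

(** * The groups G[P] as groups of homologies *)

Section GaloisSubgroups.
Variable K : closedFieldType.
Variables (d : nat) (F : {mpoly K[3]}).
Hypotheses (d_gt3 : (3 < d)%N) (smF : smooth_plane_curve d F).
Implicit Types (p x P : 'rV[K]_3) (M N B : 'M[K]_3).

Let d_gt2 : (2 < d)%N. Proof. exact: ltnW. Qed.
Let d_gt1 : (1 < d)%N. Proof. exact: ltnW. Qed.

Local Notation lin := (lin F).
Local Notation linear_aut := (linear_aut F).

Lemma eigen_scalar (M : 'M[K]_3) : (forall x, collinear (x *m M) x) -> exists c, M = c%:M.
Proof.
move=> H; have row_e i : delta_mx 0 i *m M = M i i *: (delta_mx 0 i : 'rV[K]_3).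
  apply/rowP => j; have := H (delta_mx 0 i) j i; rewrite -rowE !mxE !eqxx /= mulr1.
  by rewrite [j == i]eq_sym; case: (i =P j) => [<-|_]; rewrite ?mulr1 ?mulr0.
have dij i j : i != j -> M i i = M j j.
  move=> ij; have := H (delta_mx 0 i + delta_mx 0 j) i j; rewrite mulmxDl !row_e !mxE !eqxx /=.
  by rewrite [j == i]eq_sym (negPf ij) /= !(addr0, add0r, mulr0, mulr1).
exists (M ord0 ord0); apply/matrixP => i j.
have : ((delta_mx 0 i : 'rV[K]_3) *m M) 0 j = (M i i *: (delta_mx 0 i : 'rV[K]_3)) 0 j by rewrite row_e.
rewrite -rowE !mxE eqxx /= => ->; rewrite eq_sym mulr_natr; congr (_ *+ _).
by have [->//|/dij] := eqVneq i ord0.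
Qed.

Lemma lin_scale M c : c != 0 -> linear_aut M -> lin (c *: M) = lin M.
Proof.
move=> c0 aM; have aC := linear_aut_scale smF c0 aM.
have [rM rC] := (represents_linear d_gt3 smF aM, represents_linear d_gt3 smF aC).
apply/(ratmap_of_eq d_gt3 smF rC rM)/same_ratmapP; split=> //.
by move=> x _; rewrite !evt_linear_forms -scalemxAr; apply: collinear_sym; exact: collinearZr.
Qed.

(** The minors that compare x M with x N are quadrics vanishing on a curve of degree greater than 2,
    so they vanish on the whole plane. Every vector is then an eigenvector of N^-1 M. *)
Lemma lin_eq M N : linear_aut M -> linear_aut N -> lin M = lin N -> exists2 c, c != 0 & M = c *: N.
Proof.
move=> aM aN; have [uM _] := aM; have [uN _] := aN.
have [rM rN] := (represents_linear d_gt3 smF aM, represents_linear d_gt3 smF aN).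
move=> /(ratmap_of_eq d_gt3 smF rM rN) [_ _ H].
have col y : collinear (y *m M) (y *m N).
  move=> i j; rewrite -!eval_linear_forms; apply: subr0_eq; rewrite -!mevalM -mevalB.
  rewrite (vanishes_low_degree d_gt1 smF _ d_gt2 (H i j)) ?meval0 //.
  by apply: rpredB; (rewrite -[2%N]/(1 + 1)%N; apply: dhomogM; exact: linear_forms_homog).
have [|c ec] := @eigen_scalar (invmx N *m M).
  by move=> x; have := col (x *m invmx N); rewrite mulmxKV // mulmxA.
have eM : M = c *: N by rewrite -[M](mulKVmx uN) ec mul_mx_scalar.
exists c => //; apply: contraTneq uM => c0.
by rewrite eM c0 scale0r unitmxE det0 unitr0.
Qed.

(** Scalars, homologies and elations with centre P: the matrices that map every line through P into
    itself. *)
Definition central P M := exists r (l : 'cV[K]_3), M = r%:M + l *m P.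

Lemma centralP P M : P != 0 -> central P M <-> forall x, det3 (x *m M) P x = 0.
Proof.
move=> P0; split=> [[r [l ->]] x|H].
  rewrite mulmxDr mul_mx_scalar mulmxA [x *m l]mx11_scalar mul_scalar_mx /det3 !mxE; ring.
have [u [w D]] := frame_exists P0; have uA := frame_unit D.
have crd v : exists a b c, v = a *: u + b *: P + c *: w.
  have e : v = v *m invmx (frame u P w) *m frame u P w by rewrite mulmxKV.
  move: (v *m _) e => z ->; rewrite (pt_eta z) mul_pt_frame.
  by exists (z 0 ord0), (z 0 i1), (z 0 i2).
have [a [b [c eu]]] := crd (u *m M); have [a' [b' [c' ew]]] := crd (w *m M).
have [a2 [b2 [c2 eP]]] := crd (P *m M).
(* In the frame u, P, w these test vectors leave only components along P and one common eigenvalue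
   on the quotient by P. *)
have := H (u + w); have := H (u + P); have := H (w + P); have := H u; have := H w.
rewrite !mulmxDl eu ew eP => H1 H2 H3 H4 H5.
have D0 k : k * det3 u P w = 0 -> k = 0 by move/eqP; rewrite mulf_eq0 (negPf D) orbF => /eqP.
have a'0 : a' = 0 by apply: D0; rewrite -H1 /det3 !mxE; ring.
have c0 : c = 0 by apply/eqP; rewrite -oppr_eq0; apply/eqP/D0; rewrite -H2 /det3 !mxE; ring.
have a20 : a2 = 0 by apply: D0; rewrite -[RHS]subr0 -{1}H3 -{1}H1 /det3 !mxE; ring.
have c20 : c2 = 0.
  by apply/eqP; rewrite -oppr_eq0; apply/eqP/D0; rewrite -[RHS]subr0 -{1}H4 -{1}H2 /det3 !mxE; ring.
have ac : a = c'.
  by apply/subr0_eq/D0; rewrite -H5 a'0 c0 /det3 !mxE; ring.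
pose v : 'cV[K]_3 := \col_i nth 0 [:: b; b2 - a; b'] i.
pose l := invmx (frame u P w) *m v.
have lE (x y z : K) : (x *: u + y *: P + z *: w) *m l = (x * b + y * (b2 - a) + z * b')%:M.
  rewrite -mul_pt_frame /l mulmxA mulmxK // [LHS]mx11_scalar; congr (_%:M).
  by rewrite mxE sum3 !ptE !mxE.
exists a, l; apply/row_matrixP => i; rewrite !rowE; move: (delta_mx _ _) => y.
have [x1 [x2 [x3 ey]]] := crd y.
rewrite mulmxDr mulmxA mul_mx_scalar ey lE mul_scalar_mx !mulmxDl -!scalemxAl eu ew eP a20 c20 c0 a'0 -ac.
by apply/rowP => j; rewrite !mxE; ring.
Qed.

(** Two points have the same image exactly if they are collinear with P. The only minor is P_i times
    the determinant up to sign, and the sign depends on which coordinate i is dropped. *)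
Lemma projection_det3 P x (y : 'rV[K]_3) :
  (forall k l, (tnth (projection_forms P) k).[: x] * (tnth (projection_forms P) l).[: y] =
     (tnth (projection_forms P) l).[: x] * (tnth (projection_forms P) k).[: y]) <-> (P != 0 -> det3 x P y = 0).
Proof.
have [->|P0] := eqVneq P 0.
  split=> // _ k l; rewrite !tnth_mktuple !mxE !scale0r subrr !meval0 //.
have [i [Pi E]] : exists i, P 0 i != 0 /\ forall k (z : 'rV[K]_3), (tnth (projection_forms P) k).[: z] =
    P 0 i * z 0 (lift i k) - P 0 (lift i k) * z 0 i.
  case ei : [pick i | P 0 i != 0] => [i|]; last first.
    by have [j] := nonzero_coord P0; move: ei; case: pickP => // + _ => /(_ j) ->.
  exists i; split; first by move: ei; case: pickP => // j ? [<-].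
  by move=> k z; rewrite tnth_mktuple ei /= mevalB !mevalZ !mevalXU.
have D : (P 0 i * x 0 (lift i ord0) - P 0 (lift i ord0) * x 0 i) * (P 0 i * y 0 (lift i ord_max) - P 0 (lift i ord_max) * y 0 i)
    - (P 0 i * x 0 (lift i ord_max) - P 0 (lift i ord_max) * x 0 i) * (P 0 i * y 0 (lift i ord0) - P 0 (lift i ord0) * y 0 i)
    = (if i == i1 then - P 0 i else P 0 i) * - det3 x P y.
  case: (ord3P i) => -> /=; rewrite /det3.
  - have -> : lift ord0 (ord0 : 'I_2) = i1 by exact: val_inj.
    have -> : lift ord0 (ord_max : 'I_2) = i2 by exact: val_inj.
    by ring.
  - have -> : lift i1 (ord0 : 'I_2) = ord0 by exact: val_inj.
    have -> : lift i1 (ord_max : 'I_2) = i2 by exact: val_inj.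
    by ring.
  have -> : lift i2 (ord0 : 'I_2) = ord0 by exact: val_inj.
  have -> : lift i2 (ord_max : 'I_2) = i1 by exact: val_inj.
  by ring.
split=> [H _|H k l].
  move: D; rewrite -!E H subrr => /esym/eqP; rewrite mulf_eq0 oppr_eq0 => /orP[|/eqP//].
  by case: ifP => _; rewrite ?oppr_eq0 (negPf Pi).
move: D; rewrite (H isT) oppr0 mulr0 -!E => /subr0_eq D.
have I2 (j : 'I_2) : j = ord0 \/ j = ord_max by case: j => [[|[|]]] // ?; [left|right]; exact: val_inj.
by case: (I2 k) => ->; case: (I2 l) => -> //; exact: esym.
Qed.

Lemma represents_projection P : P != 0 -> represents_ratmap F (projection_forms P).
Proof.
move=> P0; split.
  exists 1%N => k; rewrite tnth_mktuple; apply: rpredB; apply: dhomogZ; rewrite dhomogX /= mdeg1 //.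
exists ord0; apply: (linear_not_vanishing d_gt1 smF).
  rewrite tnth_mktuple; apply: rpredB; apply: dhomogZ; rewrite dhomogX /= mdeg1 //.
rewrite tnth_mktuple; case: pickP => [i Pi|H]; last by have [j] := nonzero_coord P0; rewrite H.
apply/eqP => /(congr1 (fun G : {mpoly K[3]} => G.[: (delta_mx 0 (lift i ord0) : 'rV[K]_3)])).
rewrite mevalB !mevalZ !mevalXU meval0 !mxE !eqxx /= mulr1 (negPf (neq_lift _ _)) mulr0 subr0.
exact/eqP.
Qed.

(** Preserving the projection is a condition by quadrics on C, and since d > 2 it extends from C to
    the plane. *)
Lemma galois_lin P M : P != 0 -> linear_aut M -> galois_at F P (lin M) <-> central P M.
Proof.
move=> P0 aM; have rP := represents_projection P0; have rC := represents_compose aM rP.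
rewrite centralP //.
have -> : galois_at F P (lin M) <-> same_ratmap F (compose_forms (projection_forms P) (linear_forms M)) (projection_forms P).
  rewrite /galois_at /= /projection (comp_linear d_gt3 smF rP aM).
  split=> [[_ e]|e]; first exact/(ratmap_of_eq d_gt3 smF).
  by split; [exact/Aut_Bir/(lin_Aut d_gt3 smF)|exact/(ratmap_of_eq d_gt3 smF)].
have E (G : {mpoly K[3]}) k x : (tnth (compose_forms (projection_forms P) (linear_forms M)) k * G).[: x] =
   (tnth (projection_forms P) k).[: x *m M] * G.[: x].
  by rewrite mevalM tnth_compose evt_linear_forms.
split=> [[_ _ H] x|H].
  have [pd _] := projection_det3 P (x *m M) x; apply: pd => // k l; apply: subr0_eq; rewrite -!E -mevalB.
  have h1 j : tnth (projection_forms P) j \is 1.-homog.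
    by rewrite tnth_mktuple; apply: rpredB; apply: dhomogZ; rewrite dhomogX /= mdeg1.
  have h2 j : tnth (compose_forms (projection_forms P) (linear_forms M)) j \is 1.-homog.
    by rewrite tnth_mktuple; exact: lsub_homog.
  rewrite (vanishes_low_degree d_gt1 smF _ d_gt2 (H k l)) ?meval0 //.
  by apply: rpredB; (rewrite -[2%N]/(1 + 1)%N; exact: dhomogM).
split=> // k l x Cx; rewrite mevalB !E; apply/eqP; rewrite subr_eq0; apply/eqP.
by move: k l; apply/(projection_det3 P (x *m M) x) => _; exact: H.
Qed.

Lemma galois_linear P sigma : P != 0 -> galois_at F P sigma -> exists M, [/\ linear_aut M, sigma = lin M & central P M].
Proof.
move=> P0 gP; have [M aM e] := Bir_linear d_gt3 smF gP.1.
by exists M; split=> //; apply/(galois_lin P0 aM); rewrite -e.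
Qed.

Lemma centralM P M N : central P M -> central P N -> central P (M *m N).
Proof.
move=> [r [l ->]] [s [m ->]]; exists (r * s), (s *: l + r *: m + ((P *m m) 0 0) *: l).
rewrite mulmxDl !mulmxDr -scalar_mxM mul_scalar_mx mul_mx_scalar -addrA; congr (_ + _).
rewrite !mulmxDl -!scalemxAl -!addrA addrCA; congr (_ + (_ + _)).
rewrite !mulmxA -[l *m P *m m]mulmxA [P *m m]mx11_scalar mul_mx_scalar -scalemxAl.
by congr (_ *: _); rewrite [RHS]mxE eqxx mulr1n.
Qed.

Lemma central1 P : central P 1%:M.
Proof. by exists 1, 0; rewrite mul0mx addr0. Qed.

Lemma central_conj P M B : B \in unitmx -> central P M -> central (P *m B) (invmx B *m M *m B).
Proof.
move=> uB [r [l ->]]; exists r, (invmx B *m l).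
by rewrite mulmxDr mulmxDl mul_mx_scalar -scalemxAl mulVmx // scalemx1 !mulmxA.
Qed.

Lemma conj_mx_aut M B : linear_aut M -> linear_aut B -> linear_aut (invmx B *m M *m B).
Proof. by move=> aM aB; do !apply: linear_autM => //; exact: linear_autV. Qed.

End GaloisSubgroups.

(** * The group generated by the groups G[P] *)

Lemma card_set_finset (T : finType) (A : {set T}) : ([set x | x \in A] #= `I_#|A|)%card.
Proof.
have -> : `I_#|A|%classic = ((fun x => index x (enum A)) @` [set x | x \in A])%classic.
  apply/seteqP; split=> k /=.
    move=> kA; have ks : (k < size (enum A))%N by rewrite -cardE.
    have [x0 _] : exists x0, x0 \in A by apply/card_gt0P; apply: leq_ltn_trans kA.
    exists (nth x0 (enum A) k); first by rewrite -mem_enum mem_nth.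
    by rewrite index_uniq // enum_uniq.
  by move=> [x Ax <-]; rewrite cardE index_mem mem_enum.
rewrite card_eq_sym; apply: inj_card_eq => x y; rewrite !inE /= => Ax Ay e.
have eI z : z \in A -> nth x (enum A) (index z (enum A)) = z by move=> Az; rewrite nth_index // mem_enum.
by rewrite -(eI x Ax) e eI.
Qed.

Section QuasiGaloisGroup.
Variable K : closedFieldType.
Variables (d : nat) (F : {mpoly K[3]}).
Hypotheses (d_gt3 : (3 < d)%N) (smF : smooth_plane_curve d F).
Implicit Types (p x P : 'rV[K]_3) (M N B : 'M[K]_3) (H : set (ratmap K 3)).

Let d_gt2 : (2 < d)%N. Proof. exact: ltnW. Qed.
Let d_gt1 : (1 < d)%N. Proof. exact: ltnW. Qed.

Local Notation lin := (lin F).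
Local Notation linear_aut := (linear_aut F).

Lemma quasi_galois_groupP n sigma : quasi_galois_group F n sigma <->
  forall H, curve_Bir_subgroup F H ->
    (forall P, P != 0 -> (galois_at F P #= `I_n)%card -> (galois_at F P `<=` H)%classic) -> H sigma.
Proof.
split=> [G H sH gH|G H [sH gH]].
  apply: G; split=> // s [P [P0 c] gs]; apply: (gH P) => //.
apply: G => // P P0 c s gs; apply: gH; by exists P.
Qed.

(** The inverse supplied by [H] is an unspecified rational map; linearity of Bir(C) identifies it
    with a scalar multiple of [invmx M]. *)
Lemma subgroup_lin_inv H M : curve_Bir_subgroup F H -> linear_aut M -> H (lin M) -> H (lin (invmx M)).
Proof.
move=> [sB _ _ hV] aM /hV [tau Ht [e _]]; have [N aN eN] := Bir_linear d_gt3 smF (sB _ Ht).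
move: e Ht; rewrite eN (lin_comp d_gt3 smF aM aN) -(lin1 F) => e Ht.
have [c c0 ec] := lin_eq d_gt3 smF (linear_autM aN aM) (linear_aut1 F) e.
have [uM _] := aM; have eN' : N = c *: invmx M by rewrite -[N](mulmxK uM) ec -scalemxAl mul1mx.
by move: Ht; rewrite eN' (lin_scale d_gt3 smF c0) //; exact: linear_autV.
Qed.

Lemma Bir_subgroup : curve_Bir_subgroup F (curve_Bir F).
Proof.
have LB M : linear_aut M -> curve_Bir F (lin M) by move=> /(lin_Aut d_gt3 smF)/Aut_Bir.
split=> //.
- by rewrite -lin1; exact: LB (linear_aut1 F).
- move=> s t /(Bir_linear d_gt3 smF) [M aM ->] /(Bir_linear d_gt3 smF) [N aN ->].
  by rewrite (lin_comp d_gt3 smF) //; apply: LB; exact: linear_autM.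
move=> s /(Bir_linear d_gt3 smF) [M aM ->]; exists (lin (invmx M)); last exact: (lin_inverse d_gt3 smF aM).
exact/LB/linear_autV.
Qed.

Section Fixed.
Variable n : nat.
Local Notation Gamma := (quasi_galois_group F n).

Lemma qg_Bir sigma : Gamma sigma -> curve_Bir F sigma.
Proof. by move/quasi_galois_groupP; apply; [exact: Bir_subgroup|move=> P _ _ s []]. Qed.

Lemma qg1 : Gamma (lin 1%:M).
Proof. by apply/quasi_galois_groupP => H [_ h1 _ _] _; rewrite lin1. Qed.

Lemma qgM M N : linear_aut M -> linear_aut N -> Gamma (lin M) -> Gamma (lin N) -> Gamma (lin (M *m N)).
Proof.
move=> aM aN /quasi_galois_groupP gM /quasi_galois_groupP gN; apply/quasi_galois_groupP => H sH gH.
rewrite -(lin_comp d_gt3 smF aN aM); case: (sH) => _ _ hM _; apply: hM; [exact: gN|exact: gM].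
Qed.

Lemma qgV M : linear_aut M -> Gamma (lin M) -> Gamma (lin (invmx M)).
Proof.
move=> aM /quasi_galois_groupP gM; apply/quasi_galois_groupP => H sH gH.
by apply: subgroup_lin_inv => //; exact: gM.
Qed.

Lemma qg_central P M : P != 0 -> (galois_at F P #= `I_n)%card -> linear_aut M -> central P M -> Gamma (lin M).
Proof.
move=> P0 c aM cM; apply/quasi_galois_groupP => H sH gH; apply: (gH P P0 c).
exact/(galois_lin d_gt3 smF P0 aM).
Qed.

Lemma galois_card_conj P B : P != 0 -> linear_aut B -> (galois_at F (P *m B) #= galois_at F P)%card.
Proof.
move=> P0 aB; have [uB _] := aB; have PB0 := mul_linear_forms_neq0 uB P0.
have aV := linear_autV aB.
pose f sigma := ratmap_comp F (lin B) (ratmap_comp F sigma (lin (invmx B))).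
have fE M : linear_aut M -> f (lin M) = lin (invmx B *m M *m B).
  move=> aM; rewrite /f (lin_comp d_gt3 smF aM aV) (lin_comp d_gt3 smF aB) //.
  exact: linear_autM.
have -> : galois_at F (P *m B) = (f @` galois_at F P)%classic.
  apply/seteqP; split=> s /=.
    move=> /(galois_linear d_gt3 smF PB0) [M [aM -> cM]].
    have aC : linear_aut (B *m M *m invmx B) by do !apply: linear_autM.
    exists (lin (B *m M *m invmx B)).
      apply/(galois_lin d_gt3 smF P0 aC).
      have uV : invmx B \in unitmx by rewrite unitmx_inv.
      by have := central_conj uV cM; rewrite invmxK mulmxK.
    by rewrite fE // !mulmxA mulVmx // mul1mx mulmxKV.
  move=> [t /(galois_linear d_gt3 smF P0) [M [aM -> cM]] <-]; rewrite fE //.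
  apply/(galois_lin d_gt3 smF PB0); first exact: conj_mx_aut.
  exact: central_conj.
apply: inj_card_eq => s t; rewrite !inE => /(galois_linear d_gt3 smF P0) [M [aM -> _]].
move=> /(galois_linear d_gt3 smF P0) [N [aN -> _]]; rewrite !fE // => e.
have [c c0 ec] := lin_eq d_gt3 smF (conj_mx_aut aM aB) (conj_mx_aut aN aB) e.
have -> : M = c *: N; last exact: (lin_scale d_gt3 smF).
have eX (X : 'M[K]_3) : X = B *m (invmx B *m X *m B) *m invmx B by rewrite !mulmxA mulmxV // mul1mx mulmxK.
by rewrite (eX M) ec -scalemxAr -scalemxAl -eX.
Qed.

(** Normality. The maps whose conjugate by B lies in Gamma form a subgroup, and it contains every
    G[P] of order n because conjugation carries G[P] onto G[P B], of the same order. *)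
Lemma qg_conj M B : linear_aut M -> linear_aut B -> Gamma (lin M) -> Gamma (lin (invmx B *m M *m B)).
Proof.
move=> aM aB; have [uB _] := aB.
pose H : set (ratmap K 3) := [set s | exists N, [/\ linear_aut N, s = lin N & Gamma (lin (invmx B *m N *m B))]]%classic.
have sH : curve_Bir_subgroup F H.
  split.
  - by move=> s [N [aN -> _]]; exact/Aut_Bir/(lin_Aut d_gt3 smF).
  - exists 1%:M; split; [exact: linear_aut1|by rewrite lin1|].
    by rewrite mulmx1 mulVmx //; exact: qg1.
  - move=> s t [N [aN -> gN]] [N' [aN' -> gN']]; exists (N' *m N); split.
    + exact: linear_autM.
    + exact: (lin_comp d_gt3 smF).
    have -> : invmx B *m (N' *m N) *m B = (invmx B *m N' *m B) *m (invmx B *m N *m B).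
      by rewrite !mulmxA mulmxK.
    by apply: qgM => //; exact: conj_mx_aut.
  move=> s [N [aN -> gN]]; exists (lin (invmx N)); last exact: (lin_inverse d_gt3 smF aN).
  exists (invmx N); split=> //; first exact: linear_autV.
  have [uN _] := aN; have aNB := conj_mx_aut aN aB.
  have -> : invmx B *m invmx N *m B = invmx (invmx B *m N *m B); last exact: qgV.
  have [uNB _] := aNB; apply: (can_inj (mulKmx uNB)); rewrite mulmxV //.
  by rewrite !mulmxA mulmxK // mulmxK // mulVmx.
have gH P : P != 0 -> (galois_at F P #= `I_n)%card -> (galois_at F P `<=` H)%classic.
  move=> P0 c s /(galois_linear d_gt3 smF P0) [N [aN -> cN]]; exists N; split=> //.
  apply: (@qg_central (P *m B)).
  - exact: mul_linear_forms_neq0.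
  - exact: card_eq_trans (galois_card_conj P0 aB) c.
  - exact: conj_mx_aut.
  exact: central_conj.
move=> /quasi_galois_groupP /(_ H sH gH) [N [aN e gN]].
have [c c0 ->] := lin_eq d_gt3 smF aM aN e.
by rewrite -scalemxAr -scalemxAl (lin_scale d_gt3 smF c0) //; exact: conj_mx_aut.
Qed.

End Fixed.

Theorem simple_even_aut (gT : finGroupType) (G : {group gT}) (phi : gT -> ratmap K 3) :
  group_iso F G (curve_Aut F) phi -> simple G -> ~~ odd #|G| ->
  exists n : nat, [/\ (2 <= n)%N, ~~ odd n & curve_Aut F = quasi_galois_group F n].
Proof.
move=> [phi_inj phi_im phiM] sG evG.
have phiA g : g \in G -> exists2 M, linear_aut M & phi g = lin M.
  move=> Gg; apply/(Bir_linear d_gt3 smF)/Aut_Bir; rewrite -phi_im; exists g => //.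
have phiV M : linear_aut M -> exists2 g, g \in G & phi g = lin M.
  by move=> /(lin_Aut d_gt3 smF); rewrite -phi_im => -[g Gg e]; exists g.
have phi1 : phi 1%g = lin 1%:M.
  have [N aN e] := phiA _ (group1 G); have := phiM _ _ (group1 G) (group1 G).
  rewrite mulg1 e (lin_comp d_gt3 smF) // => /(lin_eq d_gt3 smF aN (linear_autM aN aN)) [c c0 eN].
  have [uN _] := aN; have eN1 : 1%:M = c *: N by rewrite -(mulVmx uN) {2}eN -scalemxAr mulKmx.
  by rewrite eN1 (lin_scale d_gt3 smF).
have phi_cancel g h M N : g \in G -> h \in G -> linear_aut M -> linear_aut N -> phi g = lin M -> phi h = lin N ->
    phi (g * h)%g = lin (N *m M).
  by move=> Gg Gh aM aN eg eh; rewrite phiM // eg eh (lin_comp d_gt3 smF).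
have phi_inv g M : g \in G -> linear_aut M -> phi g = lin M -> phi g^-1%g = lin (invmx M).
  move=> Gg aM e; have [N aN eN] := phiA _ (groupVr Gg).
  have := phi_cancel _ _ _ _ Gg (groupVr Gg) aM aN e eN; rewrite mulgV phi1.
  move=> /esym/(lin_eq d_gt3 smF (linear_autM aN aM) (linear_aut1 F)) [c c0 ec].
  have [uM _] := aM; have eN' : N = c *: invmx M by rewrite -[N](mulmxK uM) ec -scalemxAl mul1mx.
  by rewrite eN eN' (lin_scale d_gt3 smF c0) //; exact: linear_autV.
have [s Gs os] : {s | s \in G & #[s]%g = 2%N} by apply: Cauchy => //; rewrite dvdn2.
have [M aM es] := phiA s Gs.
have nsc c : M <> c%:M.
  move=> e; have c0 : c != 0.
    by have [uM _] := aM; apply: contraTneq uM => c0; rewrite e c0 unitmxE det_scalar expr0n unitr0.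
  have : phi s = phi 1%g.
    by rewrite es phi1 e -[c%:M]scalemx1 (lin_scale d_gt3 smF c0) //; exact: linear_aut1.
  by move=> /(phi_inj s 1%g Gs (group1 G)) s1; move: os; rewrite s1 order1.
(* The square of M is scalar since s has order 2, and the scalar has a square root in K. *)
have [a Ma] : exists a, M *m M = (a ^+ 2)%:M.
  have := phi_cancel _ _ _ _ Gs Gs aM aM es es; have -> : (s * s)%g = 1%g by rewrite -(expg_order s) os expg2.
  rewrite phi1.
  move=> /esym/(lin_eq d_gt3 smF (linear_autM aM aM) (linear_aut1 F)) [c c0 ec].
  have [a ea] := @solve_monicpoly K 2 (fun i => if i is 0 then c else 0) isT.
  by exists a; rewrite ec ea !big_ord_recl big_ord0 expr0 mulr1 mul0r !addr0 scalemx1.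
(* Since (M - a)(M + a) = 0, the two ranks add up to at most 3, so one of them is at most 1. This
   makes M a matrix with a centre P. *)
have [b rb] : exists b, (\rank (M - b%:M)%R <= 1)%N.
  have e0 : (M - a%:M) *m (M - (- a)%:M) = 0.
    rewrite mulmxBl !mulmxBr Ma !mul_scalar_mx !mul_mx_scalar -scalemx1.
    by rewrite scalemx1 scale_scalar_mx mulrN -expr2 raddfN /= opprK scaleNr; apply/matrixP => i j; rewrite !mxE; ring.
  have := mulmx0_rank_max e0; case: (leqP (\rank (M - a%:M)) 1) => h; first by exists a.
  by move=> h'; exists (- a); move: h h'; clear; move: (\rank _) (\rank _); lia.
have [P [l [P0 eM]]] : exists (P : 'rV[K]_3) (l : 'cV[K]_3), P != 0 /\ M = b%:M + l *m P.
  have rb1 : \rank (M - b%:M) = 1%N.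
    apply/eqP; rewrite eqn_leq rb lt0n mxrank_eq0 subr_eq0; apply/eqP; exact: nsc.
  move: (mulmx_base (M - b%:M)) (row_base_free (M - b%:M)); move: (col_base _) (row_base _); rewrite rb1.
  move=> l P e fP; exists P, l; split; last by rewrite e addrC subrK.
  by apply: contraTneq fP => ->; rewrite /row_free mxrank0.
have cM : central P M by exists b, l.
(* G[P] as a subgroup of G. It contains s, so its order, which will be n, is even. *)
pose H := [set g in G | `[< galois_at F P (phi g) >]].
have HP g N : g \in G -> linear_aut N -> phi g = lin N -> reflect (central P N) (g \in H).
  move=> Gg aN eg; rewrite inE Gg /=; apply: (iffP (asboolP _)); rewrite eg => h.
    exact/(galois_lin d_gt3 smF P0 aN).
  exact/(galois_lin d_gt3 smF P0 aN).
have HG : H \subset G by apply/fintype.subsetP => g; rewrite inE => /andP[].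
have gH : group_set H.
  apply/group_setP; split.
    by apply/(HP _ _ (group1 G) (linear_aut1 F) phi1); exact: central1.
  move=> g h Hg Hh; have Gg := fintype.subsetP HG _ Hg; have Gh := fintype.subsetP HG _ Hh.
  have [N aN eg] := phiA g Gg; have [N' aN' eh] := phiA h Gh.
  apply/(HP _ _ (groupM Gg Gh) (linear_autM aN' aN) (phi_cancel _ _ _ _ Gg Gh aN aN' eg eh)).
  by apply: centralM; [apply/(HP _ _ Gh aN' eh)|apply/(HP _ _ Gg aN eg)].
pose HH := Group gH; have sH : s \in HH by apply/(HP _ _ Gs aM es).
have evH : (2 %| #|HH|)%N by rewrite -os order_dvdG.
have cardP : (galois_at F P #= `I_#|H|)%card.
  have -> : galois_at F P = (phi @` [set g | g \in H])%classic.
    apply/seteqP; split=> t /=.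
      move=> gt; have [N [aN et cN]] := galois_linear d_gt3 smF P0 gt.
      by have [g Gg eg] := phiV N aN; exists g; [apply/(HP _ _ Gg aN eg)|rewrite et].
    by move=> [g Hg <-]; move: Hg; rewrite inE => /andP[_ /asboolP].
  apply: card_eq_trans (inj_card_eq _) _.
    by move=> g h; rewrite !inE /= => /(fintype.subsetP HG) Gg /(fintype.subsetP HG) Gh; exact: phi_inj.
  exact: card_set_finset.
exists #|H|; split.
- by apply: dvdn_leq => //; exact: (cardG_gt0 HH).
- by rewrite -dvdn2.
rewrite -(BirE d_gt3 smF); set Gamma := quasi_galois_group F #|H|.
(* Gamma seen inside G: normal by [qg_conj] and nontrivial because it contains s. *)
pose N := [set g in G | `[< Gamma (phi g) >]].
have NG : N \subset G by apply/fintype.subsetP => g; rewrite inE => /andP[].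
have inN g : g \in G -> reflect (Gamma (phi g)) (g \in N) by move=> Gg; rewrite inE Gg; exact: asboolP.
have gN : group_set N.
  apply/group_setP; split; first by apply/(inN _ (group1 G)); rewrite phi1; exact: qg1.
  move=> g h Ng Nh; have Gg := fintype.subsetP NG _ Ng; have Gh := fintype.subsetP NG _ Nh.
  have [L aL eg] := phiA g Gg; have [L' aL' eh] := phiA h Gh.
  apply/(inN _ (groupM Gg Gh)); rewrite (phi_cancel _ _ _ _ Gg Gh aL aL' eg eh); apply: qgM => //.
    by rewrite -eh; apply/inN.
  by rewrite -eg; apply/inN.
pose NN := Group gN.
have nN : (NN <| G)%g.
  apply/andP; split=> //; apply/normsP => g Gg; apply/eqP; rewrite eqEcard cardJg leqnn andbT.
  apply/fintype.subsetP => _ /imsetP [h Nh ->]; have Gh := fintype.subsetP NG _ Nh.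
  have [L aL eg] := phiA g Gg; have [L' aL' eh] := phiA h Gh.
  have Ghg : (h ^ g)%g \in G by rewrite groupJ.
  apply/(inN _ Ghg); rewrite conjgE.
  have e1 := phi_cancel _ _ _ _ Gh Gg aL' aL eh eg.
  rewrite (phi_cancel _ _ _ _ (groupVr Gg) (groupM Gh Gg) (linear_autV aL) (linear_autM aL aL') (phi_inv _ _ Gg aL eg) e1).
  rewrite -{1}[L]invmxK; apply: qg_conj => //; first exact: linear_autV.
  by rewrite -eh; apply/inN.
have s_N : s \in NN.
  by apply/(inN _ Gs); rewrite es; exact: (qg_central P0 cardP aM cM).
have eN : NN :=: G.
  case/simpleP: sG => _ /(_ NN nN) [e1|//]; move: s_N; rewrite e1 => /set1gP s1.
  by move: os; rewrite s1 order1.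
apply/seteqP; split=> t; last exact: qg_Bir.
move=> /(Bir_linear d_gt3 smF) [L aL ->]; have [g Gg <-] := phiV L aL.
by apply/(inN _ Gg); rewrite -[N]/(NN : {set gT}) eN.
Qed.

End QuasiGaloisGroup.

(** * Hessian and orbits of flexes *)

Section Hessian.
Variable K : closedFieldType.
Implicit Types (F G : {mpoly K[3]}) (p x u v w P : 'rV[K]_3) (M N B : 'M[K]_3).

Lemma det_mx3 (R : comNzRingType) (A : 'M[R]_3) : \det A =
  A ord0 ord0 * (A i1 i1 * A i2 i2 - A i1 i2 * A i2 i1)
  - A ord0 i1 * (A i1 ord0 * A i2 i2 - A i1 i2 * A i2 ord0)
  + A ord0 i2 * (A i1 ord0 * A i2 i1 - A i1 i1 * A i2 ord0).
Proof.
have det2 (E : 'M[R]_2) : \det E = E ord0 ord0 * E ord_max ord_max - E ord0 ord_max * E ord_max ord0.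
  rewrite (expand_det_row _ ord0) !big_ord_recl big_ord0 addr0 /cofactor !det_mx11 !mxE /= /bump /=.
  rewrite addn0 expr0 mul1r !expr1 mulN1r mulrN.
  by congr (_ * E _ _ - E _ _ * E _ _); exact: val_inj.
rewrite (expand_det_row _ ord0) sum3 /cofactor !det2 !mxE /=.
have -> : lift (ord0 : 'I_3) (ord0 : 'I_2) = i1 by exact: val_inj.
have -> : lift (ord0 : 'I_3) (ord_max : 'I_2) = i2 by exact: val_inj.
have -> : lift i1 (ord0 : 'I_2) = ord0 by exact: val_inj.
have -> : lift i1 (ord_max : 'I_2) = i2 by exact: val_inj.
have -> : lift i2 (ord0 : 'I_2) = ord0 by exact: val_inj.
have -> : lift i2 (ord_max : 'I_2) = i1 by exact: val_inj.
by rewrite !expr0 !expr1 expr2; ring.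
Qed.

Definition dform F v := \sum_i v 0 i *: F^`M(i).

Lemma eval_dform F v p : (dform F v).[: p] = dgrad F p v.
Proof. by rewrite /dform raddf_sum; apply: eq_bigr => i _; rewrite /= mevalZ mulrC. Qed.

Lemma dform_homog m F v : F \is m.-homog -> dform F v \is m.-1.-homog.
Proof. by move=> hF; apply: rpred_sum => i _; apply: dhomogZ; exact: dhomog_mderiv. Qed.

Lemma dform_lsub m M F v : F \is m.-homog -> dform (lsub M F) v = lsub M (dform F (v *m M)).
Proof.
move=> hF; apply: (form_eq (m := m.-1)).
- exact/dform_homog/lsub_homog.
- exact/lsub_homog/dform_homog.
by move=> p; rewrite eval_lsub !eval_dform dgrad_lsub.
Qed.

Definition second_derivs F : 'M[{mpoly K[3]}]_3 := \matrix_(i, j) F^`M(i)^`M(j).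
Definition hessian F := \det (second_derivs F).
Definition hess_at F p : 'M[K]_3 := \matrix_(i, j) (F^`M(i)^`M(j)).[: p].

Lemma eval_hessian F p : (hessian F).[: p] = \det (hess_at F p).
Proof.
rewrite /hessian -[LHS]/((meval (p 0)) (\det _)) -det_map_mx; congr (\det _).
by apply/matrixP => i j; rewrite !mxE.
Qed.

Lemma hess_atE F p u w : dgrad (dform F u) p w = (u *m hess_at F p *m w^T) 0 0.
Proof.
rewrite mxE; apply: eq_bigr => j _; rewrite mxE [w^T j 0]mxE; congr (_ * _).
rewrite /dform (raddf_sum (mderiv j)) (raddf_sum (meval (p 0))).
by apply: eq_bigr => i _; rewrite /= mderivZ mevalZ mxE.
Qed.

Lemma bilinear_mx (A : 'M[K]_3) i j : ((delta_mx 0 i : 'rV[K]_3) *m A *m (delta_mx 0 j : 'rV[K]_3)^T) 0 0 = A i j.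
Proof. by rewrite trmx_delta -rowE -colE !mxE. Qed.

Lemma hess_at_lsub m M F p : F \is m.-homog -> hess_at (lsub M F) p = M *m hess_at F (p *m M) *m M^T.
Proof.
move=> hF; apply/matrixP => i j; rewrite -bilinear_mx -hess_atE (dform_lsub M _ hF) dgrad_lsub hess_atE.
by rewrite trmx_mul -[RHS]bilinear_mx !mulmxA.
Qed.

Lemma hess_atZ c F p : hess_at (c *: F) p = c *: hess_at F p.
Proof. by apply/matrixP => i j; rewrite !mxE !mderivZ mevalZ. Qed.

Lemma hessian_homog m F : F \is m.-homog -> hessian F \is (m.-2 + (m.-2 + m.-2)).-homog.
Proof.
move=> hF; have h i j : second_derivs F i j \is (m.-2).-homog by rewrite mxE; do 2!apply: dhomog_mderiv.
rewrite /hessian det_mx3; apply: rpredD; [apply: rpredB|]; (apply: dhomogM; first exact: h);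
  by apply: rpredB; apply: dhomogM; exact: h.
Qed.

(** An automorphism changes the Hessian matrix by congruence with an invertible matrix and a scalar,
    so its determinant remains zero. *)
Lemma hessian_aut m F M p : F \is m.-homog -> linear_aut F M -> (hessian F).[: p] = 0 -> (hessian F).[: p *m M] = 0.
Proof.
move=> hF [uM [c c0 e]]; rewrite !eval_hessian => h0.
have := congr1 determinant (hess_at_lsub M p hF); rewrite e hess_atZ detZ h0 mulr0 !det_mulmx det_tr.
move=> /esym/eqP; move: uM; rewrite unitmxE unitfE => /negPf dM.
by rewrite !mulf_eq0 dM orbF => /eqP.
Qed.

End Hessian.

(** The group generated by s is a p-group, and its orbits on A other than fixed points have length
    divisible by p. *)
Lemma fixed_points_mod (T : finType) (s : {perm T}) (p : nat) (A : {set T}) : prime p -> (s ^+ p = 1)%g ->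
  (forall x, x \in A -> s x \in A) -> #|A| = #|[set x in A | s x == x]| %[mod p].
Proof.
move=> pr sp sA; pose G := <[s]>%G.
have pG : (p.-group G)%g.
  apply: (@pnat_dvd _ p); last by rewrite pnat_id.
  by rewrite -[#|_|]/(#[s]%g) order_dvdn sp.
have sk k x : x \in A -> (s ^+ k)%g x \in A.
  by elim: k x => [|k IH] x Ax; rewrite ?expg0 ?perm1 // expgS permM; apply/IH/sA.
have aG : [acts G, on A | 'P]%g.
  apply/fintype.subsetP => g /cycleP [k ->]; rewrite !inE /=; apply/fintype.subsetP => y Ay.
  by rewrite inE /= apermE sk.
rewrite (pgroup_fix_mod pG aG); congr (_ %% _)%N; apply: eq_card => x.
rewrite finset.in_setI [RHS]inE; congr (_ && _); apply/afixP/eqP => [H|H g /cycleP [k ->]].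
  by have := H s (cycle_id s).
by rewrite /= apermE; elim: k => [|k IH]; rewrite ?expg0 ?perm1 // expgS permM H.
Qed.

(** * Flexes and fixed points in orbits *)

Section FlexPoints.
Variable K : closedFieldType.
Variables (d : nat) (F : {mpoly K[3]}).
Hypotheses (d_gt3 : (3 < d)%N) (smF : smooth_plane_curve d F).
Implicit Types (p x P : 'rV[K]_3) (M N B : 'M[K]_3).

Let d_gt2 : (2 < d)%N. Proof. exact: ltnW. Qed.
Let d_gt1 : (1 < d)%N. Proof. exact: ltnW. Qed.
Let homF : F \is d.-homog. Proof. exact: curve_homog smF. Qed.

Local Notation lin := (lin F).
Local Notation linear_aut := (linear_aut F).

(** Vectors of [s] need not satisfy Q themselves; a proportional vector satisfying Q is chosen, once
    for each point of the plane. *)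
Lemma distinct_representatives (Q : 'rV[K]_3 -> Prop) (s : seq 'rV[K]_3) : (forall p, Q p -> p != 0) ->
  exists (N : nat) (pts : 'I_N -> 'rV[K]_3), [/\ forall i, Q (pts i), forall i j, collinear (pts i) (pts j) -> i = j &
    forall p, Q p -> (exists2 q : 'rV[K]_3, q \in s & q != 0 /\ collinear q p) -> exists i, collinear p (pts i)].
Proof.
move=> Q0; elim: s => [|q s [N [pts [Qp pinj pall]]]].
  by exists 0%N, (fun=> 0); split=> [[]|[]|p _ []] //.
case: (pselect (exists p, [/\ Q p, q != 0, collinear q p & forall i, ~ collinear p (pts i)])) => [[p [Qp0 q0 qp np]]|H].
  exists N.+1, (fun i => if unlift ord0 i is Some j then pts j else p); split.
  - by move=> i; case: unliftP.
  - move=> i j; case: unliftP => [i' ->|->]; case: unliftP => [j' ->|->] //.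
    + by move=> /pinj ->.
    + by move=> /collinear_sym /np.
    + by move=> /np.
  move=> x Qx [r]; rewrite inE => /orP[/eqP ->|rs] [r0 rx].
    by exists ord0; rewrite unlift_none; exact: collinear_trans_mid q0 (collinear_sym rx) qp.
  have [|i xi] := pall x Qx; first by exists r.
  by exists (lift ord0 i); rewrite liftK.
exists N, pts; split=> // x Qx [r]; rewrite inE => /orP[/eqP ->|rs] [r0 rx]; last by apply: pall => //; exists r.
apply: contrapT => /forallNP nx; apply: H; exists x; split=> //.
Qed.

(** Automorphisms act as permutations of this finite list of zeros of the Hessian on C, so orbits
    can be counted without knowing that Aut(C) is finite. *)
Lemma flex_points : ~ vanishes_on F (hessian F) ->
  exists (N : nat) (pts : 'I_N -> 'rV[K]_3), [/\ forall i, curve_points F (pts i),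
    forall i j, collinear (pts i) (pts j) -> i = j,
    forall M i, linear_aut M -> exists j, collinear (pts i *m M) (pts j) &
    forall p, curve_points F p -> (hessian F).[: p] = 0 -> exists i, collinear p (pts i)].
Proof.
move=> nh; have hh := hessian_homog homF.
have [s sE] := finite_zeros d_gt1 smF hh nh.
have [|N [pts [Qp pinj pall]]] := @distinct_representatives (fun p => curve_points F p /\ (hessian F).[: p] = 0) s.
  by move=> p [/curve_pointsP []].
have all p : curve_points F p -> (hessian F).[: p] = 0 -> exists i, collinear p (pts i).
  by move=> Cp hp; apply: pall => //; exact: sE.
exists N, pts; split=> //; first by move=> i; case: (Qp i).
move=> M i aM; have [Ci hi] := Qp i; apply: all; first exact: linear_aut_point.
exact: hessian_aut homF aM hi.
Qed.

Lemma collinear_mulmx x (y : 'rV[K]_3) M : collinear x y -> collinear (x *m M) (y *m M).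
Proof.
have [->|y0] := eqVneq y 0; first by move=> _ i j; rewrite mul0mx !mxE !mulr0.
by move=> /(collinear_scale_mid y0) [c ->]; rewrite -scalemxAl; apply: collinear_sym; exact: collinearZr.
Qed.

Section OrbitCount.
Variables (n N pr : nat) (pts : 'I_N -> 'rV[K]_3) (g : 'M[K]_3) (i0 : 'I_N).
Local Notation Gamma := (quasi_galois_group F n).
Hypotheses (Cpts : forall i, curve_points F (pts i)) (pinj : forall i j, collinear (pts i) (pts j) -> i = j).
Hypothesis pclosed : forall M i, linear_aut M -> exists j, collinear (pts i *m M) (pts j).
Hypotheses (pr_prime : prime pr) (ag : linear_aut g) (Gg : Gamma (lin g)).
Hypothesis g_pr : exists c, c != 0 /\ g ^+ pr = c%:M.
Hypothesis g_fix0 : collinear (pts i0 *m g) (pts i0).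
Hypothesis g_fix : forall i, collinear (pts i *m g) (pts i) ->
  exists B, [/\ linear_aut B, Gamma (lin B) & collinear (pts i0 *m B) (pts i)].
Hypothesis g_few : exists s : seq 'I_N, (size s < pr)%N /\ forall i, collinear (pts i *m g) (pts i) -> i \in s.

Let pts0 i : pts i != 0. Proof. by case/curve_pointsP: (Cpts i). Qed.
Let ptsM0 i M : linear_aut M -> pts i *m M != 0.
Proof. by move=> [uM _]; exact: mul_linear_forms_neq0. Qed.

Lemma point_perm M : linear_aut M -> exists s : {perm 'I_N}, forall i, collinear (pts i *m M) (pts (s i)).
Proof.
move=> aM; have [uM _] := aM; have /choice [f fE] i := pclosed i aM.
have finj : injective f.
  move=> i j e; apply: pinj; rewrite -[pts i](mulmxK uM) -[pts j](mulmxK uM); apply: collinear_mulmx.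
  apply: (collinear_trans_mid (pts0 (f i)) (fE i)); rewrite e; exact: collinear_sym.
by exists (perm finj) => i; rewrite permE.
Qed.

(** The image under M of the Gamma-orbit of i0; by normality of Gamma it is again a Gamma-orbit. *)
Definition in_orbit M i := exists B, [/\ linear_aut B, Gamma (lin B) & collinear (pts i0 *m B *m M) (pts i)].

Lemma orbit_fixed_points M : linear_aut M -> exists i, in_orbit M i /\ collinear (pts i *m g) (pts i).
Proof.
move=> aM; have [s sE] := point_perm ag; have [t tE] := point_perm aM.
have sk k i : collinear (pts i *m g ^+ k) (pts ((s ^+ k)%g i)).
  elim: k i => [|k IH] i; first by rewrite expr0 mulmx1 expg0 perm1 => a b; rewrite mulrC.
  rewrite exprS -mulmxE mulmxA expgS permM.
  apply: (collinear_trans_mid _ _ (IH (s i))); last exact/collinear_mulmx/sE.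
  apply: ptsM0; elim: k {IH} => [|k IH]; first by rewrite expr0; exact: linear_aut1.
  by rewrite exprS -mulmxE; exact: linear_autM.
have s1 : (s ^+ pr = 1)%g.
  apply/permP => i; rewrite perm1; apply/esym/pinj; have [c [c0 e]] := g_pr.
  have := sk pr i; rewrite e mul_mx_scalar => H.
  apply: (collinear_trans_mid _ _ H); last exact: collinearZr.
  by rewrite scaler_eq0 negb_or c0 pts0.
have sfix i : (s i == i) = `[< collinear (pts i *m g) (pts i) >].
  apply/eqP/asboolP => [{2}<-|H]; first exact: sE.
  apply: pinj; apply: (collinear_trans_mid _ _ H); first exact: ptsM0.
  exact: collinear_sym.
pose O L := [set i | `[< in_orbit L i >]].
have inO L i : reflect (in_orbit L i) (i \in O L) by rewrite inE; exact: asboolP.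
(* g preserves the translated orbit because its conjugate by L lies in Gamma. *)
have Os L i : linear_aut L -> i \in O L -> s i \in O L.
  move=> aL /inO [B [aB gB H]]; apply/inO; have aV := linear_autV aL; have [uL _] := aL.
  have gC := qg_conj d_gt3 smF ag aV Gg; rewrite invmxK in gC.
  have aC := conj_mx_aut ag aV; rewrite invmxK in aC.
  exists (B *m (L *m g *m invmx L)); split; [exact: linear_autM|exact: (qgM d_gt3 smF)|].
  rewrite -!mulmxA mulVmx // mulmx1 !mulmxA.
  apply: (collinear_trans_mid (ptsM0 i ag) _ (sE i)); exact: collinear_mulmx.
have eO : #|O 1%:M| = #|O M|.
  rewrite -(card_imset _ (@perm_inj _ t)); apply: eq_card => i; apply/imsetP/inO.
    move=> [j /inO [B [aB gB]]]; rewrite mulmx1 => H ->; exists B; split=> //.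
    by apply: (collinear_trans_mid (ptsM0 j aM) _ (tE j)); exact: collinear_mulmx.
  move=> [B [aB gB H]]; exists ((t^-1)%g i); last by rewrite permKV.
  apply/inO; exists B; split=> //; rewrite mulmx1; have [uM _] := aM.
  have := tE ((t^-1)%g i); rewrite permKV => H'.
  rewrite -[_ *m B](mulmxK uM) -[pts (_ i)](mulmxK uM); apply: collinear_mulmx.
  exact: (collinear_trans_mid (pts0 i) H (collinear_sym H')).
have fixO L : #|[set i in O L | s i == i]| != 0%N -> exists i, in_orbit L i /\ collinear (pts i *m g) (pts i).
  rewrite cards_eq0 => /set0Pn [i]; rewrite inE => /andP[/inO Oi]; rewrite sfix => /asboolP; by exists i.
apply: fixO; have m1 := fixed_points_mod pr_prime s1 (fun i => Os 1%:M i (linear_aut1 F)).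
have m2 := fixed_points_mod pr_prime s1 (fun i => Os M i aM).
apply/eqP => z; move: m1 m2; rewrite eO z mod0n => + e0; rewrite e0.
(* All fixed points of g lie in the orbit of i0. Their number is positive and less than [pr], hence
   nonzero modulo [pr], and the translated orbit has the same size modulo [pr]. *)
have -> : [set i in O 1%:M | s i == i] = [set i | s i == i].
  apply/setP => i; rewrite !inE; case si: (s i == i); rewrite ?andbF // andbT; apply/asboolP.
  move: si; rewrite sfix => /asboolP /g_fix [B [aB gB H]]; exists B; split=> //.
  by rewrite mulmx1.
have [l [lp lE]] := g_few; set A := [set i | s i == i].
have A0 : (0 < #|A|)%N by apply/card_gt0P; exists i0; rewrite inE sfix; apply/asboolP.
have Al : (#|A| < pr)%N.
  apply: leq_ltn_trans lp; apply: leq_trans (card_size l); apply/subset_leq_card/fintype.subsetP => i.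
  by rewrite inE sfix => /asboolP /lE.
by rewrite modn_small // => A1; move: A0; rewrite -A1.
Qed.

(** The translated orbit contains a fixed point of g, which lies in the original orbit; normality
    turns the two descriptions of this point into an element of Gamma that brings M back to the
    stabilizer of i0. *)
Lemma orbit_transfer M : linear_aut M ->
  exists B, [/\ linear_aut B, Gamma (lin B) & collinear (pts i0 *m (M *m B)) (pts i0)].
Proof.
move=> aM; have [i [[B [aB gB H]] /g_fix [B' [aB' gB' H']]]] := orbit_fixed_points aM.
have [uM _] := aM; have [uB' _] := aB'; have aC := conj_mx_aut aB aM; have aV := linear_autV aB'.
exists ((invmx M *m B *m M) *m invmx B'); split; first exact: linear_autM.
  by apply: (qgM d_gt3 smF) => //; [exact: (qg_conj d_gt3 smF)|exact: (qgV d_gt3 smF)].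
have -> : M *m (invmx M *m B *m M *m invmx B') = B *m M *m invmx B' by rewrite !mulmxA mulmxV // mul1mx.
rewrite mulmxA -[pts i0 in X in collinear _ X](mulmxK uB'); apply: collinear_mulmx; rewrite mulmxA.
exact: (collinear_trans_mid (pts0 i) H (collinear_sym H')).
Qed.

End OrbitCount.

End FlexPoints.

(** * Criteria for Aut(C) = G_n(C) and for |G[P]| = 2 *)

Section Criteria.
Variable K : closedFieldType.
Variables (d : nat) (F : {mpoly K[3]}).
Hypotheses (d_gt3 : (3 < d)%N) (smF : smooth_plane_curve d F).
Implicit Types (p x P : 'rV[K]_3) (M N B : 'M[K]_3).

Let d_gt2 : (2 < d)%N. Proof. exact: ltnW. Qed.
Let d_gt1 : (1 < d)%N. Proof. exact: ltnW. Qed.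
Let homF : F \is d.-homog. Proof. exact: curve_homog smF. Qed.

Local Notation lin := (lin F).
Local Notation linear_aut := (linear_aut F).

(** Every automorphism M becomes, after multiplication by an element of Gamma, a stabilizer of the
    flex e, and stabilizers are in Gamma by hypothesis. The list [vs] serves only to bound the
    number of points of C fixed by g. *)
Theorem aut_is_quasi_galois n pr (g : 'M[K]_3) (e : 'rV[K]_3) (vs : seq 'rV[K]_3) :
  ~ vanishes_on F (hessian F) -> curve_points F e -> (hessian F).[: e] = 0 -> prime pr -> linear_aut g ->
  quasi_galois_group F n (lin g) -> (exists c, c != 0 /\ g ^+ pr = c%:M) -> collinear (e *m g) e ->
  (forall x, curve_points F x -> collinear (x *m g) x ->
     exists B, [/\ linear_aut B, quasi_galois_group F n (lin B) & collinear (e *m B) x]) ->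
  (size vs < pr)%N ->
  (forall x, curve_points F x -> collinear (x *m g) x -> exists2 v : 'rV[K]_3, v \in vs & v != 0 /\ collinear x v) ->
  (forall M, linear_aut M -> collinear (e *m M) e -> quasi_galois_group F n (lin M)) ->
  curve_Aut F = quasi_galois_group F n.
Proof.
move=> nh Ce he pr_prime ag Gg g_pr g_fix0 g_fix vs_lt vsE stab.
have [N [pts [Cpts pinj pclosed pall]]] := flex_points d_gt3 smF nh.
have [i0 ei0] := pall e Ce he.
have e0 : e != 0 by case/curve_pointsP: Ce.
have p0 i : pts i != 0 by case/curve_pointsP: (Cpts i).
have [c c0 ec] := collinear_scale (p0 i0) e0 (collinear_sym ei0).
have scale_col (b : K) (x y : 'rV[K]_3) : b != 0 -> collinear (b *: x) y -> collinear x y.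
  by move=> b0 H; apply: collinear_sym; apply: (collinear_unscale b0); exact: collinear_sym.
have [l [lsz lE]] : exists l : seq 'I_N, (size l <= size vs)%N /\
    forall i, (exists2 v : 'rV[K]_3, v \in vs & v != 0 /\ collinear (pts i) v) -> i \in l.
  elim: (vs) => [|v s [l [lsz lE]]]; first by exists [::]; split=> // i [].
  case: (pselect (v != 0 /\ exists i, collinear (pts i) v)) => [[v0 [i vi]]|H].
    exists (i :: l); split=> // j [w]; rewrite !inE => /orP[/eqP ->|ws] [w0 jw]; last by rewrite lE ?orbT //; exists w.
    by rewrite (pinj j i) ?eqxx //; exact: (collinear_trans_mid v0 jw (collinear_sym vi)).
  exists l; split; first exact: leqW.
  move=> j [w]; rewrite inE => /orP[/eqP ->|ws] [w0 jw]; last by apply: lE; exists w.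
  by case: H; split=> //; exists j.
rewrite -(BirE d_gt3 smF); apply/seteqP; split=> t; last exact: (qg_Bir d_gt3 smF).
move=> /(Bir_linear d_gt3 smF) [M aM ->].
have [|||B [aB gB]] := @orbit_transfer K d F d_gt3 smF n N pr pts g i0 Cpts pinj pclosed pr_prime ag Gg g_pr _ _ _ M aM.
- by move: g_fix0; rewrite ec -scalemxAl => /(scale_col _ _ _ c0)/(collinear_unscale c0).
- move=> i gi; have [B [aB gB H]] := g_fix _ (Cpts i) gi; exists B; split=> //.
  by apply: (scale_col c) => //; rewrite scalemxAl -ec.
- exists l; split; first exact: leq_ltn_trans lsz vs_lt.
  by move=> i gi; apply: lE; apply: vsE.
have aMB := linear_autM aM aB; have [uB _] := aB.
move=> H; have gMB : quasi_galois_group F n (lin (M *m B)).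
  have scale2 (b : K) (x y : 'rV[K]_3) : collinear x y -> collinear (b *: x) (b *: y).
    by move=> h i j; rewrite !mxE mulrACA h; ring.
  by apply: stab => //; rewrite ec -scalemxAl; exact: scale2.
rewrite -[M](mulmxK uB); apply: (qgM d_gt3 smF) => //; first exact: linear_autV.
exact: (qgV d_gt3 smF).
Qed.

Lemma dgradDv G p u v : dgrad G p (u + v) = dgrad G p u + dgrad G p v.
Proof. by rewrite /dgrad -big_split; apply: eq_bigr => i _; rewrite mxE mulrDr. Qed.

Lemma card_two (T : Type) (A : set T) (a b : T) : a <> b -> A = [set a; b]%classic -> (A #= `I_2)%card.
Proof.
move=> ab ->.
have -> : ([set a; b] = (fun k : nat => if k is 0 then a else b) @` `I_2)%classic.
  apply/seteqP; split=> x /=; first by move=> [->|->]; [exists 0%N|exists 1%N].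
  by move=> [[|[|k]] //= _ <-]; [left|right].
by apply: inj_card_eq => -[|[|i]] [|[|j]] //=; rewrite !inE //= => _ _ e; case: ab.
Qed.

Lemma mul_col_row x (m : 'cV[K]_3) P : x *m (m *m P) = (x *m m) 0 0 *: P.
Proof. by rewrite mulmxA {1}[x *m m]mx11_scalar mul_scalar_mx. Qed.

(* For P off the curve, an element of G[P] fixes the polar line of P pointwise and is determined by its ratio of
   eigenvalues; a nonzero quadratic term on that line forces the ratio to be 1 or -1. *)
Lemma galois_card2 P v s (l : 'cV[K]_3) : P != 0 -> F.[: P] != 0 -> d%:R != 0 :> K -> dgrad F P v = 0 ->
  (v *m hess_at F P *m v^T) 0 0 != 0 -> linear_aut (s%:M + l *m P) -> l != 0 ->
  (galois_at F P #= `I_2)%card.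
Proof.
move=> P0 FP dn dv Qv aI l0.
have key M r (m : 'cV[K]_3) : linear_aut M -> M = r%:M + m *m P ->
    [/\ r != 0, (r + (P *m m) 0 0) ^+ 2 = r ^+ 2 &
      forall u, (u *m m) 0 0 * (d%:R * F.[: P]) = (P *m m) 0 0 * dgrad F P u].
  move=> [uM [c c0 eM]] eqM; set a := r + (P *m m) 0 0.
  have xM (x : 'rV[K]_3) : x *m M = r *: x + (x *m m) 0 0 *: P.
    by rewrite eqM mulmxDr mul_mx_scalar mul_col_row.
  have PM : P *m M = a *: P by rewrite xM -scalerDl.
  have a0 : a != 0 by apply: contraTneq P0 => a0; rewrite -[P](mulmxK uM) PM a0 scale0r mul0mx eqxx.
  have ca : c = a ^+ d.
    have := eval_lsub M F P; rewrite eM mevalZ PM (homog_evalZ _ _ homF); exact: mulIf FP _ _.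
  have dM u : dgrad F P (u *m M) = a * dgrad F P u.
    have := dgrad_lsub M F P u; rewrite eM dgradZ PM (dgrad_scale _ _ _ homF) ca.
    rewrite -{1}[d](prednK (ltnW d_gt1)) exprS -mulrA mulrCA => /(mulfI (expf_neq0 _ a0)) ->.
    by [].
  have mE u : (u *m m) 0 0 * (d%:R * F.[: P]) = (P *m m) 0 0 * dgrad F P u.
    have := dM u; rewrite xM dgradDv !dgradZv (euler_formula P homF) /a mulrDl => /addrI.
    by [].
  have vm : (v *m m) 0 0 = 0.
    by apply/eqP; have /eqP := mE v; rewrite dv mulr0 !mulf_eq0 (negPf dn) (negPf FP) !orbF.
  have vM : v *m M = r *: v by rewrite xM vm scale0r addr0.
  (* The quadratic form of F at P is compared at v before and after M. P has eigenvalue a, v has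
     eigenvalue r, and c = a^d, so a nonzero value at v gives a^2 = r^2. *)
  have e2 : c * (v *m hess_at F P *m v^T) 0 0 = a ^+ d.-2 * (r ^+ 2 * (v *m hess_at F P *m v^T) 0 0).
    have E := hess_at_lsub M P homF; rewrite eM hess_atZ PM in E.
    have Ha : hess_at F (a *: P) = a ^+ d.-2 *: hess_at F P.
      by apply/matrixP => i j; rewrite !mxE; apply: homog_evalZ; do 2!apply: dhomog_mderiv.
    have sc (b : K) (A : 'M[K]_1) : (b *: A) 0 0 = b * A 0 0 by rewrite mxE.
    have := congr1 (fun A => (v *m A *m v^T) 0 0) E; rewrite Ha !(=^~ scalemxAr, =^~ scalemxAl) !sc => ->.
    have -> : v *m (M *m hess_at F P *m M^T) *m v^T = v *m M *m hess_at F P *m (v *m M)^T.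
      by rewrite trmx_mul !mulmxA.
    by rewrite vM linearZ /= !(=^~ scalemxAr, =^~ scalemxAl) !sc expr2 !mulrA.
  split=> //.
    apply: contraTneq a0 => r0; move: e2; rewrite r0 expr0n /= mul0r mulr0 => /eqP.
    by rewrite mulf_eq0 (negPf c0) (negPf Qv).
  apply: (mulIf Qv); apply: (mulfI (expf_neq0 d.-2 a0)); rewrite -e2 ca mulrA -exprD.
  by congr (_ ^+ _ * _); move: d_gt3; clear; lia.
have [s0 es sl] := key _ s l aI erefl.
have dF0 : d%:R * F.[: P] != 0 by rewrite mulf_neq0.
have col_eq (m m' : 'cV[K]_3) : (forall u : 'rV[K]_3, (u *m m) 0 0 = (u *m m') 0 0) -> m = m'.
  by move=> H; apply/matrixP => i j; have := H (delta_mx 0 i); rewrite ord1 -!rowE !mxE.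
have m0 (m : 'cV[K]_3) : (forall u, (u *m m) 0 0 * (d%:R * F.[: P]) = (P *m m) 0 0 * dgrad F P u) ->
    (P *m m) 0 0 = 0 -> m = 0.
  move=> H e0; apply: col_eq => u; apply: (mulIf dF0); rewrite H e0 mulmx0 mxE !mul0r //.
have eP r (m : 'cV[K]_3) : (r + (P *m m) 0 0) ^+ 2 = r ^+ 2 -> (P *m m) 0 0 = 0 \/ (P *m m) 0 0 = - (2%:R * r).
  move=> e2; have : (P *m m) 0 0 * ((P *m m) 0 0 + 2%:R * r) = 0.
    by rewrite -[RHS](subrr (r ^+ 2)) -{1}e2; ring.
  by move/eqP; rewrite mulf_eq0 addr_eq0 => /orP[/eqP|/eqP]; [left|right].
have Pl : (P *m l) 0 0 != 0 by apply: contraNneq l0 => /(m0 l sl) ->.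
have Pls : (P *m l) 0 0 = - (2%:R * s) by case: (eP s l es) => // e0; rewrite e0 eqxx in Pl.
have s2 : 2%:R * s != 0 by rewrite -oppr_eq0 -Pls.
apply: (@card_two _ _ (lin 1%:M) (lin (s%:M + l *m P))).
  move=> /(lin_eq d_gt3 smF (linear_aut1 F) aI) [c c0 e1].
  have xM (x : 'rV[K]_3) : x = c *: (s *: x + (x *m l) 0 0 *: P).
    by rewrite -[LHS]mulmx1 e1 -scalemxAr mulmxDr mul_mx_scalar mul_col_row.
  have vl : (v *m l) 0 0 = 0 by apply: (mulIf dF0); rewrite sl dv mulr0 mul0r.
  have v0 : v != 0 by apply: contraNneq Qv => ->; rewrite !mul0mx mxE.
  have cs : c * s = 1.
    have := xM v; rewrite vl scale0r addr0 scalerA => /eqP.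
    by rewrite eq_sym -subr_eq0 -{2}[v]scale1r -scalerBl scaler_eq0 (negPf v0) orbF subr_eq0 => /eqP.
  have := xM P; rewrite Pls -scalerDl scalerA => /eqP.
  rewrite eq_sym -subr_eq0 -{2}[P]scale1r -scalerBl scaler_eq0 (negPf P0) orbF => /eqP.
  have -> : c * (s - 2%:R * s) - 1 = - (c * (2%:R * s)) - (1 - c * s) by ring.
  by rewrite cs subrr subr0 => /eqP; rewrite oppr_eq0 mulf_eq0 (negPf c0) (negPf s2).
apply/seteqP; split=> t /=; last first.
  move=> [->|->].
    exact/(galois_lin d_gt3 smF P0 (linear_aut1 F))/central1.
  by apply/(galois_lin d_gt3 smF P0 aI); exists s, l.
move=> /(galois_linear d_gt3 smF P0) [N [aN -> [r [m eN]]]].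
have [r0 er rm] := key N r m aN eN; case: (eP r m er) => Pm.
  left; rewrite eN (m0 m rm Pm) mul0mx addr0 -scalemx1 (lin_scale d_gt3 smF r0) //; exact: linear_aut1.
(* Both l and m are proportional to the polar form of P, so N is a multiple of the given matrix as
   soon as its eigenvalues have ratio -1. *)
right; have e1 : N = (r / s) *: (s%:M + l *m P).
  rewrite eN scalerDr scale_scalar_mx divfK // scalemxAl; congr (_ + _ *m _); apply: col_eq => u.
  apply: (mulIf dF0); rewrite rm Pm -scalemxAr mxE -mulrA sl Pls.
  by rewrite mulrA; congr (_ * _); field.
by rewrite e1 (lin_scale d_gt3 smF) // mulf_neq0 // invr_eq0.
Qed.

End Criteria.

(** * The Wiman sextic and the Klein quartic *)

Section ExplicitForms.
Variable K : closedFieldType.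
Implicit Types (G : {mpoly K[3]}) (p : 'rV[K]_3).

Lemma ord3_0 : (0 : 'I_3) = ord0. Proof. exact: val_inj. Qed.
Lemma ord3_1 : (1 : 'I_3) = i1. Proof. exact: val_inj. Qed.
Lemma ord3_2 : (2%:R : 'I_3) = i2. Proof. exact: val_inj. Qed.

Lemma mderiv_nat n (i : 'I_3) : (n%:R : {mpoly K[3]})^`M(i) = 0.
Proof. by rewrite -[n%:R]mpolyC_nat mderivC. Qed.

Lemma mderiv_exp G n (i : 'I_3) : (G ^+ n.+1)^`M(i) = n.+1%:R * G ^+ n * G^`M(i).
Proof.
elim: n => [|n IH]; first by rewrite expr1 expr0 !mul1r.
by rewrite exprS mderivM IH -[n.+2%:R]natr1 exprS; ring.
Qed.

Lemma mderiv_var (i j : 'I_3) : ('X_i : {mpoly K[3]})^`M(j) = (i == j)%:R.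
Proof. exact: mderivXi. Qed.

Definition mderivE := (mderivD, mderivB, mderivN, mderivM, mderiv_exp, mderiv_nat, mderiv_var).

Lemma eval_nat n p : (n%:R : {mpoly K[3]}).[: p] = n%:R.
Proof. exact: rmorph_nat. Qed.

Lemma eval_exp G n p : (G ^+ n).[: p] = G.[: p] ^+ n.
Proof. exact: rmorphXn. Qed.

Definition evalE := (eval_nat, eval_exp, mevalXU, mevalB, mevalD, mevalM).

Lemma dhomog_var (i : 'I_3) n : ('X_i : {mpoly K[3]}) ^+ n \is n.-homog.
Proof.
elim: n => [|n IH]; first by rewrite expr0 dhomog1.
by rewrite exprS; apply: (dhomogM (d := 1)) => //; rewrite dhomogX /= mdeg1.
Qed.

Lemma dhomog_natM n m G : G \is m.-homog -> n%:R * G \is m.-homog.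
Proof. by rewrite mulr_natl; exact: rpredMn. Qed.

Lemma nth_root (n : nat) (c : K) : (0 < n)%N -> exists a, a ^+ n = c.
Proof.
case: n => // n _; have [a ea] := @solve_monicpoly K n.+1 (fun i => if i is 0 then c else 0) isT.
exists a; rewrite ea big_ord_recl big1 ?addr0 ?expr0 ?mulr1 // => i _ /=; exact: mul0r.
Qed.

Lemma mul_diag (x : 'rV[K]_3) a b c : x *m diag_mx (pt a b c) = pt (x 0 ord0 * a) (x 0 i1 * b) (x 0 i2 * c).
Proof. by rewrite mul_mx_diag; apply: row3P; rewrite !ptE !mxE. Qed.

Lemma mul_row3 (x : 'rV[K]_3) (M : 'M[K]_3) j : (x *m M) 0 j = x 0 ord0 * M ord0 j + x 0 i1 * M i1 j + x 0 i2 * M i2 j.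
Proof. by rewrite mxE sum3. Qed.

Lemma invmx_eq (M N : 'M[K]_3) : M *m N = 1%:M -> M \in unitmx /\ invmx M = N.
Proof. by move=> e; have [uM _] := mulmx1_unit e; split=> //; rewrite -[LHS]mulmx1 -e mulKmx. Qed.

Lemma linear_aut_eval d F M N c : F \is d.-homog -> M *m N = 1%:M -> c != 0 ->
  (forall x : 'rV[K]_3, F.[: x *m M] = c * F.[: x]) -> linear_aut F M.
Proof.
move=> hF e c0 H; have [uM _] := invmx_eq e; split=> //; exists c => //.
apply: (form_eq (lsub_homog _ hF)); first exact: dhomogZ.
by move=> x; rewrite eval_lsub mevalZ H.
Qed.

Lemma mx3_eq (M N : 'M[K]_3) : (forall x y z : K, pt x y z *m M = pt x y z *m N) -> M = N.
Proof.
by move=> H; apply/row_matrixP => i; rewrite !rowE [delta_mx _ _]pt_eta H.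
Qed.

Lemma pt_neq0 (x y z : K) i : pt x y z 0 i != 0 -> pt x y z != 0.
Proof. by apply: contraNneq => ->; rewrite mxE. Qed.

Lemma scale_row a (x : 'rV[K]_3) j : (a *: x) 0 j = a * x 0 j.
Proof. by rewrite mxE. Qed.

End ExplicitForms.

(** * Smoothness of the Wiman sextic *)

Section Wiman.
Variable K : closedFieldType.
Hypothesis char0 : [pchar K] =i pred0.
Local Notation X := ('X_ord0 : {mpoly K[3]}).
Local Notation Y := ('X_i1 : {mpoly K[3]}).
Local Notation Z := ('X_i2 : {mpoly K[3]}).
Local Notation F := (Wiman_sextic K).
Implicit Types (p : 'rV[K]_3) (M : 'M[K]_3) (x y z : K).

Lemma natr_neq0 n : (n.+1%:R : K) != 0.
Proof. by move/pcharf0P: char0 => ->. Qed.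

Lemma WimanE : F = 10%:R * (X ^+ 3 * Y ^+ 3) + 9%:R * ((X ^+ 5 + Y ^+ 5) * Z ^+ 1)
  - 45%:R * (X ^+ 2 * Y ^+ 2 * Z ^+ 2) - 135%:R * (X ^+ 1 * Y ^+ 1 * Z ^+ 4) + 27%:R * Z ^+ 6.
Proof. by rewrite /Wiman_sextic ord3_0 ord3_1 ord3_2; ring. Qed.

Lemma Wiman_homog : F \is 6.-homog.
Proof.
rewrite WimanE; apply: rpredD; [apply: rpredB; [apply: rpredB; [apply: rpredD|]|]|]; apply: dhomog_natM.
- by apply: (dhomogM (d := 3)); exact: dhomog_var.
- by apply: (dhomogM (d := 5)); [apply: rpredD; exact: dhomog_var|exact: dhomog_var].
- by apply: (dhomogM (d := 4)); [apply: (dhomogM (d := 2))|]; exact: dhomog_var.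
- by apply: (dhomogM (d := 2)); [apply: (dhomogM (d := 1))|]; exact: dhomog_var.
exact: dhomog_var.
Qed.

Lemma Wiman_d0 : F^`M(ord0) = 30%:R * X ^+ 2 * Y ^+ 3 + 45%:R * X ^+ 4 * Z - 90%:R * X * Y ^+ 2 * Z ^+ 2 - 135%:R * Y * Z ^+ 4.
Proof. by rewrite WimanE !mderivE /=; ring. Qed.

Lemma Wiman_d1 : F^`M(i1) = 30%:R * X ^+ 3 * Y ^+ 2 + 45%:R * Y ^+ 4 * Z - 90%:R * X ^+ 2 * Y * Z ^+ 2 - 135%:R * X * Z ^+ 4.
Proof. by rewrite WimanE !mderivE /=; ring. Qed.

Lemma Wiman_d2 : F^`M(i2) = 9%:R * (X ^+ 5 + Y ^+ 5) - 90%:R * X ^+ 2 * Y ^+ 2 * Z - 540%:R * X * Y * Z ^+ 3 + 162%:R * Z ^+ 5.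
Proof. by rewrite WimanE !mderivE /=; ring. Qed.

Lemma Wiman_eval p : F.[: p] = 10%:R * (p 0 ord0 ^+ 3 * p 0 i1 ^+ 3) + 9%:R * ((p 0 ord0 ^+ 5 + p 0 i1 ^+ 5) * p 0 i2)
  - 45%:R * (p 0 ord0 ^+ 2 * p 0 i1 ^+ 2 * p 0 i2 ^+ 2) - 135%:R * (p 0 ord0 * p 0 i1 * p 0 i2 ^+ 4) + 27%:R * p 0 i2 ^+ 6.
Proof. by rewrite WimanE !evalE expr1; ring. Qed.

Lemma Wiman_dgrad p v : dgrad F p v =
  15%:R * (2%:R * p 0 ord0 ^+ 2 * p 0 i1 ^+ 3 + 3%:R * p 0 ord0 ^+ 4 * p 0 i2
    - 6%:R * p 0 ord0 * p 0 i1 ^+ 2 * p 0 i2 ^+ 2 - 9%:R * p 0 i1 * p 0 i2 ^+ 4) * v 0 ord0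
  + 15%:R * (2%:R * p 0 ord0 ^+ 3 * p 0 i1 ^+ 2 + 3%:R * p 0 i1 ^+ 4 * p 0 i2
    - 6%:R * p 0 ord0 ^+ 2 * p 0 i1 * p 0 i2 ^+ 2 - 9%:R * p 0 ord0 * p 0 i2 ^+ 4) * v 0 i1
  + 9%:R * (p 0 ord0 ^+ 5 + p 0 i1 ^+ 5 - 10%:R * p 0 ord0 ^+ 2 * p 0 i1 ^+ 2 * p 0 i2
    - 60%:R * p 0 ord0 * p 0 i1 * p 0 i2 ^+ 3 + 18%:R * p 0 i2 ^+ 5) * v 0 i2.
Proof. by rewrite /dgrad sum3 Wiman_d0 Wiman_d1 Wiman_d2 !evalE; ring. Qed.

Lemma mul_nat_eq0 n (a : K) : n.+1%:R * a = 0 -> a = 0.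
Proof. by move/eqP; rewrite mulf_eq0 (negPf (natr_neq0 n)) => /eqP. Qed.

Lemma Wiman_partials x y z :
  2%:R * x ^+ 2 * y ^+ 3 + 3%:R * x ^+ 4 * z - 6%:R * x * y ^+ 2 * z ^+ 2 - 9%:R * y * z ^+ 4 = 0 ->
  2%:R * x ^+ 3 * y ^+ 2 + 3%:R * y ^+ 4 * z - 6%:R * x ^+ 2 * y * z ^+ 2 - 9%:R * x * z ^+ 4 = 0 ->
  x ^+ 5 + y ^+ 5 - 10%:R * x ^+ 2 * y ^+ 2 * z - 60%:R * x * y * z ^+ 3 + 18%:R * z ^+ 5 = 0 ->
  [/\ x = 0, y = 0 & z = 0].
Proof.
move=> A B C; have [z0|z0] := eqVneq z 0.
  subst z; have : 2%:R * (x ^+ 2 * y ^+ 3) = 0 by rewrite -[RHS]A; ring.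
  move/mul_nat_eq0/eqP; rewrite mulf_eq0 !expf_eq0 /= => xy.
  have : x ^+ 5 + y ^+ 5 = 0 by rewrite -[RHS]C; ring.
  by case/orP: xy => /eqP ->; rewrite expr0n /= ?add0r ?addr0 => /eqP; rewrite expf_eq0 /= => /eqP ->.
exfalso; pose u := x / z; pose v := y / z.
have A' : 2%:R * u ^+ 2 * v ^+ 3 + 3%:R * u ^+ 4 - 6%:R * u * v ^+ 2 - 9%:R * v = 0.
  by apply: (mulfI (expf_neq0 5 z0)); rewrite mulr0 -A /u /v; field.
have B' : 2%:R * u ^+ 3 * v ^+ 2 + 3%:R * v ^+ 4 - 6%:R * u ^+ 2 * v - 9%:R * u = 0.
  by apply: (mulfI (expf_neq0 5 z0)); rewrite mulr0 -B /u /v; field.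
have C' : u ^+ 5 + v ^+ 5 - 10%:R * u ^+ 2 * v ^+ 2 - 60%:R * u * v + 18%:R = 0.
  by apply: (mulfI (expf_neq0 5 z0)); rewrite mulr0 -C /u /v; field.
clearbody u v; move: A' B' C' => {A B C} A B C.
(* u times the first equation minus v times the second cancels all mixed terms. The system then
   becomes two equations in w = u v alone: a cubic, and one of degree 5 from w^5 = u^10. *)
have uv : u ^+ 5 = v ^+ 5.
  apply/subr0_eq/(@mul_nat_eq0 2).
  transitivity (u * (2%:R * u ^+ 2 * v ^+ 3 + 3%:R * u ^+ 4 - 6%:R * u * v ^+ 2 - 9%:R * v)
    - v * (2%:R * u ^+ 3 * v ^+ 2 + 3%:R * v ^+ 4 - 6%:R * u ^+ 2 * v - 9%:R * u)); first by ring.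
  by rewrite A B; ring.
pose w := u * v.
have tE : u ^+ 5 = 5%:R * w ^+ 2 + 30%:R * w - 9%:R.
  apply/subr0_eq/(@mul_nat_eq0 1); rewrite -[RHS]C -uv /w; ring.
have f0 : 2%:R * w ^+ 3 + 9%:R * w ^+ 2 + 81%:R * w - 27%:R = 0.
  have E : 2%:R * w ^+ 3 + 3%:R * u ^+ 5 - 6%:R * w ^+ 2 - 9%:R * w = 0.
    by rewrite -[RHS](mulr0 u) -A /w; ring.
  by rewrite -[RHS]E tE; ring.
have g0 : w ^+ 5 - (5%:R * w ^+ 2 + 30%:R * w - 9%:R) ^+ 2 = 0.
  by rewrite -tE /w exprMn -uv; ring.
(* A Bezout certificate: the two polynomials in w generate an ideal containing 2 * 3^7 * 5^2, which
   is nonzero in characteristic 0. Large coefficients are split by thousands to keep the numerals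
   small. *)
have : 2%:R * 3%:R ^+ 7 * 5%:R ^+ 2 =
   (953%:R * w ^+ 4 - (23%:R * 1000%:R + 519%:R) * w ^+ 3 - (293%:R * 1000%:R + 451%:R) * w ^+ 2
     - (866%:R * 1000%:R + 178%:R) * w + (236%:R * 1000%:R + 385%:R)) * (2%:R * w ^+ 3 + 9%:R * w ^+ 2 + 81%:R * w - 27%:R)
   + (- (1906%:R) * w ^+ 2 - (9%:R * 1000%:R + 189%:R) * w - (80%:R * 1000%:R + 145%:R))
     * (w ^+ 5 - (5%:R * w ^+ 2 + 30%:R * w - 9%:R) ^+ 2) by ring.
rewrite f0 g0 !mulr0 addr0 => /eqP.
by rewrite !(expf_eq0, mulf_eq0) /= (negPf (natr_neq0 1)) (negPf (natr_neq0 2)) (negPf (natr_neq0 4)).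
Qed.

Lemma Wiman_smooth : smooth_plane_curve 6 F.
Proof.
split=> [|x /curve_pointsP [x0 _]]; first exact: Wiman_homog.
apply: contrapT => /forallNP H.
have dg v : dgrad F x v = 0.
  by rewrite /dgrad big1 // => i _; have /negP/negPn/eqP -> := H i; rewrite mul0r.
move/eqP: x0; apply; move: (dg (pt 1 0 0)) (dg (pt 0 1 0)) (dg (pt 0 0 1)).
rewrite !Wiman_dgrad !ptE !(mulr1, mulr0, addr0, add0r) => /mul_nat_eq0 A /mul_nat_eq0 B /mul_nat_eq0 C.
have [e0 e1 e2] := Wiman_partials A B C.
by apply: row3P; rewrite mxE.
Qed.

End Wiman.

(** * Smoothness and Hessian of the Klein quartic *)

Section Klein.
Variable K : closedFieldType.
Hypothesis char0 : [pchar K] =i pred0.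
Local Notation X := ('X_ord0 : {mpoly K[3]}).
Local Notation Y := ('X_i1 : {mpoly K[3]}).
Local Notation Z := ('X_i2 : {mpoly K[3]}).
Local Notation F := (Klein_quartic K).
Local Notation Gamma := (quasi_galois_group F 2).
Implicit Types (p v : 'rV[K]_3) (M : 'M[K]_3) (x y : K).

Let n0 n : (n.+1%:R : K) != 0. Proof. exact: natr_neq0. Qed.

Lemma KleinE : F = X ^+ 3 * Y ^+ 1 + Y ^+ 3 * Z ^+ 1 + Z ^+ 3 * X ^+ 1.
Proof. by rewrite /Klein_quartic ord3_0 ord3_1 ord3_2. Qed.

Lemma Klein_homog : F \is 4.-homog.
Proof. by rewrite KleinE; do ![apply: rpredD]; apply: (dhomogM (d := 3)); exact: dhomog_var. Qed.

Lemma Klein_d0 : F^`M(ord0) = 3%:R * X ^+ 2 * Y + Z ^+ 3.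
Proof. by rewrite KleinE !mderivE /=; ring. Qed.

Lemma Klein_d1 : F^`M(i1) = X ^+ 3 + 3%:R * Y ^+ 2 * Z.
Proof. by rewrite KleinE !mderivE /=; ring. Qed.

Lemma Klein_d2 : F^`M(i2) = Y ^+ 3 + 3%:R * Z ^+ 2 * X.
Proof. by rewrite KleinE !mderivE /=; ring. Qed.

Lemma Klein_eval p : F.[: p] = p 0 ord0 ^+ 3 * p 0 i1 + p 0 i1 ^+ 3 * p 0 i2 + p 0 i2 ^+ 3 * p 0 ord0.
Proof. by rewrite KleinE !evalE !expr1. Qed.

Lemma Klein_dgrad p v : dgrad F p v =
  (3%:R * p 0 ord0 ^+ 2 * p 0 i1 + p 0 i2 ^+ 3) * v 0 ord0
  + (p 0 ord0 ^+ 3 + 3%:R * p 0 i1 ^+ 2 * p 0 i2) * v 0 i1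
  + (p 0 i1 ^+ 3 + 3%:R * p 0 i2 ^+ 2 * p 0 ord0) * v 0 i2.
Proof. by rewrite /dgrad sum3 Klein_d0 Klein_d1 Klein_d2 !evalE. Qed.

Lemma Klein_smooth : smooth_plane_curve 4 F.
Proof.
split=> [|p /curve_pointsP [p0 _]]; first exact: Klein_homog.
apply: contrapT => /forallNP H.
have dg v : dgrad F p v = 0.
  by rewrite /dgrad big1 // => i _; have /negP/negPn/eqP -> := H i; rewrite mul0r.
move/eqP: p0; apply; move: (dg (pt 1 0 0)) (dg (pt 0 1 0)) (dg (pt 0 0 1)).
rewrite !Klein_dgrad !ptE !(mulr1, mulr0, addr0, add0r); rewrite (pt_eta p) !ptE.
move: (p 0 ord0) (p 0 i1) (p 0 i2) => x y z A B C {p dg H}.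
have xy : x ^+ 3 * y = 0.
  apply: (mul_nat_eq0 char0 (n := 27)).
  (* This combination of the partial derivatives equals 28 x^3 y. *)
  transitivity (9%:R * (x * (3%:R * x ^+ 2 * y + z ^+ 3)) + y * (x ^+ 3 + 3%:R * y ^+ 2 * z)
    - 3%:R * (z * (y ^+ 3 + 3%:R * z ^+ 2 * x))); first by ring.
  by rewrite A B C; ring.
have e x' : x' ^+ 3 = 0 -> x' = 0 by move/eqP; rewrite expf_eq0 /= => /eqP.
have z0 : z = 0.
  apply: e; rewrite -[RHS]A; move/eqP: xy; rewrite mulf_eq0 expf_eq0 /= => /orP[] /eqP ->; ring.
have y0 : y = 0 by apply: e; rewrite -[RHS]C z0; ring.
have x0 : x = 0 by apply: e; rewrite -[RHS]B z0; ring.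
by apply: row3P; rewrite !ptE mxE.
Qed.

Let d_gt3 : (3 < 4)%N. Proof. by []. Qed.
Let smF := Klein_smooth.

Lemma Klein_hess00 p : hess_at F p ord0 ord0 = 6%:R * p 0 ord0 * p 0 i1.
Proof. by rewrite mxE Klein_d0 !mderivE /= !evalE; ring. Qed.
Lemma Klein_hess01 p : hess_at F p ord0 i1 = 3%:R * p 0 ord0 ^+ 2.
Proof. by rewrite mxE Klein_d0 !mderivE /= !evalE; ring. Qed.
Lemma Klein_hess02 p : hess_at F p ord0 i2 = 3%:R * p 0 i2 ^+ 2.
Proof. by rewrite mxE Klein_d0 !mderivE /= !evalE; ring. Qed.
Lemma Klein_hess10 p : hess_at F p i1 ord0 = 3%:R * p 0 ord0 ^+ 2.
Proof. by rewrite mxE Klein_d1 !mderivE /= !evalE; ring. Qed.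
Lemma Klein_hess11 p : hess_at F p i1 i1 = 6%:R * p 0 i1 * p 0 i2.
Proof. by rewrite mxE Klein_d1 !mderivE /= !evalE; ring. Qed.
Lemma Klein_hess12 p : hess_at F p i1 i2 = 3%:R * p 0 i1 ^+ 2.
Proof. by rewrite mxE Klein_d1 !mderivE /= !evalE; ring. Qed.
Lemma Klein_hess20 p : hess_at F p i2 ord0 = 3%:R * p 0 i2 ^+ 2.
Proof. by rewrite mxE Klein_d2 !mderivE /= !evalE; ring. Qed.
Lemma Klein_hess21 p : hess_at F p i2 i1 = 3%:R * p 0 i1 ^+ 2.
Proof. by rewrite mxE Klein_d2 !mderivE /= !evalE; ring. Qed.
Lemma Klein_hess22 p : hess_at F p i2 i2 = 6%:R * p 0 i2 * p 0 ord0.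
Proof. by rewrite mxE Klein_d2 !mderivE /= !evalE; ring. Qed.

Definition Klein_hess := (Klein_hess00, Klein_hess01, Klein_hess02, Klein_hess10, Klein_hess11, Klein_hess12,
  Klein_hess20, Klein_hess21, Klein_hess22).

Lemma Klein_hessian_nonvanishing : ~ vanishes_on F (hessian F).
Proof.
(* With y^7 = -2 the point (y^3 : y : 1) lies on the quartic, and the Hessian there is -702 y. *)
have [y ey] := @nth_root K 7 (- 2%:R) isT.
have y0 : y != 0 by apply: contra_eq_neq ey => ->; rewrite expr0n /= eq_sym oppr_eq0 n0.
have C : curve_points F (pt (y ^+ 3) y 1).
  apply/curve_pointsP; split; first by apply: (@pt_neq0 _ _ _ _ i2); rewrite ptE oner_neq0.
  rewrite Klein_eval !ptE; transitivity (y ^+ 3 * (y ^+ 7 + 2%:R)); first by ring.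
  by rewrite ey; ring.
move=> /(_ _ C); rewrite eval_hessian det_mx3 !Klein_hess !ptE => E.
have : - (702%:R * y) = 0.
  rewrite -[RHS]E; transitivity (54%:R * y * (4%:R * y ^+ 7 - 1 - (y ^+ 7) ^+ 2)); last by ring.
  by rewrite ey; ring.
by move/eqP; rewrite oppr_eq0 mulf_eq0 (negPf y0) (negPf (n0 _)).
Qed.

(* Here a, b, c are z^k - z^(-k) for k = 1, 2, 4; each identity below is certified by its quotient by the seventh
   cyclotomic polynomial. *)
Section SeventhRoot.
Variable z : K.
Hypothesis hz : 1 + z + z ^+ 2 + z ^+ 3 + z ^+ 4 + z ^+ 5 + z ^+ 6 = 0.
Let a := z - z ^+ 6.
Let b := z ^+ 2 - z ^+ 5.
Let c := z ^+ 4 - z ^+ 3.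
Let s := a + b + c.

Lemma e2_eq0 : a * b + b * c + c * a = 0.
Proof. by rewrite -[RHS](mul0r (z ^+ 3 - 2%:R * z ^+ 4 + z ^+ 5)) -hz /a /b /c; ring. Qed.

Lemma cubic_eq0 : a ^+ 3 * b + b ^+ 3 * c + c ^+ 3 * a = 0.
Proof. by rewrite -[RHS](mul0r (z ^+ 5 - z ^+ 6 - z ^+ 8 - 2%:R * z ^+ 10 + 6%:R * z ^+ 11 - 2%:R * z ^+ 12
    - z ^+ 14 - z ^+ 16 + z ^+ 17)) -hz /a /b /c; ring. Qed.

Lemma s_sqr : s ^+ 2 = - 7%:R.
Proof. by apply: subr0_eq; rewrite -[RHS](mul0r (7%:R - 7%:R * z ^+ 1 + z ^+ 2 + z ^+ 3 - 3%:R * z ^+ 4 + z ^+ 5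
    + z ^+ 6)) -hz /s /a /b /c; ring. Qed.

Lemma abc_eq : a * b * c = s.
Proof. by apply: subr0_eq; rewrite -[RHS](mul0r (- z ^+ 1 + 2%:R * z ^+ 3 - 2%:R * z ^+ 4 + 2%:R * z ^+ 5
    - z ^+ 6 + z ^+ 7 - 2%:R * z ^+ 8 + z ^+ 9)) -hz /s /a /b /c; ring. Qed.

Lemma quadric_eq7 : (a ^+ 2 * b - b * c ^+ 2 + a * c ^+ 2) * a = 7%:R.
Proof. by apply: subr0_eq; rewrite -[RHS](mul0r (- 7%:R + 7%:R * z ^+ 1 + z ^+ 5 - z ^+ 6 - 7%:R * z ^+ 7
    + 7%:R * z ^+ 8 - 3%:R * z ^+ 9 + 3%:R * z ^+ 10 - z ^+ 11 + 3%:R * z ^+ 12 - 3%:R * z ^+ 13 - z ^+ 16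
    + z ^+ 17)) -hz /a /b /c; ring. Qed.

Lemma quintic_eq : a ^+ 3 * b ^+ 2 + b ^+ 3 * c ^+ 2 + c ^+ 3 * a ^+ 2 = 7%:R * s.
Proof. by apply: subr0_eq; rewrite -[RHS](mul0r (- 7%:R * z ^+ 1 + 14%:R * z ^+ 3 - 14%:R * z ^+ 4
    + 14%:R * z ^+ 5 - 6%:R * z ^+ 7 - 8%:R * z ^+ 8 + 12%:R * z ^+ 10 - 13%:R * z ^+ 11 + 16%:R * z ^+ 12
    - 5%:R * z ^+ 13 - 7%:R * z ^+ 15 + 5%:R * z ^+ 16 - 2%:R * z ^+ 17 - z ^+ 18 + 2%:R * z ^+ 19 + z ^+ 21
    - z ^+ 22)) -hz /s /a /b /c; ring. Qed.

Lemma polar_eq0 : 3%:R * (a ^+ 2 * b ^+ 3 * c) + c ^+ 2 * a ^+ 4 - 3%:R * (a ^+ 3 * b ^+ 2 * c) - b ^+ 3 * c ^+ 3 = 0.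
Proof. by rewrite -[RHS](mul0r (4%:R * z ^+ 10 - 12%:R * z ^+ 11 + 12%:R * z ^+ 12 - 10%:R * z ^+ 13
    + 21%:R * z ^+ 14 - 36%:R * z ^+ 15 + 44%:R * z ^+ 16 - 38%:R * z ^+ 17 + 30%:R * z ^+ 18 - 38%:R * z ^+ 19
    + 44%:R * z ^+ 20 - 36%:R * z ^+ 21 + 21%:R * z ^+ 22 - 10%:R * z ^+ 23 + 12%:R * z ^+ 24 - 12%:R * z ^+ 25
    + 4%:R * z ^+ 26)) -hz /a /b /c; ring. Qed.

End SeventhRoot.
End Klein.

(** * Automorphisms of the Wiman sextic *)

Section WimanGroup.
Variable K : closedFieldType.
Hypothesis char0 : [pchar K] =i pred0.
Local Notation F := (Wiman_sextic K).
Local Notation Gamma := (quasi_galois_group F 2).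
Implicit Types (p x v : 'rV[K]_3) (M : 'M[K]_3) (a b c : K).

Let d_gt3 : (3 < 6)%N. Proof. by []. Qed.
Let smF : smooth_plane_curve 6 F. Proof. exact: Wiman_smooth. Qed.
Let n0 n : (n.+1%:R : K) != 0. Proof. exact: natr_neq0. Qed.

Lemma Wiman_hess00 p : hess_at F p ord0 ord0 = 60%:R * p 0 ord0 * p 0 i1 ^+ 3 + 180%:R * p 0 ord0 ^+ 3 * p 0 i2 - 90%:R * p 0 i1 ^+ 2 * p 0 i2 ^+ 2.
Proof. by rewrite mxE Wiman_d0 !mderivE /= !evalE; ring. Qed.
Lemma Wiman_hess01 p : hess_at F p ord0 i1 = 90%:R * p 0 ord0 ^+ 2 * p 0 i1 ^+ 2 - 180%:R * p 0 ord0 * p 0 i1 * p 0 i2 ^+ 2 - 135%:R * p 0 i2 ^+ 4.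
Proof. by rewrite mxE Wiman_d0 !mderivE /= !evalE; ring. Qed.
Lemma Wiman_hess02 p : hess_at F p ord0 i2 = 45%:R * p 0 ord0 ^+ 4 - 180%:R * p 0 ord0 * p 0 i1 ^+ 2 * p 0 i2 - 540%:R * p 0 i1 * p 0 i2 ^+ 3.
Proof. by rewrite mxE Wiman_d0 !mderivE /= !evalE; ring. Qed.
Lemma Wiman_hess10 p : hess_at F p i1 ord0 = hess_at F p ord0 i1.
Proof. by rewrite Wiman_hess01 mxE Wiman_d1 !mderivE /= !evalE; ring. Qed.
Lemma Wiman_hess11 p : hess_at F p i1 i1 = 60%:R * p 0 ord0 ^+ 3 * p 0 i1 + 180%:R * p 0 i1 ^+ 3 * p 0 i2 - 90%:R * p 0 ord0 ^+ 2 * p 0 i2 ^+ 2.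
Proof. by rewrite mxE Wiman_d1 !mderivE /= !evalE; ring. Qed.
Lemma Wiman_hess12 p : hess_at F p i1 i2 = 45%:R * p 0 i1 ^+ 4 - 180%:R * p 0 ord0 ^+ 2 * p 0 i1 * p 0 i2 - 540%:R * p 0 ord0 * p 0 i2 ^+ 3.
Proof. by rewrite mxE Wiman_d1 !mderivE /= !evalE; ring. Qed.
Lemma Wiman_hess20 p : hess_at F p i2 ord0 = hess_at F p ord0 i2.
Proof. by rewrite Wiman_hess02 mxE Wiman_d2 !mderivE /= !evalE; ring. Qed.
Lemma Wiman_hess21 p : hess_at F p i2 i1 = hess_at F p i1 i2.
Proof. by rewrite Wiman_hess12 mxE Wiman_d2 !mderivE /= !evalE; ring. Qed.
Lemma Wiman_hess22 p : hess_at F p i2 i2 = - (90%:R * p 0 ord0 ^+ 2 * p 0 i1 ^+ 2) - 1620%:R * p 0 ord0 * p 0 i1 * p 0 i2 ^+ 2 + 810%:R * p 0 i2 ^+ 4.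
Proof. by rewrite mxE Wiman_d2 !mderivE /= !evalE; ring. Qed.

Definition Wiman_hess := (Wiman_hess10, Wiman_hess20, Wiman_hess21, Wiman_hess00, Wiman_hess01, Wiman_hess02,
  Wiman_hess11, Wiman_hess12, Wiman_hess22).

Lemma Wiman_hessian p y : p = pt 0 y 1 -> (hessian F).[: p] = 45%:R ^+ 3 * (2%:R * y ^+ 10 - 648%:R * y ^+ 5 - 162%:R).
Proof. by move=> ->; rewrite eval_hessian det_mx3 !Wiman_hess !ptE; ring. Qed.

Lemma Wiman_hessian_nonvanishing : ~ vanishes_on F (hessian F).
Proof.
(* On the line X = 0 the sextic is 9 Y^5 Z + 27 Z^6, which gives the points (0 : y : 1) with y^5 =
   -3. *)
have [y ey] := @nth_root K 5 (- 3%:R) isT.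
have C : curve_points F (pt 0 y 1).
  apply/curve_pointsP; split; first by apply: (@pt_neq0 _ _ _ _ i2); rewrite ptE oner_neq0.
  by rewrite Wiman_eval !ptE ey; ring.
move=> /(_ _ C); rewrite (Wiman_hessian erefl) -[10%N]/(5 * 2)%N exprM ey => /eqP.
have -> : 2%:R * (- 3%:R) ^+ 2 - 648%:R * - 3%:R - 162%:R = 1800%:R :> K by ring.
by rewrite mulf_eq0 expf_eq0 /= !(negPf (n0 _)).
Qed.

(** The exchange of X and Y, written as a homology with centre (1 : -1 : 0) and axis X = Y. *)
Definition swap : 'M[K]_3 := 1%:M + (pt (- 1) 1 0)^T *m pt 1 (- 1) 0.

Lemma mul_swap x : x *m swap = pt (x 0 i1) (x 0 ord0) (x 0 i2).
Proof. by apply: row3P; rewrite mul_row3 !mxE !big_ord1 !mxE /= ?ptE; ring. Qed.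

Lemma swap_aut : linear_aut F swap.
Proof.
have ss : swap *m swap = 1%:M.
  by apply: mx3_eq => x y z; rewrite mulmxA !mul_swap mulmx1 !ptE.
apply: (linear_aut_eval (Wiman_homog K) ss (oner_neq0 _)) => x.
by rewrite mul_swap !Wiman_eval !ptE; ring.
Qed.

Lemma swap_in_Gamma : Gamma (lin F swap).
Proof.
have P0 : pt 1 (- 1) 0 != 0 :> 'rV[K]_3 by apply: (@pt_neq0 _ _ _ _ ord0); rewrite ptE oner_neq0.
apply: (qg_central d_gt3 smF P0 _ swap_aut); last by exists 1, (pt (- 1) 1 0)^T.
(* The point (0 : 0 : 1) of the axis serves as the test vector for the quadratic term at the
   centre. *)
apply: (@galois_card2 K 6 F d_gt3 smF _ (pt 0 0 1) 1 (pt (- 1) 1 0)^T P0 _ (n0 5) _ _ swap_aut).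
- rewrite Wiman_eval !ptE.
  have -> : 10%:R * (1 ^+ 3 * (-1) ^+ 3) + 9%:R * ((1 ^+ 5 + (-1) ^+ 5) * 0) - 45%:R * (1 ^+ 2 * (-1) ^+ 2 * 0 ^+ 2)
    - 135%:R * (1 * -1 * 0 ^+ 4) + 27%:R * 0 ^+ 6 = - 10%:R :> K by ring.
  by rewrite oppr_eq0 n0.
- by rewrite Wiman_dgrad !ptE; ring.
- have -> : pt 0 0 1 = delta_mx 0 i2 :> 'rV[K]_3 by apply: row3P; rewrite !ptE mxE.
  rewrite bilinear_mx Wiman_hess !ptE.
  have -> : - (90%:R * 1 ^+ 2 * (-1) ^+ 2) - 1620%:R * 1 * -1 * 0 ^+ 2 + 810%:R * 0 ^+ 4 = - 90%:R :> K by ring.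
  by rewrite oppr_eq0 n0.
by apply/eqP => /(congr1 (fun A : 'cV[K]_3 => A i1 0)); rewrite !mxE /=; apply/eqP/oner_neq0.
Qed.

Lemma diag_inv a b : a * b = 1 -> diag_mx (pt a b 1) *m diag_mx (pt b a 1) = 1%:M :> 'M[K]_3.
Proof.
by move=> ab; apply: mx3_eq => x y z; rewrite mulmxA !mul_diag mulmx1 !ptE !mulr1 -!mulrA [b * a]mulrC ab !mulr1.
Qed.

Lemma diag_aut a b : a * b = 1 -> a ^+ 5 = 1 -> linear_aut F (diag_mx (pt a b 1)).
Proof.
move=> ab a5; have b5 : b ^+ 5 = 1 by rewrite -[LHS]mul1r -a5 -exprMn ab expr1n.
apply: (linear_aut_eval (Wiman_homog K) (diag_inv ab) (oner_neq0 _)) => x; rewrite mul_diag !Wiman_eval !ptE.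
move: (x 0 ord0) (x 0 i1) (x 0 i2) => u v w.
transitivity (10%:R * ((a * b) ^+ 3 * (u ^+ 3 * v ^+ 3)) + 9%:R * ((a ^+ 5 * u ^+ 5 + b ^+ 5 * v ^+ 5) * w)
  - 45%:R * ((a * b) ^+ 2 * (u ^+ 2 * v ^+ 2 * w ^+ 2)) - 135%:R * (a * b * (u * v * w ^+ 4)) + 27%:R * w ^+ 6); first by ring.
by rewrite ab a5 b5; ring.
Qed.

(* The commutator of the swap with the diagonal matrix of (a, b, 1) is the diagonal matrix of (a^2, b^2, 1). *)
Lemma diag_in_Gamma a b : a * b = 1 -> a ^+ 5 = 1 -> Gamma (lin F (diag_mx (pt a b 1))).
Proof.
move=> ab a5; have b5 : b ^+ 5 = 1 by rewrite -[LHS]mul1r -a5 -exprMn ab expr1n.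
(* Square roots among the fifth roots of unity: (a^3)^2 = a^6 = a. *)
have [a' [b' [ab' a5' ea eb]]] : exists a' b', [/\ a' * b' = 1, a' ^+ 5 = 1, a' ^+ 2 = a & b' ^+ 2 = b].
  exists (a ^+ 3), (b ^+ 3); split; rewrite -?exprMn ?ab ?expr1n //.
  - by rewrite -exprM mulnC exprM a5 expr1n.
  - by rewrite -exprM exprS a5 mulr1.
  by rewrite -exprM exprS b5 mulr1.
have aD := diag_aut ab' a5'.
have [_ iD] := invmx_eq (diag_inv ab').
have aC := conj_mx_aut swap_aut aD.
have := qgM d_gt3 smF swap_aut aC swap_in_Gamma (qg_conj d_gt3 smF swap_aut aD swap_in_Gamma).
congr (Gamma (lin F _)); apply: mx3_eq => x y z.
by rewrite iD !mulmxA !(mul_swap, mul_diag) !ptE !mulr1 -!mulrA -!expr2 ea eb.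
Qed.

Let e0 : 'rV[K]_3 := pt 1 0 0.

Lemma Wiman_e0 : curve_points F e0.
Proof.
apply/curve_pointsP; split; first by apply: (@pt_neq0 _ _ _ _ ord0); rewrite ptE oner_neq0.
by rewrite Wiman_eval !ptE; ring.
Qed.

(** M preserves the tangent Z = 0 at (1 : 0 : 0), which meets C only there and at (0 : 1 : 0), so it
    fixes both points. First derivatives along this line make M diagonal, and comparing coefficients
    leaves A^5 C = B^5 C = A B C^4 = C^6, a group of order 5 modulo scalars. *)
Lemma Wiman_stabilizer M : linear_aut F M -> collinear (e0 *m M) e0 -> Gamma (lin F M).
Proof.
move=> aM col; have [uM [c c0 eM]] := aM.
have e0_neq0 : e0 != 0 by case/curve_pointsP: Wiman_e0.
have [A eA] := collinear_scale_mid e0_neq0 col.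
have A0 : A != 0 by apply: contraTneq e0_neq0 => A0; rewrite -[e0](mulmxK uM) eA A0 scale0r mul0mx eqxx.
have rE j : M ord0 j = A * e0 0 j.
  have := congr1 (fun v : 'rV[K]_3 => v 0 j) eA; rewrite mul_row3 scale_row !ptE => <-; ring.
have r00 : M ord0 ord0 = A by rewrite rE ptE mulr1.
have r01 : M ord0 i1 = 0 by rewrite rE ptE mulr0.
have r02 : M ord0 i2 = 0 by rewrite rE ptE mulr0.
have FM x : F.[: x *m M] = c * F.[: x] by rewrite -eval_lsub eM mevalZ.
have dM p v : dgrad F (p *m M) (v *m M) = c * dgrad F p v by rewrite -dgrad_lsub eM dgradZ.
have r12 : M i1 i2 = 0.
  have := dM e0 (pt 0 1 0); rewrite !Wiman_dgrad !mul_row3 !ptE r00 r01 r02 => E.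
  have : 9%:R * (A ^+ 5 * M i1 i2) = 0.
    by apply: etrans (etrans _ E) _; ring.
  by move/mul_nat_eq0 => /(_ char0)/eqP; rewrite mulf_eq0 expf_eq0 (negPf A0) /= => /eqP.
have r11 : M i1 i1 != 0.
  apply/eqP => B0; have e : pt (- M i1 ord0) A 0 *m M = 0.
    by apply: row3P; rewrite mul_row3 !ptE ?r00 ?r01 ?r02 ?r12 ?B0 mxE; ring.
  have := mulmxK uM (pt (- M i1 ord0) A 0); rewrite e mul0mx => /(congr1 (fun v : 'rV[K]_3 => v 0 i1)).
  by rewrite mxE ptE => /esym/eqP; rewrite (negPf A0).
have r10 : M i1 ord0 = 0.
  have := FM (pt 0 1 0); rewrite !Wiman_eval !mul_row3 !ptE r01 r02 r12 => E.
  have : 10%:R * (M i1 ord0 ^+ 3 * M i1 i1 ^+ 3) = 0.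
    by apply: etrans (etrans _ E) _; ring.
  by move/mul_nat_eq0 => /(_ char0)/eqP; rewrite mulf_eq0 !expf_eq0 (negPf r11) orbF /= => /eqP.
have xM (x y z : K) : pt x y z *m M = pt (x * A + z * M i2 ord0) (y * M i1 i1 + z * M i2 i1) (z * M i2 i2).
  by apply: row3P; rewrite mul_row3 !ptE ?r00 ?r01 ?r02 ?r10 ?r12; ring.
move: (M i1 i1) (M i2 ord0) (M i2 i1) (M i2 i2) r11 xM {r00 r01 r02 r10 r12 rE} => B p q C B0 xM.
have nat_inj n a b : n.+1%:R * a = n.+1%:R * b -> a = b.
  by move=> e; apply/subr0_eq/(mul_nat_eq0 char0 (n := n)); rewrite mulrBr e subrr.
have AC : A ^+ 5 * C = c.
  by apply: (nat_inj 8); have := dM (pt 1 0 0) (pt 0 0 1); rewrite !xM !Wiman_dgrad !ptE => E; apply: etrans (etrans _ E) _; ring.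
have BC : B ^+ 5 * C = c.
  by apply: (nat_inj 8); have := dM (pt 0 1 0) (pt 0 0 1); rewrite !xM !Wiman_dgrad !ptE => E; apply: etrans (etrans _ E) _; ring.
have AB : 30%:R * (A ^+ 2 * B ^+ 2) != 0 by rewrite !mulf_neq0 ?expf_neq0 ?n0.
(* The derivative in the Z-direction is compared at (1 : 1 : 0) and (1 : -1 : 0). The term 10 X^3
   Y^3 contributes multiples of B p + A q and of - B p + A q, so p and q both vanish. *)
have s1 : B * p + A * q = 0.
  apply: (mulfI AB); have E := dM (pt 1 1 0) (pt 0 0 1); rewrite !xM !Wiman_dgrad !ptE in E.
  have {E} : 30%:R * (A ^+ 2 * B ^+ 2) * (B * p + A * q) + 9%:R * (A ^+ 5 * C + B ^+ 5 * C) = 9%:R * (c + c).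
    by apply: etrans (etrans _ E) _; ring.
  by rewrite AC BC => /(canRL (addrK _)) ->; rewrite subrr mulr0.
have s2 : - (B * p) + A * q = 0.
  apply: (mulfI AB); have E := dM (pt 1 (- 1) 0) (pt 0 0 1); rewrite !xM !Wiman_dgrad !ptE in E.
  have {E} : 30%:R * (A ^+ 2 * B ^+ 2) * (- (B * p) + A * q) + 9%:R * (A ^+ 5 * C - B ^+ 5 * C) = 0.
    by apply: etrans (etrans _ E) _; ring.
  by rewrite AC BC subrr mulr0 addr0 mulr0.
have p0 : p = 0.
  apply: (mulfI B0); apply: (nat_inj 1); rewrite mulr0 mulr0 -[RHS](subrr 0) -{1}s1 -s2; ring.
have q0 : q = 0.
  apply: (mulfI A0); apply: (nat_inj 1); rewrite mulr0 mulr0 -[RHS](addr0 0) -{1}s1 -s2; ring.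
have CC : C ^+ 6 = c.
  by apply: (nat_inj 26); have E := FM (pt 0 0 1); rewrite !xM !Wiman_eval !ptE p0 q0 in E; apply: etrans (etrans _ E) _; ring.
have ABC : A * B * C ^+ 4 = c.
  apply: (nat_inj 269).
  (* F takes the values -125 and 107 at these two points. Apart from terms already known, the
     difference isolates 270 A B C^4. *)
  have E1 := FM (pt 1 1 1); have E2 := FM (pt 1 (- 1) 1); rewrite !xM !Wiman_eval !ptE p0 q0 in E1 E2.
  have E3 : 10%:R * (A ^+ 3 * B ^+ 3) = 10%:R * c.
    by have E := FM (pt 1 1 0); rewrite !xM !Wiman_eval !ptE in E; apply: etrans (etrans _ E) _; ring.
  have {}E1 : 10%:R * (A ^+ 3 * B ^+ 3) + 9%:R * (A ^+ 5 * C + B ^+ 5 * C) - 45%:R * (A ^+ 2 * B ^+ 2 * C ^+ 2)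
      - 135%:R * (A * B * C ^+ 4) + 27%:R * C ^+ 6 = - (125%:R * c) by apply: etrans (etrans _ E1) _; ring.
  have {}E2 : - (10%:R * (A ^+ 3 * B ^+ 3)) + 9%:R * (A ^+ 5 * C - B ^+ 5 * C) - 45%:R * (A ^+ 2 * B ^+ 2 * C ^+ 2)
      + 135%:R * (A * B * C ^+ 4) + 27%:R * C ^+ 6 = 107%:R * c by apply: etrans (etrans _ E2) _; ring.
  move: E1 E2; rewrite E3 AC BC CC => E1 E2.
  transitivity (107%:R * c - - (125%:R * c) + 38%:R * c); last by ring.
  by rewrite -E1 -E2; ring.
have C0 : C != 0 by apply: contraNneq c0 => C0; rewrite -CC C0 expr0n.
have -> : M = C *: diag_mx (pt (A / C) (B / C) 1).
  by apply: mx3_eq => x y z; rewrite xM -scalemxAr mul_diag; apply: row3P; rewrite scale_row !ptE ?p0 ?q0; field.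
have ab : A / C * (B / C) = 1.
  by apply: (mulIf (expf_neq0 6 C0)); rewrite mul1r [RHS]CC -ABC; field.
have a5 : (A / C) ^+ 5 = 1.
  by apply: (mulIf (expf_neq0 6 C0)); rewrite mul1r [RHS]CC -AC; field.
rewrite (lin_scale d_gt3 smF C0); [exact: diag_in_Gamma|exact: diag_aut].
Qed.

Theorem Wiman_quasi_galois : curve_Aut F = Gamma.
Proof.
(* A root of the fifth cyclotomic polynomial. *)
have [a ea] := @solve_monicpoly K 4 (fun=> - 1) isT.
have sum0 : 1 + a + a ^+ 2 + a ^+ 3 + a ^+ 4 = 0 by rewrite ea !big_ord_recl big_ord0 /= /bump /=; ring.
have a5 : a ^+ 5 = 1.
  by apply/subr0_eq; rewrite -[RHS](mul0r (a - 1)) -sum0; ring.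
have a1 : a - 1 != 0.
  apply/eqP => /subr0_eq a1; have : 5%:R = 0 :> K by rewrite -[RHS]sum0 a1; ring.
  by move/eqP; rewrite (negPf (n0 4)).
pose b := a ^+ 4; have ab : a * b = 1 by rewrite /b -exprS.
have b1 : b - 1 != 0.
  by apply: contraNneq a1 => /subr0_eq e; rewrite -[a]mulr1 -{1}e ab subrr.
have anb : a - b != 0.
  apply: contraNneq a1 => /subr0_eq e; have a2 : a ^+ 2 = 1 by rewrite expr2 {2}e.
  by rewrite e /b -[4%N]/(2 * 2)%N exprM a2 expr1n subrr.
pose e1 : 'rV[K]_3 := pt 0 1 0.
(* The eigenvalues a, a^4 and 1 are distinct, so only coordinate points are fixed, and (0 : 0 : 1)
   is not on the sextic. *)
have fixed x : curve_points F x -> collinear (x *m diag_mx (pt a b 1)) x -> exists2 t, t != 0 & x = t *: e0 \/ x = t *: e1.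
  move=> /curve_pointsP [x0 Fx] col; move: (col ord0 i1) (col ord0 i2) (col i1 i2); rewrite mul_diag !ptE.
  move: (pt_eta x) x0 Fx; move: (x 0 ord0) (x 0 i1) (x 0 i2) => u v w -> x0 Fx h1 h2 h3.
  have uv : u * v = 0.
    by apply: (mulIf anb); rewrite mul0r -[RHS](subrr (u * a * v)) {2}h1; ring.
  have uw : u * w = 0 by apply: (mulIf a1); rewrite mul0r -[RHS](subrr (u * a * w)) {2}h2; ring.
  have vw : v * w = 0 by apply: (mulIf b1); rewrite mul0r -[RHS](subrr (v * b * w)) {2}h3; ring.
  have [u0|u0] := eqVneq u 0.
    have [v0|v0] := eqVneq v 0.
      exfalso; move: Fx x0; rewrite u0 v0 Wiman_eval !ptE => Fx.
      have : 27%:R * w ^+ 6 = 0 by rewrite -Fx; ring.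
      move/(mul_nat_eq0 char0)/eqP; rewrite expf_eq0 /= => /eqP ->.
      by move/eqP; apply; apply: row3P; rewrite ptE mxE.
    have w0 : w = 0 by apply: (mulfI v0); rewrite vw mulr0.
    by exists v => //; right; apply: row3P; rewrite scale_row !ptE ?u0 ?w0; ring.
  have v0 : v = 0 by apply: (mulfI u0); rewrite uv mulr0.
  have w0 : w = 0 by apply: (mulfI u0); rewrite uw mulr0.
  by exists u => //; left; apply: row3P; rewrite scale_row !ptE ?v0 ?w0; ring.
have es : e0 *m swap = e1 by rewrite mul_swap; apply: row3P; rewrite !ptE.
have e00 : e0 != 0 by case/curve_pointsP: Wiman_e0.
have e10 : e1 != 0 by apply: (@pt_neq0 _ _ _ _ i1); rewrite ptE oner_neq0.
have gG := diag_in_Gamma ab a5; have ga := diag_aut ab a5.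
apply: (aut_is_quasi_galois d_gt3 smF (pr := 5) (vs := [:: e0; e1]) Wiman_hessian_nonvanishing Wiman_e0 _ _ ga gG) => //.
- by rewrite eval_hessian det_mx3 !Wiman_hess !ptE; ring.
- exists 1; split; first exact: oner_neq0.
  have dk k : diag_mx (pt a b 1) ^+ k = diag_mx (pt (a ^+ k) (b ^+ k) 1).
    elim: k => [|k IH]; apply: mx3_eq => x y z; first by rewrite expr0 mulmx1 mul_diag !ptE !mulr1.
    by rewrite exprS -mulmxE mulmxA mul_diag IH !mul_diag !ptE !exprS !mulr1 !mulrA.
  rewrite dk a5 /b -exprM mulnC exprM a5 expr1n.
  by apply: mx3_eq => x y z; rewrite mul_diag mulmx1 !ptE !mulr1.
- by move=> i j; rewrite mul_diag !mxE; case: (ord3P i) => ->; case: (ord3P j) => -> /=; ring.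
- move=> x Cx /(fixed x Cx) [t t0 [->|->]].
    by exists 1%:M; split; [exact: linear_aut1|exact: qg1|rewrite mulmx1; exact: collinearZr].
  by exists swap; split; [exact: swap_aut|exact: swap_in_Gamma|rewrite es; exact: collinearZr].
- move=> x Cx /(fixed x Cx) [t t0 [->|->]]; [exists e0|exists e1]; rewrite ?inE ?eqxx ?orbT //;
    split=> //; apply: collinear_sym; exact: collinearZr.
exact: Wiman_stabilizer.
Qed.

End WimanGroup.

(** * Automorphisms of the Klein quartic *)

Section KleinInvolution.
Variable K : closedFieldType.
Hypothesis char0 : [pchar K] =i pred0.
Local Notation F := (Klein_quartic K).
Local Notation Gamma := (quasi_galois_group F 2).
Implicit Types (p x v : 'rV[K]_3) (M : 'M[K]_3).

Let n0 n : (n.+1%:R : K) != 0. Proof. exact: natr_neq0. Qed.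
Let d_gt3 : (3 < 4)%N. Proof. by []. Qed.
Let smF : smooth_plane_curve 4 F. Proof. exact: Klein_smooth. Qed.

Variables a b c s : K.
Hypotheses (sE : s = a + b + c) (e2 : a * b + b * c + c * a = 0) (cubic : a ^+ 3 * b + b ^+ 3 * c + c ^+ 3 * a = 0)
  (s2 : s ^+ 2 = - 7%:R) (abc : a * b * c = s) (quadric : (a ^+ 2 * b - b * c ^+ 2 + a * c ^+ 2) * a = 7%:R)
  (quintic : a ^+ 3 * b ^+ 2 + b ^+ 3 * c ^+ 2 + c ^+ 3 * a ^+ 2 = 7%:R * s)
  (polar0 : 3%:R * (a ^+ 2 * b ^+ 3 * c) + c ^+ 2 * a ^+ 4 - 3%:R * (a ^+ 3 * b ^+ 2 * c) - b ^+ 3 * c ^+ 3 = 0).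

Let P : 'rV[K]_3 := pt (b * c) (a * b) (c * a).
(** Klein's involution in the form of a homology with centre P. As [mul_involution] shows, it is the
    symmetric matrix with rows (a, b, c), (b, c, a), (c, a, b); its eigenvalues are s, s and -s. *)
Definition involution : 'M[K]_3 := s%:M + (s^-1 *: P^T) *m P.

Let s0 : s != 0.
Proof. by apply: contra_eq_neq s2 => ->; rewrite expr0n /= eq_sym oppr_eq0 n0. Qed.

Lemma mul_involution x : x *m involution = pt (x 0 ord0 * a + x 0 i1 * b + x 0 i2 * c)
  (x 0 ord0 * b + x 0 i1 * c + x 0 i2 * a) (x 0 ord0 * c + x 0 i1 * a + x 0 i2 * b).
Proof.
have PT i : P^T i 0 = P 0 i by rewrite mxE.
have xP : (x *m P^T) 0 0 = x 0 ord0 * (b * c) + x 0 i1 * (a * b) + x 0 i2 * (c * a).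
  by rewrite mxE sum3 !PT !ptE.
(* ab + bc + ca = 0 and abc = s turn the products of two coordinates of P into s times linear
   expressions in a, b, c. *)
have h00 : b * c * (b * c) = - (s * (b + c)).
  by apply/subr0_eq; rewrite -[RHS](mulr0 (b * c)) -e2 -abc; ring.
have h11 : a * b * (a * b) = - (s * (a + b)).
  by apply/subr0_eq; rewrite -[RHS](mulr0 (a * b)) -e2 -abc; ring.
have h22 : c * a * (c * a) = - (s * (a + c)).
  by apply/subr0_eq; rewrite -[RHS](mulr0 (c * a)) -e2 -abc; ring.
have h01 : b * c * (a * b) = s * b by rewrite -abc; ring.
have h02 : b * c * (c * a) = s * c by rewrite -abc; ring.
have h12 : a * b * (c * a) = s * a by rewrite -abc; ring.
have xl : (x *m (s^-1 *: P^T)) 0 0 = s^-1 * (x 0 ord0 * (b * c) + x 0 i1 * (a * b) + x 0 i2 * (c * a)).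
  by rewrite -xP -scalemxAr mxE.
rewrite mulmxDr mul_mx_scalar mul_col_row xl {xl xP}.
apply: row3P; rewrite mxE !scale_row !ptE; move: (x 0 ord0) (x 0 i1) (x 0 i2) => u v w; apply: (mulfI s0).
- transitivity (s * s * u + (u * (b * c * (b * c)) + v * (b * c * (a * b)) + w * (b * c * (c * a)))); first by field.
  by rewrite h00 h01 h02 {2}sE; ring.
- transitivity (s * s * v + (u * (b * c * (a * b)) + v * (a * b * (a * b)) + w * (a * b * (c * a)))); first by field.
  by rewrite h01 h11 h12 {2}sE; ring.
transitivity (s * s * w + (u * (b * c * (c * a)) + v * (a * b * (c * a)) + w * (c * a * (c * a)))); first by field.
by rewrite h02 h12 h22 {2}sE; ring.
Qed.

Let p2 : a ^+ 2 + b ^+ 2 + c ^+ 2 = - 7%:R.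
Proof. by transitivity (s ^+ 2 - 2%:R * (a * b + b * c + c * a)); [rewrite sE; ring|rewrite s2 e2; ring]. Qed.

Lemma involution_sqr : involution *m involution = (- 7%:R)%:M.
Proof.
apply: mx3_eq => x y z; rewrite mulmxA !mul_involution mul_mx_scalar; apply: row3P; rewrite scale_row !ptE -p2.
- by rewrite -[LHS]subr0 -{1}(mulr0 (y + z)) -e2; ring.
- by rewrite -[LHS]subr0 -{1}(mulr0 (x + z)) -e2; ring.
by rewrite -[LHS]subr0 -{1}(mulr0 (x + y)) -e2; ring.
Qed.

Lemma involution_aut : linear_aut F involution.
Proof.
have ii : involution *m ((- 7%:R)^-1 *: involution) = 1%:M.
  by rewrite -scalemxAr involution_sqr scale_scalar_mx mulVf // oppr_eq0 n0.
apply: (linear_aut_eval (Klein_homog K) ii (n0 48)) => p; rewrite mul_involution !Klein_eval !ptE.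
move: (p 0 ord0) (p 0 i1) (p 0 i2) => x y z.
have q2 : a ^+ 2 * b ^+ 2 + b ^+ 2 * c ^+ 2 + c ^+ 2 * a ^+ 2 = 14%:R.
  transitivity ((a * b + b * c + c * a) ^+ 2 - 2%:R * (a * b * c * (a + b + c))); first by ring.
  by rewrite e2 abc -sE -expr2 s2; ring.
have as7 : a * b * c * (a + b + c) = - 7%:R by rewrite abc -sE -expr2 s2.
have n7 : a ^+ 3 * c + b ^+ 3 * a + c ^+ 3 * b = 7%:R.
  transitivity ((a * b + b * c + c * a) * (a ^+ 2 + b ^+ 2 + c ^+ 2) - a * b * c * (a + b + c)
    - (a ^+ 3 * b + b ^+ 3 * c + c ^+ 3 * a)); first by ring.
  by rewrite e2 as7 cubic; ring.
have p4 : a ^+ 4 + b ^+ 4 + c ^+ 4 = 21%:R.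
  transitivity ((a ^+ 2 + b ^+ 2 + c ^+ 2) ^+ 2 - 2%:R * (a ^+ 2 * b ^+ 2 + b ^+ 2 * c ^+ 2 + c ^+ 2 * a ^+ 2)); first by ring.
  by rewrite p2 q2; ring.
(* The image of F is sorted by cyclic orbits of monomials. Only the orbit of x^3 y survives, with
   coefficient 7 + 3 * 14 = 49. *)
transitivity ((a ^+ 3 * b + b ^+ 3 * c + c ^+ 3 * a) * (x ^+ 4 + y ^+ 4 + z ^+ 4)
  + ((a ^+ 3 * c + b ^+ 3 * a + c ^+ 3 * b) + 3%:R * (a ^+ 2 * b ^+ 2 + b ^+ 2 * c ^+ 2 + c ^+ 2 * a ^+ 2)) * (x ^+ 3 * y + y ^+ 3 * z + z ^+ 3 * x)
  + ((a ^+ 4 + b ^+ 4 + c ^+ 4) + 3%:R * (a * b * c * (a + b + c))) * (x ^+ 3 * z + y ^+ 3 * x + z ^+ 3 * y)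
  + (3%:R * (a ^+ 3 * c + b ^+ 3 * a + c ^+ 3 * b) + 3%:R * (a * b * c * (a + b + c))) * (x ^+ 2 * y ^+ 2 + y ^+ 2 * z ^+ 2 + z ^+ 2 * x ^+ 2)
  + (3%:R * (a ^+ 3 * b + b ^+ 3 * c + c ^+ 3 * a) + 3%:R * (a ^+ 2 * b ^+ 2 + b ^+ 2 * c ^+ 2 + c ^+ 2 * a ^+ 2)
     + 6%:R * (a * b * c * (a + b + c))) * (x ^+ 2 * y * z + y ^+ 2 * z * x + z ^+ 2 * x * y)); first by ring.
by rewrite cubic n7 q2 p4 as7; ring.
Qed.

Lemma involution_in_Gamma : Gamma (lin F involution).
Proof.
have [a0 b0 c0] : [/\ a != 0, b != 0 & c != 0].
  by split; apply: contra_neq s0 => e; rewrite -abc e ?(mul0r, mulr0).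
have P0 : P != 0 by apply: (@pt_neq0 _ _ _ _ i1); rewrite ptE mulf_neq0.
have l0 : s^-1 *: P^T != 0.
  rewrite scaler_eq0 negb_or invr_eq0 s0 /=; apply: contraNneq P0 => e.
  by rewrite -[P]trmxK e trmx0.
apply: (qg_central d_gt3 smF P0 _ involution_aut); last by exists s, (s^-1 *: P^T).
(* The vector (a, -c, 0) lies on the polar line of P by [polar0]; by [quadric] the second-order term
   does not vanish there, and by [quintic] P is off the curve. *)
apply: (@galois_card2 K 4 F d_gt3 smF _ (pt a (- c) 0) s _ P0 _ (n0 3) _ _ involution_aut l0).
- rewrite Klein_eval !ptE.
  have -> : (b * c) ^+ 3 * (a * b) + (a * b) ^+ 3 * (c * a) + (c * a) ^+ 3 * (b * c) =
     (a * b * c) * (a ^+ 3 * b ^+ 2 + b ^+ 3 * c ^+ 2 + c ^+ 3 * a ^+ 2) by ring.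
  by rewrite quintic abc mulf_neq0 // mulf_neq0.
- rewrite Klein_dgrad !ptE.
  transitivity (c * (3%:R * (a ^+ 2 * b ^+ 3 * c) + c ^+ 2 * a ^+ 4 - 3%:R * (a ^+ 3 * b ^+ 2 * c) - b ^+ 3 * c ^+ 3)); first by ring.
  by rewrite polar0 mulr0.
have QE (H : 'M[K]_3) : (pt a (- c) 0 *m H *m (pt a (- c) 0)^T) 0 0 =
    H ord0 ord0 * a ^+ 2 - H ord0 i1 * (a * c) - H i1 ord0 * (a * c) + H i1 i1 * c ^+ 2.
  rewrite mxE sum3 !mul_row3.
  have vT i : (pt a (- c) 0)^T i 0 = pt a (- c) 0 0 i by rewrite mxE.
  by rewrite !vT !ptE; ring.
rewrite QE !Klein_hess !ptE.
have -> : 6%:R * (b * c) * (a * b) * a ^+ 2 - 3%:R * (b * c) ^+ 2 * (a * c) - 3%:R * (b * c) ^+ 2 * (a * c)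
    + 6%:R * (a * b) * (c * a) * c ^+ 2 = 6%:R * (a * b * c) * (a ^+ 2 * b - b * c ^+ 2 + a * c ^+ 2) by ring.
rewrite abc !mulf_neq0 //; apply: contra_eq_neq quadric => ->; by rewrite mul0r eq_sym n0.
Qed.

Let cyc : 'M[K]_3 := frame (pt 0 0 1) (pt 1 0 0) (pt 0 1 0).
Let cyc' : 'M[K]_3 := frame (pt 0 1 0) (pt 0 0 1) (pt 1 0 0).

Let mul_cyc x : x *m cyc = pt (x 0 i1) (x 0 i2) (x 0 ord0).
Proof. by rewrite {1}(pt_eta x) mul_pt_frame; apply: row3P; rewrite !mxE /=; ring. Qed.

Let mul_cyc' x : x *m cyc' = pt (x 0 i2) (x 0 ord0) (x 0 i1).
Proof. by rewrite {1}(pt_eta x) mul_pt_frame; apply: row3P; rewrite !mxE /=; ring. Qed.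

Let cyc_inv : cyc *m cyc' = 1%:M.
Proof. by apply: mx3_eq => x y z; rewrite mulmxA mul_cyc mul_cyc' mulmx1 !ptE. Qed.

Let cyc_aut : linear_aut F cyc.
Proof.
by apply: (linear_aut_eval (Klein_homog K) cyc_inv (oner_neq0 _)) => p; rewrite mul_cyc !Klein_eval !ptE; ring.
Qed.

Let inv_cyc : invmx cyc = cyc'. Proof. by case: (invmx_eq cyc_inv). Qed.

Let cyc'_aut : linear_aut F cyc'. Proof. by rewrite -inv_cyc; exact: linear_autV. Qed.

(* The involution times its conjugate by the cyclic permutation is -7 times the inverse cyclic permutation. *)
Lemma cyc'_in_Gamma : Gamma (lin F cyc').
Proof.
have aI := involution_aut; have gI := involution_in_Gamma; have aC := conj_mx_aut aI cyc_aut.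
have n7 : - 7%:R != 0 :> K by rewrite oppr_eq0 n0.
have := qgM d_gt3 smF aI aC gI (qg_conj d_gt3 smF aI cyc_aut gI).
rewrite inv_cyc; have -> : involution *m (cyc' *m involution *m cyc) = - 7%:R *: cyc'; last by rewrite (lin_scale d_gt3 smF n7).
apply: mx3_eq => x y z; rewrite !mulmxA !(mul_involution, mul_cyc, mul_cyc') -scalemxAr mul_cyc' !ptE.
apply: row3P; rewrite scale_row !ptE -p2.
- by rewrite -[LHS]subr0 -{1}(mulr0 (x + y)) -e2; ring.
- by rewrite -[LHS]subr0 -{1}(mulr0 (y + z)) -e2; ring.
by rewrite -[LHS]subr0 -{1}(mulr0 (x + z)) -e2; ring.
Qed.

Lemma cyc_in_Gamma : Gamma (lin F cyc).
Proof.
have uC' : invmx cyc' = cyc by rewrite -inv_cyc invmxK.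
by rewrite -uC'; exact: (qgV d_gt3 smF cyc'_aut cyc'_in_Gamma).
Qed.

Lemma Klein_diag_aut t : t ^+ 7 = 1 -> linear_aut F (diag_mx (pt (t ^+ 3) t 1)).
Proof.
move=> t7; have t1 : t ^+ 6 * t = 1 by rewrite -exprSr.
have dd : diag_mx (pt (t ^+ 3) t 1) *m diag_mx (pt (t ^+ 4) (t ^+ 6) 1) = 1%:M.
  apply: mx3_eq => x y z; rewrite mulmxA !mul_diag mulmx1; apply: row3P; rewrite !ptE ?mulr1 //.
    by rewrite -mulrA -exprD t7 mulr1.
  by rewrite -mulrA [t * _]mulrC t1 mulr1.
have t30 : t ^+ 3 != 0.
  by apply/eqP => t0; move: t7; rewrite -[7%N]/(3 + 4)%N exprD t0 mul0r => /esym/eqP; rewrite oner_eq0.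
apply: (linear_aut_eval (Klein_homog K) dd t30) => p; rewrite mul_diag !Klein_eval !ptE.
move: (p 0 ord0) (p 0 i1) (p 0 i2) => x y z.
transitivity (t ^+ 3 * (t ^+ 7 * x ^+ 3 * y + y ^+ 3 * z + z ^+ 3 * x)); first by ring.
by rewrite t7 mul1r.
Qed.

(* The commutator of the cyclic permutation with a diagonal automorphism is again such a diagonal matrix. *)
Lemma Klein_diag_in_Gamma t : t ^+ 7 = 1 -> Gamma (lin F (diag_mx (pt (t ^+ 3) t 1))).
Proof.
move=> t7; have [r [r7 rt]] : exists r, r ^+ 7 = 1 /\ r * t = 1.
  by exists (t ^+ 6); rewrite -exprSr -exprM mulnC exprM t7 expr1n.
have aD := Klein_diag_aut r7.
have r3 : r ^+ 3 * t ^+ 3 = 1 by rewrite -exprMn rt expr1n.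
have dd : diag_mx (pt (r ^+ 3) r 1) *m diag_mx (pt (t ^+ 3) t 1) = 1%:M.
  apply: mx3_eq => x y z; rewrite mulmxA !mul_diag mulmx1; apply: row3P; rewrite !ptE ?mulr1 //.
    by rewrite -mulrA r3 mulr1.
  by rewrite -mulrA rt mulr1.
have [_ iD] := invmx_eq dd; have t0 : t != 0 by apply: contra_eq_neq rt => ->; rewrite mulr0 eq_sym oner_neq0.
have r0 : r != 0 by apply: contra_eq_neq rt => ->; rewrite mul0r eq_sym oner_neq0.
have aC := conj_mx_aut cyc'_aut aD.
have := qgM d_gt3 smF cyc_aut aC cyc_in_Gamma (qg_conj d_gt3 smF cyc'_aut aD cyc'_in_Gamma).
have -> : cyc *m (invmx (diag_mx (pt (r ^+ 3) r 1)) *m cyc' *m diag_mx (pt (r ^+ 3) r 1)) =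
    t *: diag_mx (pt (t ^+ 3) t 1).
  apply: mx3_eq => x y z; rewrite iD -scalemxAr !mulmxA !(mul_diag, mul_cyc, mul_cyc'); apply: row3P; rewrite scale_row !ptE.
  - transitivity (x * r ^+ 3 * t ^+ 7); first by rewrite t7; ring.
    by transitivity (t * (x * t ^+ 3) * (r ^+ 3 * t ^+ 3)); [ring|rewrite r3; ring].
  - by transitivity (y * t ^+ 2 * (r * t)); [ring|rewrite rt; ring].
  by ring.
by rewrite (lin_scale d_gt3 smF t0) //; exact: Klein_diag_aut.
Qed.

Let e2' : 'rV[K]_3 := pt 0 0 1.

Lemma Klein_e2 : curve_points F e2'.
Proof.
apply/curve_pointsP; split; first by apply: (@pt_neq0 _ _ _ _ i2); rewrite ptE oner_neq0.
by rewrite Klein_eval !ptE; ring.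
Qed.

(** The tangent X = 0 at (0 : 0 : 1) meets C again only at (0 : 1 : 0), whose tangent Z = 0 meets C
    again only at (1 : 0 : 0). So M fixes the three coordinate points and is diagonal, and A^3 B =
    B^3 C = C^3 A gives (B / C)^3 = A / C and (B / C)^7 = 1. *)
Lemma Klein_stabilizer M : linear_aut F M -> collinear (e2' *m M) e2' -> Gamma (lin F M).
Proof.
move=> aM col; have [uM [m m0 eM]] := aM.
have e2_neq0 : e2' != 0 by case/curve_pointsP: Klein_e2.
have [C eC] := collinear_scale_mid e2_neq0 col.
have rE j : M i2 j = C * e2' 0 j.
  have := congr1 (fun v : 'rV[K]_3 => v 0 j) eC; rewrite mul_row3 scale_row !ptE => <-; ring.
have r20 : M i2 ord0 = 0 by rewrite rE ptE mulr0.
have r21 : M i2 i1 = 0 by rewrite rE ptE mulr0.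
have r22 : M i2 i2 = C by rewrite rE ptE mulr1.
have FM x : F.[: x *m M] = m * F.[: x] by rewrite -eval_lsub eM mevalZ.
have dM p v : dgrad F (p *m M) (v *m M) = m * dgrad F p v by rewrite -dgrad_lsub eM dgradZ.
have C0 : C != 0 by apply: contraTneq e2_neq0 => C0; rewrite -[e2'](mulmxK uM) eC C0 scale0r mul0mx eqxx.
have r10 : M i1 ord0 = 0.
  have := dM e2' (pt 0 1 0); rewrite !Klein_dgrad !mul_row3 !ptE r20 r21 r22 => E.
  have : C ^+ 3 * M i1 ord0 = 0 by apply: etrans (etrans _ E) _; ring.
  by move/eqP; rewrite mulf_eq0 expf_eq0 (negPf C0) => /eqP.
have r11 : M i1 i1 != 0.
  apply/eqP => B0; have e : pt 0 C (- M i1 i2) *m M = 0.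
    by apply: row3P; rewrite mul_row3 !ptE ?r20 ?r21 ?r22 ?r10 ?B0 mxE; ring.
  have := mulmxK uM (pt 0 C (- M i1 i2)); rewrite e mul0mx => /(congr1 (fun v : 'rV[K]_3 => v 0 i1)).
  by rewrite mxE ptE => /esym/eqP; rewrite (negPf C0).
have r12 : M i1 i2 = 0.
  have := FM (pt 0 1 0); rewrite !Klein_eval !mul_row3 !ptE r20 r21 r10 => E.
  have : M i1 i1 ^+ 3 * M i1 i2 = 0 by apply: etrans (etrans _ E) _; ring.
  by move/eqP; rewrite mulf_eq0 expf_eq0 (negPf r11) => /eqP.
have r02 : M ord0 i2 = 0.
  have := dM (pt 0 1 0) (pt 1 0 0); rewrite !Klein_dgrad !mul_row3 !ptE r10 r12 => E.
  have : M i1 i1 ^+ 3 * M ord0 i2 = 0 by apply: etrans (etrans _ E) _; ring.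
  by move/eqP; rewrite mulf_eq0 expf_eq0 (negPf r11) => /eqP.
have CA : C ^+ 3 * M ord0 ord0 = m.
  by have E := dM e2' (pt 1 0 0); rewrite !Klein_dgrad !mul_row3 !ptE r20 r21 r22 in E; apply: etrans (etrans _ E) _; ring.
have A0 : M ord0 ord0 != 0 by apply: contraNneq m0 => A0; rewrite -CA A0 mulr0.
have r01 : M ord0 i1 = 0.
  have := FM (pt 1 0 0); rewrite !Klein_eval !mul_row3 !ptE r02 => E.
  have : M ord0 ord0 ^+ 3 * M ord0 i1 = 0 by apply: etrans (etrans _ E) _; ring.
  by move/eqP; rewrite mulf_eq0 expf_eq0 (negPf A0) => /eqP.
have xM (x y z : K) : pt x y z *m M = pt (x * M ord0 ord0) (y * M i1 i1) (z * C).
  by apply: row3P; rewrite mul_row3 !ptE ?r01 ?r02 ?r10 ?r12 ?r20 ?r21 ?r22; ring.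
move: (M ord0 ord0) (M i1 i1) r11 A0 CA xM {r01 r02 r10 r12 r20 r21 r22 rE} => A B B0 A0 CA xM.
have BC : B ^+ 3 * C = m.
  by have E := FM (pt 0 1 1); rewrite xM !Klein_eval !ptE in E; apply: etrans (etrans _ E) _; ring.
have AB : A ^+ 3 * B = m.
  by have E := FM (pt 1 1 0); rewrite xM !Klein_eval !ptE in E; apply: etrans (etrans _ E) _; ring.
have e3 : (B / C) ^+ 3 = A / C.
  by apply: (mulIf (expf_neq0 4 C0)); transitivity (B ^+ 3 * C); [field|rewrite BC -CA; field].
have t7 : (B / C) ^+ 7 = 1.
  apply: (mulIf (expf_neq0 2 (mulf_neq0 B0 C0))); rewrite mul1r.
  transitivity (((B / C) ^+ 3) ^+ 3 * C ^+ 4); first by field.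
  rewrite e3; transitivity (A ^+ 3 * B * C / B); first by field; rewrite ?B0 ?C0.
  by rewrite AB -BC; field.
have -> : M = C *: diag_mx (pt ((B / C) ^+ 3) (B / C) 1).
  by rewrite e3; apply: mx3_eq => x y z; rewrite xM -scalemxAr mul_diag; apply: row3P; rewrite scale_row !ptE; field.
rewrite (lin_scale d_gt3 smF C0); [exact: Klein_diag_in_Gamma|exact: Klein_diag_aut].
Qed.

Theorem Klein_from_root (z : K) : 1 + z + z ^+ 2 + z ^+ 3 + z ^+ 4 + z ^+ 5 + z ^+ 6 = 0 -> curve_Aut F = Gamma.
Proof.
move=> hz; have z7 : z ^+ 7 = 1.
  by apply/subr0_eq; rewrite -[RHS](mul0r (z - 1)) -hz; ring.
have z1 : z - 1 != 0.
  apply/eqP => /subr0_eq z1; have : 7%:R = 0 :> K by rewrite -[RHS]hz z1; ring.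
  by move/eqP; rewrite (negPf (n0 6)).
have z3 : z ^+ 3 - 1 != 0.
  apply: contraNneq z1 => /subr0_eq e; move: z7; rewrite -[7%N]/(3 * 2).+1 exprS exprM e expr1n mulr1 => ->.
  by rewrite subrr.
have z31 : z ^+ 3 - z != 0.
  have zn : z != 0 by apply: contra_eq_neq z7 => ->; rewrite expr0n /= eq_sym oner_neq0.
  apply: contraNneq z1 => /subr0_eq e; have e' : z ^+ 2 = 1 by apply: (mulfI zn); rewrite -exprS e mulr1.
  by move: z7; rewrite -[7%N]/(2 * 3).+1 exprS exprM e' expr1n mulr1 => ->; rewrite subrr.
pose e0 : 'rV[K]_3 := pt 1 0 0; pose e1 : 'rV[K]_3 := pt 0 1 0.
(* The eigenvalues z^3, z and 1 are distinct, so only the three coordinate points are fixed; the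
   cyclic permutations, which lie in Gamma, carry one to the others. *)
have fixed x : curve_points F x -> collinear (x *m diag_mx (pt (z ^+ 3) z 1)) x ->
    exists2 t, t != 0 & [\/ x = t *: e0, x = t *: e1 | x = t *: e2'].
  move=> /curve_pointsP [x0 _] col; move: (col ord0 i1) (col ord0 i2) (col i1 i2); rewrite mul_diag !ptE.
  move: (pt_eta x) x0; move: (x 0 ord0) (x 0 i1) (x 0 i2) => u v w -> x0 h1 h2 h3.
  have uv : u * v = 0 by apply: (mulIf z31); rewrite mul0r -[RHS](subrr (u * z ^+ 3 * v)) {2}h1; ring.
  have uw : u * w = 0 by apply: (mulIf z3); rewrite mul0r -[RHS](subrr (u * z ^+ 3 * w)) {2}h2; ring.
  have vw : v * w = 0 by apply: (mulIf z1); rewrite mul0r -[RHS](subrr (v * z * w)) {2}h3; ring.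
  have [u0|u0] := eqVneq u 0.
    have [v0|v0] := eqVneq v 0.
      have w0 : w != 0 by apply: contraNneq x0 => ->; rewrite u0 v0; apply/eqP; apply: row3P; rewrite ptE mxE.
      by exists w => //; constructor 3; apply: row3P; rewrite scale_row !ptE ?u0 ?v0; ring.
    have w0 : w = 0 by apply: (mulfI v0); rewrite vw mulr0.
    by exists v => //; constructor 2; apply: row3P; rewrite scale_row !ptE ?u0 ?w0; ring.
  have v0 : v = 0 by apply: (mulfI u0); rewrite uv mulr0.
  have w0 : w = 0 by apply: (mulfI u0); rewrite uw mulr0.
  by exists u => //; constructor 1; apply: row3P; rewrite scale_row !ptE ?v0 ?w0; ring.
have E1 : e2' *m cyc = e1 by rewrite mul_cyc; apply: row3P; rewrite !ptE.
have E0 : e2' *m cyc' = e0 by rewrite mul_cyc'; apply: row3P; rewrite !ptE.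
have n_0 : e0 != 0 by apply: (@pt_neq0 _ _ _ _ ord0); rewrite ptE oner_neq0.
have n_1 : e1 != 0 by apply: (@pt_neq0 _ _ _ _ i1); rewrite ptE oner_neq0.
have n_2 : e2' != 0 by case/curve_pointsP: Klein_e2.
have gG := Klein_diag_in_Gamma z7; have ga := Klein_diag_aut z7.
apply: (aut_is_quasi_galois d_gt3 smF (pr := 7) (vs := [:: e0; e1; e2']) (Klein_hessian_nonvanishing char0) Klein_e2 _ _ ga gG) => //.
- by rewrite eval_hessian det_mx3 !Klein_hess !ptE; ring.
- exists 1; split; first exact: oner_neq0.
  have dk k : diag_mx (pt (z ^+ 3) z 1) ^+ k = diag_mx (pt ((z ^+ 3) ^+ k) (z ^+ k) 1).
    elim: k => [|k IH]; apply: mx3_eq => x y w; first by rewrite expr0 mulmx1 mul_diag !ptE !expr0 !mulr1.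
    by rewrite exprS -mulmxE mulmxA mul_diag IH !mul_diag !ptE !exprS !mulr1 !mulrA.
  rewrite dk -exprM mulnC exprM z7 expr1n.
  by apply: mx3_eq => x y w; rewrite mul_diag mulmx1 !ptE !mulr1.
- by move=> i j; rewrite mul_diag !mxE; case: (ord3P i) => ->; case: (ord3P j) => -> /=; ring.
- move=> x Cx /(fixed x Cx) [t t0 [->|->|->]].
  + by exists cyc'; split; [exact: cyc'_aut|exact: cyc'_in_Gamma|rewrite E0; exact: collinearZr].
  + by exists cyc; split; [exact: cyc_aut|exact: cyc_in_Gamma|rewrite E1; exact: collinearZr].
  by exists 1%:M; split; [exact: linear_aut1|exact: qg1|rewrite mulmx1; exact: collinearZr].
- move=> x Cx /(fixed x Cx) [t t0 [->|->|->]]; [exists e0|exists e1|exists e2']; rewrite ?inE ?eqxx ?orbT //;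
    split=> //; apply: collinear_sym; exact: collinearZr.
exact: Klein_stabilizer.
Qed.

End KleinInvolution.

Theorem Klein_quasi_galois (K : closedFieldType) : [pchar K] =i pred0 ->
  curve_Aut (Klein_quartic K) = quasi_galois_group (Klein_quartic K) 2.
Proof.
(* A root of the seventh cyclotomic polynomial, from which the numbers a, b, c of the involution are
   built. *)
move=> char0; have [z ez] := @solve_monicpoly K 6 (fun=> - 1) isT.
have hz : 1 + z + z ^+ 2 + z ^+ 3 + z ^+ 4 + z ^+ 5 + z ^+ 6 = 0.
  by rewrite ez !big_ord_recl big_ord0 /= /bump /=; ring.
apply: (Klein_from_root char0 _ (e2_eq0 hz) (cubic_eq0 hz) (s_sqr hz) (abc_eq hz) (quadric_eq7 hz) (quintic_eq hz) (polar_eq0 hz) hz).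
by [].
Qed.

Theorem theorem3p12 (K : closedFieldType) (char_neq2 : 2%N \notin [pchar K]) :
  (forall (d : nat) (F : {mpoly K[3]}),
     (4 <= d)%N -> smooth_plane_curve d F ->
     forall (gT : finGroupType) (G : {group gT}) (phi : gT -> ratmap K 3),
       group_iso F G (curve_Aut F) phi -> simple G -> ~~ odd #|G| ->
       exists n : nat, [/\ (2 <= n)%N, ~~ odd n & curve_Aut F = quasi_galois_group F n])
  /\
  ([pchar K] =i pred0 ->
     curve_Aut (Klein_quartic K) = quasi_galois_group (Klein_quartic K) 2 /\
     curve_Aut (Wiman_sextic K) = quasi_galois_group (Wiman_sextic K) 2).
Proof.
split=> [d F d_ge4 smF gT G phi|char0]; first exact: (simple_even_aut d_ge4 smF).
by split; [exact: Klein_quasi_galois|exact: Wiman_quasi_galois].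
Qed.
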